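(* Let $K$ be a non-degenerate Calderón–Zygmund kernel on $\mathbb{R}^d$, let $k\in\{1,2,\ldots\}$ and $b\in L^k_{\mathrm{loc}}(\mathbb{R}^d;\mathbb{R})$. Let $p\in(1,\infty)$, let $\lambda,\mu\in A_p(\mathbb{R}^d)$, let $\kappa>0$ be a constant, and suppose that, for some $\Theta\geq0$, $$|\langle T_b^kf,g\rangle|=\Big|\iint(b(x)-b(y))^kK(x,y)f(y)g(x)\,dy\,dx\Big|\leq\Theta\cdot\|f\|_\infty\,\mu(B)^{1/p}\cdot\|g\|_\infty\,\lambda'(\tilde B)^{1/p'}$$ whenever $f\in L^\infty(B)$ and $g\in L^\infty(\tilde B)$ for any two balls $B,\tilde B$ of equal radius $r$ and distance $\operatorname{dist}(B,\tilde B)\geq\kappa r$. Then $b\in\mathrm{BMO}(\nu^{1/k})$, where $\nu=(\mu/\lambda)^{1/p}$, and more precisely $$\|b\|_{\mathrm{BMO}(\nu^{1/k})}\leq C\,\Theta^{1/k},$$ where $C$ depends only on $d,p,k,K,\kappa,\lambda,\mu$ (not on $b$ or $\Theta$).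
   Context: $b$ is real-valued; $K,f,g$ may be complex-valued. $p'=p/(p-1)$; for a ball $B$, $L^\infty(B)=\{f\in L^\infty(\mathbb{R}^d):f=1_Bf\}$. $\langle T_b^kf,g\rangle$ is only an abbreviation for the displayed integral; no boundedness of an operator $T$ is assumed. The Muckenhoupt class $A_p(\mathbb{R}^d)$ consists of $w\in L^1_{\mathrm{loc}}(\mathbb{R}^d)$, $w>0$ a.e., with $[w]_{A_p}:=\sup_B\big(\frac1{|B|}\int_Bw\big)\big(\frac1{|B|}\int_Bw^{-\frac1{p-1}}\big)^{p-1}<\infty$ (supremum over balls). The dual weight is $w'=w^{-\frac1{p-1}}$, and $w(B)=\int_Bw$. Moreover $\|b\|_{\mathrm{BMO}(\nu^{1/k})}=\sup_B\frac1{\nu^{1/k}(B)}\int_B|b-\langle b\rangle_B|$ over all balls, with $\langle b\rangle_B=\frac1{|B|}\int_Bb$, and $b\in\mathrm{BMO}(\nu^{1/k})$ means this is finite. An $\omega$-Calderón–Zygmund kernel is a measurable $K(x,y)$, $x\neq y$, with $|K(x,y)|\leq c_K|x-y|^{-d}$ and $$|K(x,y)-K(x',y)|+|K(y,x)-K(y,x')|\leq\frac1{|x-y|^d}\omega\Big(\frac{|x-x'|}{|x-y|}\Big)\quad\text{whenever }|x-x'|<\tfrac12|x-y|,$$ with $\omega:[0,1)\to[0,\infty)$ increasing. $K$ is a non-degenerate Calderón–Zygmund kernel if at least one of the following holds: (i) $K$ is an $\omega$-Calderón–Zygmund kernel with $\omega(t)\to0$ as $t\to0$, and for some $c_0>0$,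 for every $y\in\mathbb{R}^d$ and $r>0$ there exists $x\in B(y,r)^c$ with $|K(x,y)|\geq\frac1{c_0r^d}$; (ii) $K(x,y)=\frac{\Omega(x-y)}{|x-y|^d}$ where $\Omega(tx)=\Omega(x)$ for all $t>0$, and $\Omega\in L^1(S^{d-1})\setminus\{0\}$. *)

(* Defs.v *)
From HB Require Import structures.
From mathcomp Require Import all_boot all_order all_algebra.
From mathcomp Require Import complex.
From mathcomp Require Import all_classical all_reals all_analysis.
From mathcomp Require Import measurable_realfun.

Set Implicit Arguments.
Unset Strict Implicit.
Unset Printing Implicit Defensive.

Import Order.TTheory GRing.Theory Num.Theory.
Import numFieldNormedType.Exports.

Local Open Scope classical_set_scope.
Local Open Scope ring_scope.

Definition rV_display : measure_display. Proof. by constructor. Qed.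

Section measurable_rV.
Context {R : realType} {n : nat}.

Let coors : 'I_n -> 'rV[R]_n -> R := fun i x => x ord0 i.

Let rV_set0 : g_sigma_preimage coors set0.
Proof. exact: sigma_algebra0. Qed.

Let rV_setC A : g_sigma_preimage coors A -> g_sigma_preimage coors (~` A).
Proof. exact: sigma_algebraC. Qed.

Let rV_bigcup (F : (set 'rV[R]_n)^nat) :
  (forall i, g_sigma_preimage coors (F i)) ->
  g_sigma_preimage coors (\bigcup_i (F i)).
Proof. exact: sigma_algebra_bigcup. Qed.

(* The sigma-algebra generated by the coordinates, as the library does for
   tuples; over the reals it is the Borel sigma-algebra. *)
HB.instance Definition _ := @isMeasurable.Build rV_display
  'rV[R]_n (g_sigma_preimage coors) rV_set0 rV_setC rV_bigcup.

Lemma measurable_coord (i : 'I_n) :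
  measurable_fun setT (fun x : 'rV[R]_n => x ord0 i).
Proof.
move=> _ Y mY; rewrite setTI; apply: sub_sigma_algebra => /=.
rewrite -bigcup_seq/=; exists i => /=; first by rewrite mem_index_enum.
by exists Y => //; rewrite setTI.
Qed.

Lemma measurable_fun_rVP d (T : measurableType d) (f : T -> 'rV[R]_n) :
  measurable_fun setT f <->
  forall i, measurable_fun setT (fun x => f x ord0 i).
Proof.
split=> [mf i|mf].
  exact: (measurableT_comp (measurable_coord i) mf).
move=> _ A mA; rewrite setTI.
suff: g_sigma_preimage (fun i => coors i \o f) `<=` measurable.
  by rewrite g_sigma_preimage_comp; apply; exists A => //; rewrite setTI.
apply: smallest_sub; first exact: sigma_algebra_measurable.
rewrite -bigcup_seq; apply: bigcup_sub => i _ B [C mC <-].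
exact: mf.
Qed.

End measurable_rV.

Section lebesgue_rV.
Context {R : realType}.

Definition rV_cons n (z : measurableTypeR R * 'rV[R]_n) : 'rV[R]_n.+1 :=
  \row_i oapp (z.2 ord0) z.1 (unlift ord0 i).

Definition rV_uncons n (x : 'rV[R]_n.+1) : measurableTypeR R * 'rV[R]_n :=
  (x ord0 ord0, \row_i x ord0 (lift ord0 i)).

Lemma rV_consK n : cancel (@rV_cons n) (@rV_uncons n).
Proof.
move=> [a x]; rewrite /rV_uncons /rV_cons !mxE unlift_none/=; congr pair.
by apply/rowP => i; rewrite !mxE liftK.
Qed.

Lemma rV_unconsK n : cancel (@rV_uncons n) (@rV_cons n).
Proof.
move=> x; apply/rowP => i; rewrite !mxE.
by case: unliftP => [j ->|->] //=; rewrite mxE.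
Qed.

Lemma measurable_rV_cons n : measurable_fun setT (@rV_cons n).
Proof.
apply/measurable_fun_rVP => i; case: (unliftP ord0 i) => [j ->|->].
  rewrite (_ : (fun _ => _) = (fun x : 'rV[R]_n => x ord0 j) \o snd).
    by apply: measurableT_comp => //; exact: measurable_coord.
  by apply/funext => -[a x]/=; rewrite mxE liftK.
rewrite (_ : (fun _ => _) = fst)//.
by apply/funext => -[a x]/=; rewrite mxE unlift_none.
Qed.

Lemma measurable_rV_uncons n : measurable_fun setT (@rV_uncons n).
Proof.
apply/measurable_fun_pairP; split => /=; first exact: measurable_coord.
apply/measurable_fun_rVP => i.
rewrite (_ : (fun _ => _) = (fun x : 'rV[R]_n.+1 => x ord0 (lift ord0 i))).
  exact: measurable_coord.
by apply/funext => x; rewrite /= mxE.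
Qed.

Section lebS.
Context {n : nat} (m : {sigma_finite_measure set 'rV[R]_n -> \bar R}).

(* Product of the Lebesgue measure on [R] and of [m], carried over to
   [R^(n+1)]. *)
Definition lebS : set 'rV[R]_n.+1 -> \bar R :=
  pushforward (lebesgue_measure \x m)%E (@rV_cons n).

Let lebS0 : lebS set0 = 0%E.
Proof. by rewrite /lebS /pushforward preimage_set0 measure0. Qed.

Let lebS_ge0 A : (0 <= lebS A)%E.
Proof. by rewrite /lebS /pushforward measure_ge0. Qed.

Let lebS_additive : semi_sigma_additive lebS.
Proof.
move=> F mF tF mUF; rewrite /lebS /pushforward preimage_bigcup.
have mpre A : measurable A -> measurable (@rV_cons n @^-1` A).
  by move=> mA; rewrite -[X in measurable X]setTI; exact: measurable_rV_cons.
apply: measure_semi_sigma_additive.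
- by move=> k; exact: mpre.
- apply/trivIsetP => /= i j _ _ ij; rewrite -preimage_setI.
  by move/trivIsetP : tF => /(_ _ _ _ _ ij) ->//; rewrite preimage_set0.
- by rewrite -preimage_bigcup; exact: mpre.
Qed.

HB.instance Definition _ := isMeasure.Build _ _ _
  lebS lebS0 lebS_ge0 lebS_additive.

Let lebS_sigma_finite : sigma_finite setT lebS.
Proof.
have /sigma_finiteP[F [TF ndF Foo]] := sigma_finiteT (@lebesgue_measure R).
have /sigma_finiteP[G [TG ndG Goo]] := sigma_finiteT m.
exists (fun k => @rV_uncons n @^-1` (F k `*` G k)).
  rewrite -preimage_bigcup -[LHS](preimage_setT (@rV_uncons n)).
  congr (_ @^-1` _); apply/esym/seteqP; split => // -[x y] _.
  have [i _ Fix] : (\bigcup_i F i) x by rewrite -TF.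
  have [j _ Gjy] : (\bigcup_i G i) y by rewrite -TG.
  exists (maxn i j) => //; split.
    by move: x Fix; exact/subsetPset/ndF/leq_maxl.
  by move: y Gjy; exact/subsetPset/ndG/leq_maxr.
move=> k; have [mF Fk] := Foo k; have [mG Gk] := Goo k; split.
  rewrite -[X in measurable X]setTI.
  by apply: measurable_rV_uncons => //; exact: measurableX.
rewrite /lebS /pushforward -comp_preimage (_ : _ \o _ = id); last first.
  by apply/funext => z; exact: rV_consK.
by rewrite preimage_id product_measure1E// lte_mul_pinfty// ge0_fin_numE.
Qed.

HB.instance Definition _ := Measure_isSigmaFinite.Build _ _ _ lebS
  lebS_sigma_finite.

End lebS.

(* Lebesgue measure on [R^n]; [R^0] is a point of mass one. *)
Fixpoint leb n : {sigma_finite_measure set 'rV[R]_n -> \bar R} :=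
  match n with
  | 0%N => \d_(0 : 'rV[R]_0)
  | n.+1 => lebS (leb n)
  end.

Lemma leb_box n (A : 'I_n -> set R) : (forall i, measurable (A i)) ->
  leb n [set x | forall i, A i (x ord0 i)] =
  (\prod_(i < n) lebesgue_measure (A i))%E.
Proof.
elim: n A => [|n IHn] A mA.
  rewrite big_ord0 /= diracE mem_set//= => -[]//.
rewrite big_ord_recl /= /lebS /pushforward.
rewrite [X in (_ \x _)%E X](_ : _ = A ord0 `*`
  [set x : 'rV[R]_n | forall i, A (lift ord0 i) (x ord0 i)]).
  rewrite product_measure1E//; last first.
    rewrite (_ : [set _ | _] = \bigcap_(i in [set: 'I_n])
        ((fun x : 'rV[R]_n => x ord0 i) @^-1` A (lift ord0 i))).
      apply: fin_bigcap_measurable => // i _.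
      rewrite -[X in measurable X]setTI.
      exact: measurable_coord.
    by apply/seteqP; split => x /= h i; [move=> _|]; exact: h.
    exact: mA.
  congr (_ * _)%E.
  by apply: (IHn (fun i => A (lift ord0 i))) => i; exact: mA.
apply/seteqP; split => -[a x] /=.
  move=> h; split; first by have := h ord0; rewrite mxE unlift_none.
  by move=> i; have := h (lift ord0 i); rewrite mxE liftK.
move=> [Aa Ax] i; rewrite mxE.
by case: unliftP => [j ->|->]/=; [exact: Ax|].
Qed.

End lebesgue_rV.

Section euclidean.
Context {R : realType} {d : nat}.
Implicit Types (x y c : 'rV[R]_d) (A B : set 'rV[R]_d).

(* The library's norm on row vectors is the sup norm. *)
Definition enorm x : R := Num.sqrt (\sum_(i < d) x ord0 i ^+ 2).

Definition eball c (r : R) : set 'rV[R]_d := [set x | enorm (x - c) < r].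

Definition setdist A B : R := inf [set enorm (x - y) | x in A & y in B].

Definition sphere : set 'rV[R]_d := [set x | enorm x = 1].

Definition direction x : 'rV[R]_d := (enorm x)^-1 *: x.

Definition punctured_ball : set 'rV[R]_d := [set x | 0 < enorm x <= 1].

Lemma measurable_enorm : measurable_fun setT enorm.
Proof.
have msum : measurable_fun setT (fun x => \sum_(i < d) x ord0 i ^+ 2).
  apply: measurable_sum => i.
  by apply: measurable_funX; exact: measurable_coord.
apply: (measurableT_comp _ msum).
exact: continuous_measurable_fun (@sqrt_continuous R).
Qed.

Lemma measurable_direction : measurable_fun setT direction.
Proof.
apply/measurable_fun_rVP => i.
rewrite (_ : (fun _ => _) = (fun x => enorm x `^ (-1) * x ord0 i)).
  apply: measurable_funM; last exact: measurable_coord.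
  exact: (measurableT_comp (measurable_powR (-1)) measurable_enorm).
by apply/funext => x; rewrite mxE powR_inv1 ?sqrtr_ge0.
Qed.

Lemma measurable_punctured_ball : measurable punctured_ball.
Proof.
rewrite (_ : punctured_ball = setT `&` enorm @^-1` `]0, 1]).
  by apply: measurable_enorm => //; exact: measurable_itv.
by rewrite setTI; apply/seteqP; split => x; rewrite /preimage/= in_itv.
Qed.

(* Surface measure of the unit sphere, as the cone measure
   sigma(E) = d |{x : 0 < |x| <= 1, x/|x| in E}| of polar coordinates. *)
Definition surface (E : set 'rV[R]_d) : \bar R :=
  (d%:R%:E * leb d (direction @^-1` E `&` punctured_ball))%E.

Let surface0 : surface set0 = 0%E.
Proof. by rewrite /surface preimage_set0 set0I measure0 mule0. Qed.

Let surface_ge0 E : (0 <= surface E)%E.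
Proof. by rewrite /surface mule_ge0// lee_fin. Qed.

Let surface_additive : semi_sigma_additive surface.
Proof.
move=> F mF tF mUF.
have mpre E : measurable E -> measurable (direction @^-1` E).
  by move=> mE; rewrite -[X in measurable X]setTI; exact: measurable_direction.
have := @measure_semi_sigma_additive _ _ _
  (mscale (d%:R)%:nng (mrestr (leb d) measurable_punctured_ball))
  (fun k => direction @^-1` F k).
rewrite -preimage_bigcup; apply.
- by move=> k; exact: mpre.
- apply/trivIsetP => /= i j _ _ ij; rewrite -preimage_setI.
  by move/trivIsetP : tF => /(_ _ _ _ _ ij) ->//; rewrite preimage_set0.
- exact: mpre.
Qed.

HB.instance Definition _ := isMeasure.Build _ _ _
  surface surface0 surface_ge0 surface_additive.

End euclidean.

Arguments surface {R d}.

Section complex_integral.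
Context {R : realType} d {T : measurableType d}.
Variable m : {measure set T -> \bar R}.
Implicit Types (D : set T) (F : T -> R[i]).

Definition cmeasurable D F :=
  measurable_fun D (fun x => complex.Re (F x)) /\
  measurable_fun D (fun x => complex.Im (F x)).

Definition cintegrable D F :=
  m.-integrable D (fun x => (complex.Re (F x))%:E) /\
  m.-integrable D (fun x => (complex.Im (F x))%:E).

Definition cintegral F : R[i] :=
  Complex (\int[m]_x complex.Re (F x)) (\int[m]_x complex.Im (F x)).

Definition Linfty_norm F : \bar R :=
  'N[m]_+oo[EFin \o @Normc.normc R \o F]%E.

(* L^oo(B): membership and the identity f = 1_B f are those of equivalence
   classes modulo null sets. *)
Definition Linfty_on D F :=
  [/\ cmeasurable setT F, (Linfty_norm F < +oo)%E &
      {ae m, forall x, F x = ((\1_D x : R)%:C)%C * F x}].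

End complex_integral.

Section weights.
Context {R : realType} {d : nat}.
Implicit Types (w b : 'rV[R]_d -> R) (B : set 'rV[R]_d).

Definition Lloc (k : nat) b :=
  measurable_fun setT b /\
  forall K : set 'rV[R]_d, compact K ->
    (\int[leb d]_(x in K) (`|b x| ^+ k)%:E < +oo)%E.

Definition weight w B : \bar R := (\int[leb d]_(x in B) (w x)%:E)%E.

Definition dual_weight (p : R) w : 'rV[R]_d -> R :=
  fun x => w x `^ (- (p - 1)^-1).

Definition Ap_const (p : R) w : \bar R :=
  ereal_sup [set (weight w (eball c r) / leb d (eball c r) *
    (weight (dual_weight p w) (eball c r) / leb d (eball c r))
      `^ (p - 1))%E | c in setT & r in [set r | 0 < r]].

Definition Ap (p : R) w :=
  [/\ Lloc 1 w, {ae leb d, forall x, 0 < w x} & (Ap_const p w < +oo)%E].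

Definition average b B : R := (\int[leb d]_(x in B) b x) / fine (leb d B).

Definition BMO_norm w b : \bar R :=
  ereal_sup [set ((\int[leb d]_(x in eball c r)
      `|b x - average b (eball c r)|%:E) / weight w (eball c r))%E
    | c in setT & r in [set r | 0 < r]].

Definition BMO w b : Prop := (BMO_norm w b < +oo)%E.

End weights.

Section kernels.
Context {R : realType} {d : nat}.
(* The values of a kernel on the diagonal are irrelevant. *)
Implicit Types K : 'rV[R]_d -> 'rV[R]_d -> R[i].

Local Notation normc := Normc.normc.

Definition CZ_kernel (omega : R -> R) K :=
  [/\ cmeasurable [set z : 'rV[R]_d * 'rV[R]_d | z.1 != z.2]
        (fun z => K z.1 z.2),
      (forall t, 0 <= t < 1 -> 0 <= omega t),
      (forall s t, 0 <= s -> s <= t -> t < 1 -> omega s <= omega t),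
      (exists cK : R, forall x y, x != y ->
         normc (K x y) <= cK * enorm (x - y) ^- d) &
      (forall x x' y, enorm (x - x') < 2^-1 * enorm (x - y) ->
         normc (K x y - K x' y) + normc (K y x - K y x') <=
         enorm (x - y) ^- d * omega (enorm (x - x') / enorm (x - y)))].

Definition nondegenerate_CZ K :=
  (exists omega : R -> R,
     [/\ CZ_kernel omega K, omega t @[t --> 0^'+] --> (0 : R) &
         exists2 c0 : R, 0 < c0 & forall y r, 0 < r ->
           exists2 x, (~` eball y r) x &
             (c0 * r ^+ d)^-1 <= normc (K x y)]).

Definition nondegenerate_rough K :=
  exists Omega : 'rV[R]_d -> R[i],
    [/\ forall t x, 0 < t -> Omega (t *: x) = Omega x,
        cintegrable surface sphere Omega,
        ~ {ae surface, forall x, sphere x -> Omega x = 0} &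
        forall x y, x != y ->
          K x y = Omega (x - y) * ((enorm (x - y) ^- d)%:C)%C].

Definition nondegenerate_kernel K := nondegenerate_CZ K \/ nondegenerate_rough K.

Definition commutator_form (k : nat) (b : 'rV[R]_d -> R) K
    (f g : 'rV[R]_d -> R[i]) : R[i] :=
  cintegral (leb d) (fun x => cintegral (leb d) (fun y =>
    (((b x - b y) ^+ k)%:C)%C * K x y * f y * g x)).

End kernels.

(* Main.v *)
Require Import Defs.
From HB Require Import structures.
From mathcomp Require Import all_boot all_order all_algebra.
From mathcomp Require Import complex.
From mathcomp Require Import all_classical all_reals all_analysis.
From mathcomp Require Import measurable_realfun ess_sup_inf ring lra.

(** The proof tests the commutator form on halves of two balls. Every ball [B] of
radius [r] has a companion [B'] of the same radius, at a distance comparable to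
[r], such that [K] is close, in mean, to a constant [K0] of size [r^-d] on
[B' x B]. For a Calderon-Zygmund kernel this is the modulus of continuity at a
large scale. For a rough kernel [K0] comes from a point of approximate continuity
of the homogeneous kernel, dilated to scale [r]; such a point exists by averaging,
because small translations move a set of finite measure by little.

Let [alpha] and [beta] be medians of [b] on [B] and [B'], and write
[b y - b x = (b y - alpha) + (beta - b x) + (alpha - beta)]. On suitable halves of
[B] and [B'] the first two summands have the sign of [alpha - beta], nothing
cancels, and the form controls both [|b - alpha|^k] on that half of [B] and
[|alpha - beta|^k]. On the opposite halves the third summand has the wrong sign,
but it has just been estimated. Hence
[int_B |b - alpha|^k <= C Theta mu(B)^(1/p) lambda'(B')^(1/p')].

Finally the [A_p] conditions, together with Jensen's inequality for the logarithm,
bound [mu(B)^(1/p) lambda'(B')^(1/p') / |B|] by the [k]-th power of the mean of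
[nu^(1/k)] over [B]. *)

(** The obstacle is the error [K - K0]: it is small only in mean, while it gets multiplied by
    [|b y - b x|^k], which is unbounded. The bound [|a + c + delta|^k <= 4^k (a^k + c^k +
    |delta|^k)] splits that factor into terms that each depend on at most one of [x] and [y], so the
    error can be integrated in the other variable first. This is why companions ask for small means
    on every slice in [x] and on every slice in [y]. The resulting error is [4^k eps |K0| V] times
    quantities that also stand on the left, and it is absorbed there once [eps = 2^-k / 8 * 4^-k].
    Absorption requires these quantities to be finite, which is where [b] in [L^k_loc] enters.

    On the weight side, [nu^(1/k)], the dual weight of [mu] and [lambda], raised to the powers [k],
    [(p-1)/p] and [1/p], have product [1] almost everywhere. The exponents add up to [k + 1]; after
    normalization, Jensen bounds the product of the means from below, and the two [A_p] conditions
    exchange the dual of [mu] and [lambda] for [mu] and the dual of [lambda]. *)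

Set Implicit Arguments.
Unset Strict Implicit.
Unset Printing Implicit Defensive.

Import Order.TTheory GRing.Theory Num.Theory.
Import numFieldNormedType.Exports.

Local Open Scope classical_set_scope.
Local Open Scope ring_scope.

(** * The Euclidean norm *)

Section enorm_theory.
Context {R : realType} {d : nat}.
Implicit Types x y c : 'rV[R]_d.

Lemma sqr_enorm x : enorm x ^+ 2 = \sum_(i < d) x ord0 i ^+ 2.
Proof. by rewrite sqr_sqrtr// sumr_ge0// => i _; rewrite sqr_ge0. Qed.

Lemma enorm_ge0 x : 0 <= enorm x.
Proof. exact: sqrtr_ge0. Qed.

Lemma enorm0 : enorm (0 : 'rV[R]_d) = 0.
Proof. by rewrite /enorm big1 ?sqrtr0// => i _; rewrite mxE expr0n. Qed.

Lemma enormZ (a : R) x : enorm (a *: x) = `|a| * enorm x.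
Proof.
rewrite /enorm -sqrtr_sqr -sqrtrM ?sqr_ge0// mulr_sumr.
by congr Num.sqrt; apply: eq_bigr => i _; rewrite mxE exprMn.
Qed.

Lemma enormN x : enorm (- x) = enorm x.
Proof. by rewrite -scaleN1r enormZ normrN1 mul1r. Qed.

Lemma enorm_distC x y : enorm (x - y) = enorm (y - x).
Proof. by rewrite -enormN opprB. Qed.

(** With [C] the inner product, the squared length of [|y|^2 x - C y] equals
    [|y|^2 (|x|^2 |y|^2 - C^2)]. Cancelling [|y|^2] requires it to be positive, so the case of zero
    length is settled first. *)
Lemma Cauchy_Schwarz x y :
  (\sum_(i < d) x ord0 i * y ord0 i) ^+ 2 <= enorm x ^+ 2 * enorm y ^+ 2.
Proof.
set C := \sum_(i < d) _.
have [y0|y0] := eqVneq (enorm y ^+ 2) 0.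
  suff -> : C = 0 by rewrite expr0n y0 mulr0.
  rewrite /C big1// => i _; apply/eqP; rewrite mulf_eq0; apply/orP; right.
  rewrite -sqrf_eq0; move: y0; rewrite sqr_enorm => /eqP.
  rewrite psumr_eq0 => [/allP/(_ i (mem_index_enum _))//|j _]; exact: sqr_ge0.
have yp : 0 < enorm y ^+ 2 by rewrite lt_neqAle eq_sym y0 sqr_ge0.
have : 0 <= \sum_(i < d) (enorm y ^+ 2 * x ord0 i - C * y ord0 i) ^+ 2.
  by apply: sumr_ge0 => i _; exact: sqr_ge0.
have -> : \sum_(i < d) (enorm y ^+ 2 * x ord0 i - C * y ord0 i) ^+ 2 =
   enorm y ^+ 2 * (enorm x ^+ 2 * enorm y ^+ 2 - C ^+ 2).
  under eq_bigr => i _.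
    rewrite (_ : _ ^+ 2 = (enorm y ^+ 2) ^+ 2 * x ord0 i ^+ 2 +
      ((- (enorm y ^+ 2 * C) *+ 2) * (x ord0 i * y ord0 i) +
       C ^+ 2 * y ord0 i ^+ 2)); last by ring.
    over.
  rewrite !big_split/= -!mulr_sumr -!sqr_enorm -/C; ring.
by rewrite pmulr_rge0// subr_ge0.
Qed.

Lemma ler_enormD x y : enorm (x + y) <= enorm x + enorm y.
Proof.
rewrite -(@ler_pXn2r _ 2) ?nnegrE ?addr_ge0 ?enorm_ge0//.
have -> : enorm (x + y) ^+ 2 = enorm x ^+ 2 + enorm y ^+ 2 +
    (\sum_(i < d) x ord0 i * y ord0 i) *+ 2.
  rewrite !sqr_enorm -sumrMnl -!big_split/=.
  by apply: eq_bigr => i _; rewrite mxE; ring.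
have : \sum_(i < d) x ord0 i * y ord0 i <= enorm x * enorm y.
  apply: le_trans (ler_norm _) _.
  rewrite -(@ler_pXn2r _ 2) ?nnegrE ?mulr_ge0 ?enorm_ge0//.
  by rewrite real_normK ?num_real// exprMn Cauchy_Schwarz.
by move=> h; rewrite sqrrD; lra.
Qed.

Lemma ler_enormB x y : enorm x - enorm y <= enorm (x - y).
Proof. by rewrite lerBlDr (le_trans _ (ler_enormD _ _))// subrK. Qed.

Lemma coord_le_enorm x i : `|x ord0 i| <= enorm x.
Proof.
rewrite -(@ler_pXn2r _ 2) ?nnegrE ?enorm_ge0//.
rewrite real_normK ?num_real// sqr_enorm (bigD1 i)//= lerDl.
by apply: sumr_ge0 => j _; exact: sqr_ge0.
Qed.

(** The crude factor [d] in place of its square root is enough to fit a small cube inside a ball. In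
    dimension zero the strict inequality would fail. *)
Lemma enorm_lt_box x (e : R) : (0 < d)%N ->
  (forall i, `|x ord0 i| < e) -> enorm x < d%:R * e.
Proof.
move=> d0 xe; have e0 : 0 < e by exact: le_lt_trans (xe (Ordinal d0)).
have de0 : 0 <= d%:R * e by rewrite mulr_ge0// ltW.
rewrite -(@ltr_pXn2r _ 2) ?nnegrE ?enorm_ge0// sqr_enorm; apply: (@lt_le_trans _ _ (\sum_(i < d) e ^+ 2)).
  apply: ltr_sum; first by apply/hasP; exists (Ordinal d0) => //; rewrite mem_index_enum.
  by move=> i _; rewrite -real_normK ?num_real// ltr_pXn2r ?nnegrE// ltW.
rewrite sumr_const card_ord exprMn -[leLHS]mulr_natl ler_wpM2r ?sqr_ge0//.
by rewrite -natrX ler_nat -{1}(expn1 d) leq_pexp2l.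
Qed.

Lemma enorm_gt0 x : (0 < enorm x) = (x != 0).
Proof.
rewrite lt_def enorm_ge0 andbT; congr (~~ _); apply/eqP/eqP => [x0|->].
  apply/rowP => i; rewrite mxE; apply/eqP.
  by rewrite -normr_le0 (le_trans (coord_le_enorm _ _))// x0.
exact: enorm0.
Qed.

Lemma measurable_affine (a : R) c :
  measurable_fun setT (fun x : 'rV[R]_d => a *: x + c).
Proof.
apply/measurable_fun_rVP => i.
rewrite (_ : (fun _ => _) = fun x : 'rV[R]_d => a * x ord0 i + c ord0 i).
  apply: measurable_funD => //; apply: measurable_funM => //.
  exact: measurable_coord.
by apply/funext => x; rewrite !mxE.
Qed.

Lemma measurable_eball c (r : R) : measurable (eball c r).
Proof.
rewrite [X in measurable X](_ : _ =
   setT `&` (enorm \o (fun x => 1 *: x - c)) @^-1` `]-oo, r[).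
  exact: (measurableT_comp measurable_enorm (measurable_affine _ _)).
rewrite setTI; apply/seteqP.
by split => x; rewrite /preimage/eball/= in_itv/= scale1r.
Qed.

Lemma eball_subset c c' (r s : R) : enorm (c - c') + r <= s ->
  eball c r `<=` eball c' s.
Proof.
move=> h x; rewrite /eball/= => xc; apply: lt_le_trans h.
rewrite (_ : x - c' = (c - c') + (x - c)); last first.
  by apply/rowP => i; rewrite !mxE; ring.
by apply: le_lt_trans (ler_enormD _ _) _; rewrite ltrD2l.
Qed.

(** Local integrability is stated on compact sets and balls are open, so balls are enclosed in these
    compact cubes. *)
Definition ebox c (r : R) : set 'rV[R]_d :=
  [set x | forall i, c ord0 i - r <= x ord0 i <= c ord0 i + r].

Lemma compact_ebox c (r : R) : compact (ebox c r).
Proof.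
have := @rV_compact _ _ (fun i => `[c ord0 i - r, c ord0 i + r]%classic)
  (fun i => @segment_compact R _ _).
congr compact; apply/seteqP; split => x /= h i; have := h i; rewrite /= in_itv//.
Qed.

Lemma eball_sub_ebox c (r : R) : eball c r `<=` ebox c r.
Proof.
move=> x/= /ltW xr i.
by have := le_trans (coord_le_enorm _ i) xr; rewrite !mxE -ler_distl.
Qed.

(** The triangle inequality loses less than one radius at each centre. Positivity of [r] makes both
    balls nonempty, so that the infimum is taken over a nonempty set and is not a default value. *)
Lemma setdist_ge c c' (r s : R) : 0 < r ->
  s + 2 * r <= enorm (c - c') -> s <= setdist (eball c r) (eball c' r).
Proof.
move=> r0 h; apply: lb_le_inf.
  exists (enorm (c - c')); exists c; rewrite /eball/= ?subrr ?enorm0//.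
  by exists c'; rewrite /eball/= ?subrr ?enorm0.
move=> _ [x xc [y yc <-]]; move: xc yc; rewrite /eball/= => xc yc.
have : enorm (c - c') <= enorm (x - y) + enorm (x - c) + enorm (y - c').
  rewrite (_ : c - c' = (x - y) - (x - c) + (y - c')); last first.
    by apply/rowP => i; rewrite !mxE; ring.
  rewrite (le_trans (ler_enormD _ _))// lerD2r (le_trans (ler_enormD _ _))//.
  by rewrite enormN.
lra.
Qed.

Lemma setdist_gt0_disj (A B : set 'rV[R]_d) x : 0 < setdist A B ->
  A x -> B x -> False.
Proof.
move=> AB Ax Bx; suff : setdist A B <= 0 by rewrite leNgt AB.
apply: ge_inf; first by exists 0 => _ [y _ [z _ <-]]; exact: enorm_ge0.
by exists x => //; exists x => //; rewrite subrr enorm0.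
Qed.

End enorm_theory.

(** * Affine invariance of the Lebesgue measure *)

(** Packages a candidate formula as a genuine measure, known only through its values, so that
    uniqueness theorems for measures apply to it. *)
Lemma scaled_pushforward (R : realType) d d' (T : measurableType d)
    (T' : measurableType d') (m : {measure set T -> \bar R}) (f : T -> T')
    (k : R) : measurable_fun setT f -> 0 <= k ->
  exists m' : {measure set T' -> \bar R},
    forall A, m' A = (k%:E * m (f @^-1` A))%E.
Proof.
move=> mf k0.
by unshelve eexists (mscale (NngNum k0) (pushforward m f)).
Qed.

Section lebesgue_affine.
Context {R : realType}.

(** By uniqueness it suffices to compare the Lebesgue measure with [|a|] times the pushforward on
    half-open intervals. A negative [a] moves the closed end to the other side, which leaves the
    length unchanged. *)
Lemma lebesgue_measure_affine (a c : R) (A : set R) : a != 0 -> measurable A ->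
  lebesgue_measure ((fun x => a * x + c) @^-1` A) =
  (`|a|^-1%:E * lebesgue_measure A)%E.
Proof.
move=> a0 mA.
have mf : measurable_fun setT
    ((fun x => a * x + c) : measurableTypeR R -> measurableTypeR R).
  by apply: measurable_funD => //; exact: measurable_funM.
have [m mE] := scaled_pushforward lebesgue_measure mf (normr_ge0 a).
suff /(_ A mA) -> : forall A, measurable A -> lebesgue_measure A = m A.
  by rewrite mE muleA -EFinM mulVf ?normr_eq0// mul1e.
apply: lebesgue_measure_unique => _ [[u v]] _ <-.
rewrite mE/=.
have [ap|an] := ltP 0 a.
  rewrite (_ : _ @^-1` _ = `](u - c) / a, (v - c) / a]%classic).
    rewrite !lebesgue_measure_itv/= !lte_fin ltr_pM2r ?invr_gt0// ltrD2r.
    case: ifPn => // _; last by rewrite mule0.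
    by rewrite gtr0_norm// -!EFinB -EFinM; congr EFin; field.
  apply/seteqP; split => x; rewrite /preimage/= !in_itv/=.
    by rewrite ltr_pdivrMr// ler_pdivlMr// ltrBlDr lerBrDr mulrC.
  by rewrite ltr_pdivrMr// ler_pdivlMr// ltrBlDr lerBrDr mulrC.
have {}an : a < 0 by rewrite lt_neqAle a0.
rewrite (_ : _ @^-1` _ = `[(v - c) / a, (u - c) / a[%classic).
  rewrite !lebesgue_measure_itv/= !lte_fin ltr_nM2r ?invr_lt0// ltrD2r.
  case: ifPn => // _; last by rewrite mule0.
  by rewrite ltr0_norm// -!EFinB -EFinM; congr EFin; field.
apply/seteqP; split => x; rewrite /preimage/= !in_itv/=.
  by rewrite ltr_ndivlMr// ler_ndivrMr// ltrBlDr lerBrDr mulrC andbC.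
by rewrite ltr_ndivlMr// ler_ndivrMr// ltrBlDr lerBrDr mulrC andbC.
Qed.

Section boxes.
Context {n : nat}.

(** A pi-system that generates the sigma-algebra and whose measures are given by [leb_box]. Together
    with the exhaustion by the cubes [cbox], it lets [measure_unique] identify measures from their
    values on boxes. *)
Definition boxes : set (set 'rV[R]_n) :=
  [set B | exists2 A : 'I_n -> set R, (forall i, measurable (A i)) &
     B = [set x : 'rV[R]_n | forall i, A i (x ord0 i)]].

Lemma measurable_boxes : @measurable _ 'rV[R]_n = <<s boxes >>.
Proof.
apply/seteqP; split; last first.
  apply: smallest_sub; first exact: sigma_algebra_measurable.
  move=> _ [A mA ->]; rewrite (_ : [set _ | _] = \bigcap_(i in [set: 'I_n])
        ((fun x : 'rV[R]_n => x ord0 i) @^-1` A i)).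
    apply: fin_bigcap_measurable => // i _.
    by rewrite -[X in measurable X]setTI; exact: measurable_coord.
  by apply/seteqP; split => x /= h i; [move=> _|]; exact: h.
move=> A mA.
(* The identity map out of the sigma-algebra generated by boxes is measurable because each
   coordinate is: the preimage of [Y] under coordinate [i] is a box with all other sides full. *)
have : measurable_fun setT ((fun x => x) : g_sigma_algebraType boxes -> 'rV[R]_n).
  apply/measurable_fun_rVP => i _ Y mY; rewrite setTI.
  apply: sub_sigma_algebra; exists (fun j => if j == i then Y else setT).
    by move=> j; case: ifP.
  apply/seteqP; split => x /=; first by move=> h j; case: eqP => // ->.
  by move=> /(_ i); rewrite eqxx.
by move=> /(_ measurableT A mA); rewrite setTI.
Qed.

Lemma setI_closed_boxes : setI_closed boxes.
Proof.
move=> _ _ [A mA ->] [B mB ->]; exists (fun i => A i `&` B i).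
  by move=> i; exact: measurableI.
apply/seteqP; split => x /=; first by move=> [h k] i; split.
by move=> h; split => i; have [] := h i.
Qed.

Definition cbox (k : R) : set 'rV[R]_n := [set x | forall i, `[- k, k]%classic (x ord0 i)].

Lemma leb_cbox (k : R) : 0 <= k -> leb n (cbox k) = ((k *+ 2) ^+ n)%:E.
Proof.
move=> k0; rewrite (@leb_box _ _ (fun=> `[- k, k]%classic)) => [|i]; last exact: measurable_itv.
under eq_bigr do rewrite lebesgue_measure_itv/=.
transitivity (\prod_(i < n) (k *+ 2)%:E)%E.
  apply: eq_bigr => i _; rewrite lte_fin -EFinB opprK; case: ifPn => //.
  rewrite -leNgt => h; suff -> : k = 0 by rewrite mul0rn.
  by apply/eqP; rewrite eq_le k0 andbT; lra.
by rewrite prodEFin prodr_const card_ord.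
Qed.

Lemma boxes_cbox k : boxes (cbox k).
Proof. by exists (fun=> `[- k, k]%classic) => // i; exact: measurable_itv. Qed.

Lemma measurable_cbox k : measurable (cbox k).
Proof. by rewrite measurable_boxes; apply: sub_sigma_algebra; exact: boxes_cbox. Qed.

Lemma bigcup_cbox : \bigcup_k cbox k%:R = setT.
Proof.
apply/seteqP; split => // x _.
have [k hk] : exists k, enorm x <= k%:R.
  exists (Num.bound (enorm x)).
  by apply/ltW; rewrite (le_lt_trans _ (archi_boundP (enorm_ge0 x)))//.
exists k => // i; rewrite /= in_itv/= -ler_norml.
exact: le_trans (coord_le_enorm _ _) hk.
Qed.

(** The map acts on each coordinate separately, so boxes pull back to boxes and the one-dimensional
    factors multiply to [|a|^n]. *)
Lemma leb_affine (a : R) (c : 'rV[R]_n) (A : set 'rV[R]_n) :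
  a != 0 -> measurable A ->
  leb n ((fun x => a *: x + c) @^-1` A) = ((`|a| ^- n)%:E * leb n A)%E.
Proof.
move=> a0 mA.
have an0 : 0 <= `|a| ^+ n by rewrite exprn_ge0.
have [m mE] := scaled_pushforward (leb n) (measurable_affine a c) an0.
suff /(_ A mA) -> : forall A, measurable A -> leb n A = m A.
  rewrite mE muleA -EFinM mulVf ?mul1e//.
  by rewrite expf_neq0 ?normr_eq0.
move=> {mA}A mA.
apply: (measure_unique boxes (fun k => cbox k%:R)) => //.
- exact: measurable_boxes.
- exact: setI_closed_boxes.
- by move=> k; exact: boxes_cbox.
- exact: bigcup_cbox.
- move=> _ [B mB ->]; rewrite mE; etransitivity; first exact: (leb_box mB).
  rewrite (_ : _ @^-1` _ = [set x : 'rV[R]_n | forall i,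
      ((fun t => a * t + c ord0 i) @^-1` B i) (x ord0 i)]); last first.
    by apply/seteqP; split => x /= h i; have := h i; rewrite !mxE.
  have mB' i : measurable ((fun t => a * t + c ord0 i) @^-1` B i).
    rewrite -[X in measurable X]setTI.
    have : measurable_fun setT (fun t : R => a * t + c ord0 i).
      by apply: measurable_funD => //; exact: measurable_funM.
    by apply.
  rewrite [X in (_ * X)%E](leb_box mB') [X in (X * _)%E](_ : _ = (\prod_(i < n) `|a|%:E)%E); last first.
    by rewrite prodEFin prodr_const card_ord.
  rewrite -big_split/=; apply: eq_bigr => i _.
  by rewrite lebesgue_measure_affine// muleA -EFinM mulfV ?normr_eq0// mul1e.
- move=> k; have : (leb n (cbox k%:R) < +oo)%E by rewrite leb_cbox ?ltry.
  by [].
Qed.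

Lemma ge0_integral_affine (a : R) (c : 'rV[R]_n) (f : 'rV[R]_n -> \bar R) :
  a != 0 -> measurable_fun setT f -> (forall x, 0 <= f x)%E ->
  (\int[leb n]_x f (a *: x + c)%R = (`|a| ^- n)%:E * \int[leb n]_x f x)%E.
Proof.
move=> a0 mf f0.
have an0 : 0 <= `|a| ^- n by rewrite invr_ge0 exprn_ge0.
rewrite -[RHS](@ge0_integral_mscale _ _ _ (leb n) setT measurableT (NngNum an0))//=.
transitivity (\int[pushforward (leb n) (fun x : 'rV[R]_n => a *: x + c)%R]_x f x)%E.
  rewrite ge0_integral_pushforward ?preimage_setT//; first exact: measurable_affine.
apply: eq_measure_integral; first exact: measurable_affine.
by move=> ? A mA _; exact: leb_affine.
Qed.

Definition ball_vol : R := fine (leb n (eball (0 : 'rV[R]_n) 1)).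

Lemma leb_eball (c : 'rV[R]_n) (r : R) : 0 < r ->
  leb n (eball c r) = (ball_vol * r ^+ n)%:E.
Proof.
move=> r0.
have fin : leb n (eball (0 : 'rV[R]_n) 1) \is a fin_num.
  rewrite ge0_fin_numE//; apply: (@le_lt_trans _ _ (leb n (cbox 1))).
    apply: le_measure; rewrite ?inE//; [exact: measurable_eball|exact: measurable_cbox|].
    move=> x /eball_sub_ebox xb i; have := xb i; rewrite mxE sub0r add0r.
    by rewrite /= in_itv.
  by rewrite leb_cbox// ltry.
rewrite mulrC EFinM /ball_vol fineK//.
have -> : eball c r = (fun x => r^-1 *: x + (- (r^-1 *: c))) @^-1` eball 0 1.
  apply/seteqP; split => x; rewrite /eball/preimage/= subr0 -scalerBr enormZ;
  by rewrite gtr0_norm ?invr_gt0// mulrC ltr_pdivrMr// mul1r.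
rewrite leb_affine; last 2 first.
- by rewrite invr_eq0 gt_eqF.
- exact: measurable_eball.
by rewrite gtr0_norm ?invr_gt0// exprVn invrK.
Qed.

Lemma ball_vol_gt0 : (0 < n)%N -> 0 < ball_vol.
Proof.
move=> n0; rewrite -lte_fin.
have <- : leb n (eball (0 : 'rV[R]_n) 1) = ball_vol%:E.
  by rewrite leb_eball// expr1n mulr1.
(* The cube is closed and [enorm_lt_box] wants strict bounds on the coordinates: they are at most
   [e], hence below [2 e], and [n] times [2 e] is [1]. *)
pose e : R := (n%:R *+ 2)^-1.
have e0 : 0 < e by rewrite invr_gt0 pmulrn_lgt0// ltr0n.
apply: (@lt_le_trans _ _ (leb n (cbox e))).
  by rewrite leb_cbox ?ltW// lte_fin exprn_gt0// pmulrn_lgt0.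
apply: le_measure; rewrite ?inE//; [exact: measurable_cbox|exact: measurable_eball|].
move=> x xe; rewrite /eball/= subr0.
apply: (@lt_le_trans _ _ (n%:R * (e *+ 2))).
  apply: enorm_lt_box => // i; have := xe i; rewrite /= in_itv/= -ler_norml.
  by move=> /le_lt_trans; apply; rewrite mulr2n ltrDl.
by rewrite mulrnAr -mulrnAl /e mulfV// gt_eqF// pmulrn_lgt0// ltr0n.
Qed.

Lemma leb_shift (h : 'rV[R]_n) (A : set 'rV[R]_n) : measurable A ->
  leb n ((fun x => x + h) @^-1` A) = leb n A.
Proof.
move=> mA; rewrite -[RHS]mul1e -[X in (X%:E * _)%E]invr1 -[X in X^-1](expr1n _ n).
rewrite -[X in (X ^- n)](normr1 R) -(leb_affine h (oner_neq0 R))//.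
by congr (leb n _); apply/seteqP; split => x; rewrite /preimage/= scale1r.
Qed.

Lemma measurable_shift (h : 'rV[R]_n) (A : set 'rV[R]_n) : measurable A ->
  measurable ((fun x => x + h) @^-1` A).
Proof.
move=> mA; have := measurable_affine 1 h measurableT mA; rewrite setTI.
by congr measurable; apply/seteqP; split => x; rewrite /preimage/= scale1r.
Qed.

End boxes.

End lebesgue_affine.

Arguments ball_vol R n : clear implicits.

(** * Continuity of translations *)

Section translation.
Context {R : realType} {n : nat}.
Implicit Types (A B : set 'rV[R]_n) (h : 'rV[R]_n).

Definition shift_diff A h : set 'rV[R]_n :=
  ((fun x => x + h) @^-1` A `\` A) `|` (A `\` (fun x => x + h) @^-1` A).

Lemma measurable_shift_diff A h : measurable A -> measurable (shift_diff A h).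
Proof.
move=> mA; have mAh := measurable_shift h mA.
by apply: measurableU; exact: measurableD.
Qed.

(** Continuity of translations of the indicator of [A] in local [L^1]. Localizing to a cube makes
    the property meaningful for sets of infinite measure and stable under complements, so that the
    sets having it form a sigma-algebra. *)
Definition shift_continuous A := forall (k e : R), 0 < e ->
  exists2 r : R, 0 < r & forall h, enorm h < r ->
    (leb n (cbox k `&` shift_diff A h) <= e%:E)%E.

Lemma shift_continuousC A : shift_continuous A -> shift_continuous (~` A).
Proof.
move=> cA k e /(cA k)[r r0 hr]; exists r => // h /hr.
congr (leb n (_ `&` _) <= _)%E; rewrite /shift_diff preimage_setC !setDE !setCK.
by rewrite setUC; congr (_ `|` _); rewrite setIC.
Qed.

Lemma shift_continuousU A B : measurable A -> measurable B ->
  shift_continuous A -> shift_continuous B -> shift_continuous (A `|` B).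
Proof.
move=> mA mB cA cB k e e0; have e20 : 0 < e / 2 by rewrite divr_gt0.
have [r r0 hr] := cA k _ e20; have [s s0 hs] := cB k _ e20.
exists (Num.min r s); first by rewrite lt_min r0.
move=> h; rewrite lt_min => /andP[/hr hA /hs hB].
rewrite (splitr e) EFinD; apply: le_trans (leeD hA hB).
apply: le_trans (measureU2 _ _ _); last 2 first.
- by apply: measurableI; [exact: measurable_cbox|exact: measurable_shift_diff].
- by apply: measurableI; [exact: measurable_cbox|exact: measurable_shift_diff].
apply: le_measure; rewrite ?inE//.
- apply: measurableI; first exact: measurable_cbox.
  by apply: measurable_shift_diff; exact: measurableU.
- by apply: measurableU; apply: measurableI;
    [exact: measurable_cbox|exact: measurable_shift_diff|
     exact: measurable_cbox|exact: measurable_shift_diff].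
rewrite -setIUr; apply: setIS => x; rewrite /shift_diff/preimage/=.
move: (A x) (B x) (A (x + h)) (B (x + h)) => a b c d; clear.
by have [ha|ha] := pselect a; have [hb|hb] := pselect b; tauto.
Qed.

Lemma shift_continuous_bigcup (F : (set 'rV[R]_n)^nat) :
  (forall i, measurable (F i)) -> (forall i, shift_continuous (F i)) ->
  shift_continuous (\bigcup_i F i).
Proof.
move=> mF cF k e e0; pose U N := \big[setU/set0]_(i < N) F i.
have mU N : measurable (U N) by apply: bigsetU_measurable.
have cU N : shift_continuous (U N).
  elim: N => [|N IH]; last first.
    rewrite /U big_ord_recr/=; apply: shift_continuousU => //; exact: mU.
  move=> k' e' e'0; exists 1 => // h _.
  rewrite /U big_ord0 /shift_diff preimage_set0 !set0D setU0 setI0 measure0.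
  by rewrite lee_fin ltW.
have mUF : measurable (\bigcup_i F i) by exact: bigcup_measurable.
(* The part of the union missed by its first [N] members. The cube is widened by [1] and shifts are
   kept shorter than [1], so that both [x] and [x + h] stay in it; inside a set of finite measure,
   the missed part shrinks to measure zero. *)
pose G N := cbox (`|k| + 1) `&` (\bigcup_i F i `\` U N).
have mG N : measurable (G N).
  by apply: measurableI; [exact: measurable_cbox|exact: measurableD].
have e40 : 0 < e / 4 by rewrite divr_gt0.
have [N GN] : exists N, (leb n (G N) < (e / 4)%:E)%E.
  have : leb n (G N) @[N --> \oo] --> leb n (\bigcap_N G N).
    apply: nonincreasing_cvg_mu => //.
    - apply: (@le_lt_trans _ _ (leb n (cbox (`|k| + 1)))).
        by apply: le_measure; rewrite ?inE//;
          [exact: measurable_cbox|exact: subIsetl].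
      by rewrite leb_cbox ?addr_ge0// ltry.
    - exact: bigcap_measurable.
    - apply/nonincreasing_seqP => N; apply/subsetPset; apply: setIS.
      by apply: setDS; rewrite /U big_ord_recr/=; exact: subsetUl.
  rewrite (_ : \bigcap_N G N = set0); last first.
    apply/seteqP; split => // x Gx; have [_ [[i _ Fix] _]] := Gx 0%N I.
    by have [_ [_]] := Gx i.+1 I; rewrite /U big_ord_recr/=; apply; right.
  have e40' : ((0 : R)%:E < (e / 4)%:E)%E by rewrite lte_fin.
  by rewrite measure0 => /(_ _ (open_ereal_lt' e40')) [N _ /(_ N (leqnn _))]; exists N.
have [r r0 hr] := cU N k _ (divr_gt0 e0 (@ltr0n R 2)).
exists (Num.min r 1); first by rewrite lt_min r0 ltr01.
move=> h; rewrite lt_min => /andP[/hr hU h1].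
have mGh := measurable_shift h (mG N).
(* Half of [e] pays for the finite union, a quarter for the missed part and a quarter for its
   translate. *)
have -> : e%:E = ((e / 2)%:E + ((e / 4)%:E + (e / 4)%:E))%E.
  by rewrite -!EFinD; congr EFin; field.
have hG : (leb n ((fun x => x + h)%R @^-1` G N) <= (e / 4)%:E)%E.
  by rewrite leb_shift// ltW.
have mC := @measurable_cbox R n k.
apply: le_trans (leeD hU (leeD (ltW GN) hG)).
have mSU : measurable (cbox k `&` shift_diff (U N) h).
  by apply: measurableI => //; exact: measurable_shift_diff.
apply: (@le_trans _ _ (leb n ((cbox k `&` shift_diff (U N) h) `|`
   (G N `|` (fun x => x + h)%R @^-1` G N)))).
  apply: le_measure; rewrite ?inE//.
  - by apply: measurableI => //; exact: measurable_shift_diff.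
  - by apply: measurableU => //; exact: measurableU.
  move=> x [xk xd].
  have xG : (\bigcup_i F i) x -> ~ U N x -> G N x.
    move=> Fx NUx; split; last by split.
    move=> i; have := xk i; rewrite /= !in_itv/=.
    by have := ler_norm k; lra.
  have xhG : (\bigcup_i F i) (x + h) -> ~ U N (x + h) -> G N (x + h).
    move=> Fx NUx; split; last by split.
    move=> i; have := xk i; rewrite /= !in_itv/= mxE.
    have := le_lt_trans (coord_le_enorm h i) h1; rewrite ltr_norml.
    by have := ler_norm k; lra.
  have UF y : U N y -> (\bigcup_i F i) y.
    by rewrite /U -bigcup_mkord => -[i _ Fy]; exists i.
  move: xk xd xG xhG (UF x) (UF (x + h)); rewrite /shift_diff/preimage/=.
  move: ((\bigcup_i F i) x) ((\bigcup_i F i) (x + h)) (U N x) (U N (x + h))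
    (G N x) (G N (x + h)) (cbox k x) => a b c e' f g k'; clear.
  by have [hc|hc] := pselect c; have [he|he] := pselect e'; tauto.
apply: le_trans (measureU2 _ _ _) _ => //; first exact: measurableU.
by apply: leeD => //; exact: measureU2.
Qed.

Let coord (i : 'I_n) (Y : set R) : set 'rV[R]_n := (fun x => x ord0 i) @^-1` Y.

Let measurable_coord_preimage i (Y : set R) : measurable Y -> measurable (coord i Y).
Proof.
by move=> mY; rewrite -[X in measurable X]setTI; exact: measurable_coord.
Qed.

(** Membership of the [i]-th coordinate in the interval can change under the shift only if that
    coordinate lies within [|h|] of [a] or of [b]. The symmetric difference is thus covered by two
    thin slabs. *)
Lemma shift_continuous_itv i (a b : R) : shift_continuous (coord i `]a, b]).
Proof.
move=> k e e0.
pose slab (c s : R) : 'I_n -> set R :=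
  fun j => if j == i then `[c - s, c + s]%classic else `[- k, k]%classic.
have mslab c s j : measurable (slab c s j) by rewrite /slab; case: ifP.
pose M : R := (\prod_(j < n | j != i) fine (lebesgue_measure (`[- k, k]%classic : set R)))%R.
have M0 : 0 <= M by apply: prodr_ge0 => j _; exact: fine_ge0.
have fin : lebesgue_measure (`[- k, k]%classic : set R) \is a fin_num.
  by rewrite lebesgue_measure_itv/=; case: ifP.
have leb_slab c s : 0 <= s -> leb n [set x | forall j, slab c s j (x ord0 j)] = (s *+ 2 * M)%:E.
  move=> s0; rewrite leb_box// (bigD1 i)//= EFinM; congr (_ * _)%E.
    rewrite /slab eqxx lebesgue_measure_itv/= lte_fin -EFinB.
    case: ifPn => [_|]; first by congr EFin; ring.
    rewrite -leNgt => h; suff -> : s = 0 by rewrite mul0rn.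
    by apply/eqP; rewrite eq_le s0 andbT; lra.
  rewrite /M -prodEFin; apply: eq_bigr => j /negbTE ji.
  by rewrite /slab ji fineK.
(* Each slab has measure [2 s M], with [M] the volume of the other sides, so the two total
   [4 s M <= e]. Adding [1] to [M] covers the case [M = 0]. *)
pose s := e / (4 * (M + 1)).
have M1 : 0 < 4 * (M + 1) by rewrite mulr_gt0// ltr_wpDl.
have s0 : 0 < s by rewrite divr_gt0.
exists s => // h hs.
have mslab' c : measurable [set x : 'rV[R]_n | forall j, slab c s j (x ord0 j)].
  by rewrite measurable_boxes; apply: sub_sigma_algebra; exists (slab c s).
have mc : measurable (coord i `]a, b]) by exact: measurable_coord_preimage.
apply: (@le_trans _ _ (leb n ([set x | forall j, slab a s j (x ord0 j)] `|`
   [set x | forall j, slab b s j (x ord0 j)]))).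
  apply: le_measure; rewrite ?inE//.
  - by apply: measurableI; [exact: measurable_cbox|exact: measurable_shift_diff].
  - exact: measurableU (mslab' a) (mslab' b).
  move=> x [xk]; rewrite /shift_diff/coord/preimage/= !in_itv/= mxE => xd.
  have hi := le_lt_trans (coord_le_enorm h i) hs.
  have : (a - s <= x ord0 i <= a + s) || (b - s <= x ord0 i <= b + s).
    move: hi; rewrite ltr_norml => /andP[h1 h2].
    have [xa|xa] := ltP a (x ord0 i); have [xb|xb] := leP (x ord0 i) b;
    have [ya|ya] := ltP a (x ord0 i + h ord0 i);
    have [yb|yb] := leP (x ord0 i + h ord0 i) b; apply/orP;
    move: xd; rewrite ?xa ?xb ?ya ?yb ?(ltNge a) ?(leNgt _ b) ?xa ?xb ?ya ?yb/=;
    (try by case=> -[]); move=> _;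
    (try by left; lra); (try by right; lra).
  by move=> /orP[] xs; [left|right] => j; rewrite /slab; case: eqP => [->|_];
    [rewrite /= in_itv|exact: xk|rewrite /= in_itv|exact: xk].
apply: (@le_trans _ _ (leb n [set x | forall j, slab a s j (x ord0 j)] +
   leb n [set x | forall j, slab b s j (x ord0 j)])%E); first exact: (measureU2 _ (mslab' a) (mslab' b)).
rewrite (leb_slab a s (ltW s0)) (leb_slab b s (ltW s0)) -EFinD lee_fin.
have -> : s *+ 2 * M + s *+ 2 * M = e * (M / (M + 1)) by rewrite /s; field; lra.
apply: ler_piMr; first exact: ltW.
rewrite ler_pdivrMr ?ltr_wpDl//; lra.
Qed.

(** Two generation arguments: the sets with the property form a sigma-algebra, so cylinders over one
    coordinate suffice; the bases of the good cylinders form one too, so half-open intervals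
    suffice. *)
Lemma shift_continuous_measurable A : measurable A -> shift_continuous A.
Proof.
pose S := [set A | measurable A /\ shift_continuous A].
have S0 : S set0.
  split=> // k e e0; exists 1 => // h _.
  rewrite /shift_diff preimage_set0 !set0D setU0 setI0 measure0.
  by rewrite lee_fin ltW.
have sigS : sigma_algebra setT S.
  split=> //.
  - move=> B [mB cB]; rewrite setTD; split; first exact: measurableC.
    exact: shift_continuousC.
  - move=> F SF; split; first by apply: bigcup_measurable => i _; have [] := SF i.
    by apply: shift_continuous_bigcup => i; have [] := SF i.
suff : @measurable _ 'rV[R]_n `<=` S by move=> mS mA; have [] := mS _ mA.
apply: smallest_sub => //.
rewrite -bigcup_seq; apply: bigcup_sub => i _ _ [Y mY <-]; rewrite setTI.
suff : @measurable _ (measurableTypeR R) `<=` [set Y | S (coord i Y)] by apply.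
apply: smallest_sub.
  split=> //=.
  - by move=> B /= SB; rewrite setTD /coord preimage_setC; have [_ + _] := sigS; move=> /(_ _ SB); rewrite setTD.
  - by move=> F SF /=; rewrite /coord preimage_bigcup; have [_ _] := sigS; apply.
move=> _ [[a b]] _ <-; split; last exact: shift_continuous_itv.
exact: measurable_coord_preimage.
Qed.

End translation.

Lemma integral_indicM d (T : measurableType d) (R : realType)
    (m : {measure set T -> \bar R}) (A : set T) (f : T -> R) :
  (\int[m]_(x in A) (f x)%:E = \int[m]_x (\1_A x * f x)%:E)%E.
Proof.
rewrite integral_mkcond; apply: eq_integral => x _.
by rewrite patchE indicE; case: (x \in A); rewrite ?mul1r ?mul0r.
Qed.

(** * Approximate continuity by averaging *)

Section small_mean.
Context {R : realType} {n : nat}.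

Lemma ge0_integral_shift (c : 'rV[R]_n) (f : 'rV[R]_n -> \bar R) :
  measurable_fun setT f -> (forall x, 0 <= f x)%E ->
  (\int[leb n]_x f (x + c)%R = \int[leb n]_x f x)%E.
Proof.
move=> mf f0; rewrite -[RHS]mul1e -[X in (X%:E * _)%E]invr1.
rewrite -[X in X^-1](expr1n _ n) -[X in (X ^- n)](normr1 R).
rewrite -(ge0_integral_affine c (oner_neq0 R))//.
by apply: eq_integral => x _; rewrite scale1r.
Qed.

Lemma measurable_add_rV :
  measurable_fun setT (fun z : 'rV[R]_n * 'rV[R]_n => z.1 + z.2).
Proof.
apply/measurable_fun_rVP => i; under eq_fun do rewrite mxE.
apply: measurable_funD.
  by apply: (measurableT_comp (measurable_coord i)); exact: measurable_fst.
by apply: (measurableT_comp (measurable_coord i)); exact: measurable_snd.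
Qed.

Variables (phi : 'rV[R]_n -> R) (E : set 'rV[R]_n) (k c delta : R).
Hypotheses (n0 : (0 < n)%N) (phi0 : forall x, 0 <= phi x).
Hypothesis iphi : (leb n).-integrable setT (EFin \o phi).
Hypotheses (mE : measurable E) (Ek : E `<=` cbox k) (E0 : (0 < leb n E)%E).
Hypotheses (c0 : 0 < c) (Ec : forall x, E x -> phi x <= c) (delta0 : 0 < delta).

Let mphi : measurable_fun setT phi.
Proof. by apply/measurable_EFinP; exact: measurable_int iphi. Qed.

Let finE : leb n E \is a fin_num.
Proof.
rewrite ge0_fin_numE//; apply: (@le_lt_trans _ _ (leb n (cbox `|k|))).
  apply: le_measure; rewrite ?inE//; first exact: measurable_cbox.
  move=> x /Ek xk i; have := xk i; rewrite /= !in_itv/=.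
  by have := ler_norm k; lra.
by rewrite leb_cbox// ltry.
Qed.

Let e := fine (leb n E).

Let e0 : 0 < e.
Proof. by rewrite fine_gt0// E0 ltey_eq finE. Qed.

Let eE : leb n E = e%:E.
Proof. by rewrite /e fineK. Qed.

Let integral_E_le : (\int[leb n]_(x in E) (phi x)%:E <= (c * e)%:E)%E.
Proof.
rewrite EFinM -eE -integral_cst//; apply: ge0_le_integral.
- by [].
- by move=> x _; rewrite lee_fin.
- by apply/measurable_EFinP; exact: measurable_funTS.
- by [].
- by move=> x /Ec; rewrite lee_fin.
Qed.

(** The integral is that of [phi] over [E + h]. The part inside [E] contributes at most [c e]; the
    part outside has small measure when [h] is short, and absolute continuity of the integral of
    [phi] bounds it by [c e] as well. *)
Let shift_le : exists2 r, 0 < r & forall h, enorm h < r ->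
  (\int[leb n]_x (\1_E x * phi (x + h)%R)%:E <= (2 * c * e)%:E)%E.
Proof.
have ce0 : 0 < c * e by rewrite mulr_gt0.
have [t [t0 ht]] := integral_normr_continuous iphi ce0.
have [r r0 hr] := shift_continuous_measurable mE (`|k| + 1) (divr_gt0 t0 (@ltr0n R 2)).
exists (Num.min r 1); first by rewrite lt_min r0 ltr01.
move=> h; rewrite lt_min => /andP[hr1 h1].
pose Eh := (fun x => x + (- h)) @^-1` E.
have mEh : measurable Eh by exact: measurable_shift.
have -> : (\int[leb n]_x (\1_E x * phi (x + h)%R)%:E =
    \int[leb n]_(x in Eh) (phi x)%:E)%E.
  rewrite [RHS]integral_indicM -[RHS](ge0_integral_shift h).
  - apply: eq_integral => x _; congr (_ * _)%:E.
    by rewrite !indicE /Eh; congr (nat_of_bool _)%:R; apply/idP/idP;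
      rewrite !inE /preimage/= addrK.
  - by apply/measurable_EFinP; apply: measurable_funM.
  - by move=> x; rewrite lee_fin mulr_ge0.
apply: (@le_trans _ _ (\int[leb n]_(x in E `|` (Eh `\` E)) (phi x)%:E)%E).
  apply: ge0_subset_integral.
  - by [].
  - by apply: measurableU => //; exact: measurableD.
  - by apply/measurable_EFinP; exact: measurable_funTS.
  - by move=> x _; rewrite lee_fin.
  - by move=> x Ehx; have [Ex|Ex] := pselect (E x); [left|right].
rewrite ge0_integral_setU//; last 4 first.
- exact: measurableD.
- by apply/measurable_EFinP; exact: measurable_funTS.
- by move=> x _; rewrite lee_fin.
- by apply/disj_setPS => x [? []].
rewrite -mulrA mulr_natl mulr2n EFinD; apply: leeD => //.
have : (leb n (Eh `\` E) < t%:E)%E.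
  apply: (@le_lt_trans _ _ (t / 2)%:E); last by rewrite lte_fin; lra.
  apply: le_trans (hr (- h) _); last by rewrite enormN.
  apply: le_measure; rewrite ?inE//.
  - exact: measurableD.
  - by apply: measurableI; [exact: measurable_cbox|exact: measurable_shift_diff].
  move=> x [Ehx Ex]; split; last by left.
  move=> i; have := Ek Ehx i; rewrite /= !in_itv/= !mxE.
  have := le_lt_trans (coord_le_enorm h i) h1; rewrite ltr_norml.
  by have := ler_norm k; lra.
move=> /(ht _ (measurableD mEh mE)) /ltW.
rewrite -lee_fin; apply: le_trans.
rewrite /Rintegral fineK.
  rewrite le_eqVlt; apply/orP; left; apply/eqP; apply: eq_integral => x _.
  by rewrite ger0_norm.
apply: integrable_fin_num => //; first exact: measurableD.
apply: (@integrableS _ _ _ _ setT) => //; first exact: measurableD.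
exact: integrable_norm.
Qed.

(** By [shift_le], the averages of [phi] over the balls centred at the points of [E] have themselves
    an average of at most [2 c] over [E]. They cannot all exceed [3 c]. *)
Lemma exists_small_mean : exists z rho, [/\ E z, 0 < rho, rho < delta &
  (\int[leb n]_(x in eball z rho) (phi x)%:E <= (3 * c)%:E * leb n (eball (0:'rV[R]_n) rho))%E].
Proof.
have [r r0 hr] := shift_le.
pose rho := Num.min r delta / 2.
have m0 : 0 < Num.min r delta by rewrite lt_min r0.
have rho0 : 0 < rho by rewrite divr_gt0.
have rhom : rho < Num.min r delta by rewrite /rho; lra.
move: (rhom); rewrite lt_min => /andP[rhor rhod].
apply: contrapT => H.
have V : leb n (eball (0 : 'rV[R]_n) rho) = (ball_vol R n * rho ^+ n)%:E by exact: leb_eball.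
set v := ball_vol R n * rho ^+ n in V.
have v0 : 0 < v by rewrite mulr_gt0 ?exprn_gt0// ball_vol_gt0.
have big z : E z -> ((3 * c * v)%:E <= \int[leb n]_h (\1_(eball 0 rho) h * phi (z + h)%R)%:E)%E.
  move=> Ez; have -> : (\int[leb n]_h (\1_(eball 0 rho) h * phi (z + h)%R)%:E =
      \int[leb n]_(x in eball z rho) (phi x)%:E)%E.
    rewrite [RHS]integral_indicM -[RHS](ge0_integral_shift z).
    - apply: eq_integral => x _; rewrite addrC; congr (_ * _)%:E.
      by rewrite !indicE; congr (nat_of_bool _)%:R; apply/idP/idP;
        rewrite !inE /eball/= addrK subr0.
    - apply/measurable_EFinP; apply: measurable_funM => //.
      by apply: measurable_indic; exact: measurable_eball.
    - by move=> x; rewrite lee_fin mulr_ge0.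
  rewrite leNgt; apply/negP => /ltW h; apply: H; exists z, rho; split => //.
  by rewrite V -EFinM.
have mB : measurable (eball (0 : 'rV[R]_n) rho) by exact: measurable_eball.
(* The two iterated integrals of [F] agree by Tonelli. If the conclusion failed, integrating in the
   shift first would give at least [3 c v e], while integrating over [E] first gives at most
   [2 c e v]. *)
pose F (z : 'rV[R]_n * 'rV[R]_n) := (\1_E z.1 * (\1_(eball 0 rho) z.2 * phi (z.1 + z.2)))%:E.
have mF : measurable_fun setT F.
  apply/measurable_EFinP; apply: measurable_funM.
    by apply: measurableT_comp => //; exact: measurable_fst.
  apply: measurable_funM.
    by apply: measurableT_comp => //; exact: measurable_snd.
  by apply: measurableT_comp => //; exact: measurable_add_rV.
have F0 z : (0 <= F z)%E by rewrite lee_fin !mulr_ge0.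
have := fubini_tonelli (m1 := leb n) (m2 := leb n) F mF F0.
apply/eqP; rewrite gt_eqF//.
apply: (@le_lt_trans _ _ (2 * c * e * v)%:E).
  apply: (@le_trans _ _ (\int[leb n]_(y in eball 0 rho) (2 * c * e)%:E)%E); last first.
    by rewrite integral_cst// [(_ * v)%:E]EFinM -V.
  rewrite [leRHS]integral_mkcond; apply: ge0_le_integral.
  - by [].
  - by move=> y _; apply: integral_ge0.
  - exact: measurable_fun_fubini_tonelli_G.
  - apply/(measurable_restrict _ mB measurableT) => //=.
  - move=> y _; rewrite patchE /F/=; case: ifPn => yB.
      apply: le_trans (hr y _); last first.
        by move: yB; rewrite inE /eball/= subr0 => /lt_trans; apply.
      rewrite le_eqVlt; apply/orP; left; apply/eqP; apply: eq_integral => x _.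
      by rewrite [\1_(eball _ _) y]indicE yB mul1r.
    rewrite integral0_eq// => x _; by rewrite [\1_(eball _ _) y]indicE (negbTE yB) mul0r mulr0.
apply: (@lt_le_trans _ _ (3 * c * v * e)%:E).
  rewrite lte_fin; have : 0 < c * e * v by exact: mulr_gt0 (mulr_gt0 c0 e0) v0.
  have -> : 3 * c * v * e = 3 * (c * e * v) by ring.
  have -> : 2 * c * e * v = 2 * (c * e * v) by ring.
  lra.
rewrite EFinM -eE -integral_cst// [leLHS]integral_mkcond; apply: ge0_le_integral.
- by [].
- by move=> y _; rewrite patchE; case: ifP => // _;
  rewrite lee_fin; exact: ltW (mulr_gt0 (mulr_gt0 _ c0) v0).
- apply/(measurable_restrict _ mE measurableT) => //=.
- exact: measurable_fun_fubini_tonelli_F.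
move=> x _; rewrite patchE; case: ifPn => xE; last first.
  by apply: integral_ge0 => y _; exact: F0.
apply: (le_trans (big x _)); first by rewrite inE in xE.
rewrite le_eqVlt; apply/orP; left; apply/eqP; apply: eq_integral => y _.
by rewrite /F/= [\1_E x]indicE xE mul1r.
Qed.

End small_mean.

(** * Kernels and companion balls *)

Section normc_theory.
Context {R : realType}.
Implicit Types x y z : R[i].
Local Notation normc := Normc.normc.
Local Notation Re := complex.Re.
Local Notation Im := complex.Im.

Lemma normcE_sqrt z : normc z = Num.sqrt (Re z ^+ 2 + Im z ^+ 2).
Proof. by case: z. Qed.

Lemma normc_ge0 z : 0 <= normc z.
Proof. by rewrite normcE_sqrt sqrtr_ge0. Qed.

Lemma normc_distC x y : normc (x - y) = normc (y - x).
Proof. by rewrite -[LHS](@normcN R) opprB. Qed.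

Lemma le_normc_dist x y z : normc (x - z) <= normc (x - y) + normc (y - z).
Proof. by rewrite -[x - z](subrKA y) (@le_normcD R). Qed.

Lemma Re_le_normc z : Re z <= normc z.
Proof.
rewrite normcE_sqrt (le_trans (ler_norm _))// -sqrtr_sqr ler_wsqrtr//.
by rewrite lerDl sqr_ge0.
Qed.

Lemma normcR (a : R) : normc (a%:C)%C = `|a|.
Proof. by rewrite /= expr0n/= addr0 sqrtr_sqr. Qed.

Lemma Re_realM (a : R) z : Re ((a%:C)%C * z) = a * Re z.
Proof. by case: z => u v /=; rewrite mul0r subr0. Qed.

Lemma measurable_normc d (T : measurableType d) (D : set T) (F : T -> R[i]) :
  cmeasurable D F -> measurable_fun D (fun t => normc (F t)).
Proof.
move=> [mR mI].
have m2 : measurable_fun D (fun t => Re (F t) ^+ 2 + Im (F t) ^+ 2).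
  by apply: measurable_funD; exact: measurable_funX.
rewrite (_ : (fun _ => _) = (fun t => Num.sqrt (Re (F t) ^+ 2 + Im (F t) ^+ 2))).
  apply: (measurableT_comp _ m2).
  exact: continuous_measurable_fun (@sqrt_continuous R).
by apply/funext => t; rewrite normcE_sqrt.
Qed.

Lemma cmeasurable_subr d (T : measurableType d) (D : set T) (F : T -> R[i]) z :
  cmeasurable D F -> cmeasurable D (fun t => F t - z).
Proof.
move=> [mR mI]; split; under eq_fun do rewrite raddfB/=;
by apply: measurable_funB.
Qed.

End normc_theory.

Section companions.
Context {R : realType} {d : nat}.
Implicit Types (K : 'rV[R]_d -> 'rV[R]_d -> R[i]) (x y : 'rV[R]_d).
Local Notation normc := Normc.normc.

(** Values of [K] on the diagonal are arbitrary; setting them to [0] gives a function measurable on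
    the whole product, to which Tonelli applies. *)
Definition offdiag K x y : R[i] := if x == y then 0 else K x y.

Definition jointly_measurable K :=
  cmeasurable setT (fun z : 'rV[R]_d * 'rV[R]_d => K z.1 z.2).

(* Closeness to [K0] is asked in mean only: rough kernels have no pointwise
   bound. *)
Definition has_companions K (kappa eps : R) := exists (M c : R),
  [/\ 0 <= M, 0 < c & forall y0 r, 0 < r -> exists x0 (K0 : R[i]),
   [/\ kappa * r <= setdist (eball y0 r) (eball x0 r),
       enorm (x0 - y0) <= M * r,
       c * r ^- d <= normc K0,
       forall y, eball y0 r y ->
         (\int[leb d]_(x in eball x0 r) (normc (K x y - K0))%:E <=
          (eps * normc K0)%:E * leb d (eball x0 r))%E &
       forall x, eball x0 r x ->
         (\int[leb d]_(y in eball y0 r) (normc (K x y - K0))%:E <=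
          (eps * normc K0)%:E * leb d (eball y0 r))%E]].

Lemma measurable_offdiag : measurable [set z : 'rV[R]_d * 'rV[R]_d | z.1 != z.2].
Proof.
rewrite [X in measurable X](_ : _ = setT `&`
    (fun z => enorm (z.1 + -1 *: z.2)) @^-1` `]0, +oo[); last first.
  rewrite setTI; apply/seteqP; split => z; rewrite /preimage/= in_itv/= andbT;
  by rewrite scaleN1r enorm_gt0 subr_eq0.
suff : measurable_fun setT (fun z : 'rV[R]_d * 'rV[R]_d => enorm (z.1 + -1 *: z.2)).
  by apply.
apply: (measurableT_comp measurable_enorm).
apply/measurable_fun_rVP => i; under eq_fun do rewrite !mxE.
apply: measurable_funD.
  by apply: (measurableT_comp (measurable_coord i)); exact: measurable_fst.
apply: measurable_funM => //.
by apply: (measurableT_comp (measurable_coord i)); exact: measurable_snd.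
Qed.

Lemma offdiag_measurable K :
  cmeasurable [set z : 'rV[R]_d * 'rV[R]_d | z.1 != z.2] (fun z => K z.1 z.2) ->
  jointly_measurable (offdiag K).
Proof.
move=> [mR mI]; split.
- rewrite (_ : (fun _ => _) =
      (fun z => complex.Re (K z.1 z.2)) \_ [set z | z.1 != z.2]).
    exact/(measurable_restrictT _ measurable_offdiag).
  apply/funext => z; rewrite patchE /offdiag.
  by case: ifPn => e; case: ifPn => //; rewrite ?inE ?notin_setE/= e.
- rewrite (_ : (fun _ => _) =
      (fun z => complex.Im (K z.1 z.2)) \_ [set z | z.1 != z.2]).
    exact/(measurable_restrictT _ measurable_offdiag).
  apply/funext => z; rewrite patchE /offdiag.
  by case: ifPn => e; case: ifPn => //; rewrite ?inE ?notin_setE/= e.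
Qed.

Lemma jointly_measurable1 K y : jointly_measurable K ->
  cmeasurable setT (fun x => K x y).
Proof. by move=> [mR mI]; split; [exact: (measurable_fun_pair1 y mR)|exact: (measurable_fun_pair1 y mI)]. Qed.

Lemma jointly_measurable2 K x : jointly_measurable K ->
  cmeasurable setT (K x).
Proof. by move=> [mR mI]; split; [exact: (measurable_fun_pair2 x mR)|exact: (measurable_fun_pair2 x mI)]. Qed.

Lemma integral_normc_le (F : 'rV[R]_d -> R[i]) z (B : set 'rV[R]_d) (e : R) :
  cmeasurable setT F -> measurable B -> 0 <= e ->
  (forall x, B x -> normc (F x - z) <= e) ->
  (\int[leb d]_(x in B) (normc (F x - z))%:E <= e%:E * leb d B)%E.
Proof.
move=> mF mB e0 Fe; rewrite -integral_cst//; apply: ge0_le_integral.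
- by [].
- by move=> x _; rewrite lee_fin normc_ge0.
- apply/measurable_EFinP/measurable_funTS/measurable_normc.
  exact: cmeasurable_subr.
- by [].
- by move=> x Bx; rewrite lee_fin; exact: Fe.
Qed.

(** Nondegeneracy at the large radius [A r] supplies [x0]. Seen from that distance, the balls of
    radius [r] are small, so [K] varies on them by a small multiple of [|x0 - y0|^-d], which is at
    most [c0 |K x0 y0|]. The size bound on [K] in turn prevents [x0] from being too far. *)
Lemma CZ_companions K (kappa eps : R) : (0 < d)%N -> 0 < kappa -> 0 < eps ->
  nondegenerate_CZ K ->
  jointly_measurable (offdiag K) /\ has_companions (offdiag K) kappa eps.
Proof.
move=> d0 kappa0 eps0 [om [[mK om0 omle [cK KcK] Kom] omto0 [c0 c00 Kc0]]].
have mK1 := offdiag_measurable mK; split=> //.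
have offE x y : x != y -> offdiag K x y = K x y by rewrite /offdiag => /negbTE ->.
(* The total variation will be bounded by [(2^d + 1) s^-d om t0], with [s^-d <= c0 |K x0 y0|]; this
   [eta] turns it into [eps |K x0 y0|]. *)
pose eta := eps / ((2 ^+ d + 1) * c0).
have D0 : 0 < (2 ^+ d + 1) * c0 :> R by rewrite mulr_gt0// ltr_wpDl// exprn_ge0.
have eta0 : 0 < eta by rewrite divr_gt0.
have [del del0 hdel] : exists2 del : R, 0 < del &
    forall t, 0 < t -> t < del -> om t < eta.
  have /cvgrPdist_lt /(_ _ eta0) := omto0.
  move=> [e /= e0 he]; exists e => // t t0 te.
  have := he t; rewrite /= !sub0r !normrN => /(_ _ t0).
  rewrite gtr0_norm// => /(_ te) /(le_lt_trans (ler_norm _)); apply.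
(* [A >= kappa + 2] separates the balls, [A > 3] ensures the condition [|x - x'| < |x - y| / 2] of
   the modulus estimate, and [A - 1 > 1 / del] makes [t0 = 1 / (A - 1)] smaller than [del]. *)
pose A := kappa + 3 + del^-1.
have A3 : 3 < A by rewrite /A -addrA addrC -addrA ltrDl addr_gt0// invr_gt0.
have A0 : 0 < A by lra.
pose t0 := (A - 1)^-1.
have A1 : 0 < A - 1 by lra.
have t00 : 0 < t0 by rewrite invr_gt0.
have omt0 : om t0 < eta.
  apply: hdel => //; rewrite -[ltRHS]invrK ltf_pV2 ?posrE ?invr_gt0//.
  by rewrite /A; lra.
(* [m] will bound [q = |x0 - y0| / (A r)]. Comparing the size bound with nondegeneracy gives
   [q^d <= cK c0]; if [q > 1] then [q <= q^d], so no root has to be taken. *)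
pose m := Num.max 1 (cK * c0).
have m1 : 1 <= m by rewrite le_max lexx.
have m0 : 0 < m by exact: lt_le_trans m1.
have Ad0 : 0 < c0 * A ^+ d by rewrite mulr_gt0// exprn_gt0.
exists (A * m), (c0 * A ^+ d)^-1; split; [by rewrite mulr_ge0// ltW|by rewrite invr_gt0|].
move=> y0 r r0.
have Ar0 : 0 < A * r by rewrite mulr_gt0.
have [x0 x0far Kx0] := Kc0 y0 _ Ar0.
have {x0far}Ax0 : A * r <= enorm (x0 - y0) by rewrite leNgt; exact/negP.
have x0y0 : x0 != y0 by rewrite -subr_eq0 -enorm_gt0 (lt_le_trans _ Ax0).
pose s := enorm (x0 - y0).
have s0 : 0 < s by exact: lt_le_trans Ax0.
have sd0 : 0 < s ^+ d by rewrite exprn_gt0.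
have sKc0 : s ^- d <= c0 * normc (K x0 y0).
  rewrite -ler_pdivrMl//; apply: le_trans Kx0; rewrite -invfM lef_pV2 ?posrE ?mulr_gt0 ?exprn_gt0//.
  by rewrite ler_pM2l// lerXn2r// nnegrE ltW.
have sep : kappa * r <= setdist (eball y0 r) (eball x0 r).
  apply: setdist_ge => //; rewrite enorm_distC; apply: le_trans Ax0.
  have : 0 < del^-1 by rewrite invr_gt0.
  by rewrite /A => ?; rewrite -mulrDl ler_pM2r//; lra.
have disj x y : eball x0 r x -> eball y0 r y -> x != y.
  move=> xB yB; apply/eqP => xy; rewrite xy in xB.
  by apply: (@setdist_gt0_disj _ _ _ _ _ _ yB xB); rewrite (lt_le_trans _ sep)// mulr_gt0.
have main x y : eball x0 r x -> eball y0 r y ->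
    normc (K x y - K x0 y0) <= eps * normc (K x0 y0).
  rewrite /eball/= => xB yB.
  have sA : r <= s * A^-1 by rewrite ler_pdivlMr// mulrC.
  have r2s : 2 * r < s by apply: lt_le_trans Ax0; rewrite ltr_pM2r//; lra.
  have rs : r < 2^-1 * s by lra.
  have sy : s - r <= enorm (x0 - y).
    have := ler_enormB (x0 - y0) (y - y0).
    by rewrite opprB addrA subrK -/s => h; apply: le_trans h; rewrite lerD2l lerN2 ltW.
  have s3 : 3 * r < s by apply: lt_le_trans Ax0; rewrite ltr_pM2r.
  have sr : s / 2 <= s - r by lra.
  have xy0 : 0 < enorm (x0 - y) by apply: lt_le_trans sy; lra.
  have tle u v : 0 <= u -> u < r -> s - r <= v -> om (u / v) <= om t0.
    move=> u0 ur vs; have v0 : 0 < v by apply: lt_le_trans vs; lra.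
    have uvt : u / v <= t0.
      rewrite /t0 ler_pdivrMr// mulrC ler_pdivlMr//.
      have : (A - 1) * r <= v by apply: le_trans vs; rewrite mulrBl mul1r lerD2r.
      by apply: le_trans; rewrite mulrC ler_pM2l// ltW.
    apply: omle => //; first by rewrite divr_ge0// ltW.
    by rewrite /t0 invf_lt1//; lra.
  (* [x] is moved to [x0] with [y] fixed, then [y] to [y0] with [x0] fixed. In the first move the
     base distance [|x0 - y|] may drop to [s / 2], hence the factor [2^d]; in the second it is
     exactly [s]. *)
  have h1 : normc (K x0 y - K x y) <= 2 ^+ d * s ^- d * om t0.
    have := Kom x0 x y; rewrite enorm_distC => h.
    apply: le_trans (le_trans _ (h _)) _; [by rewrite lerDl normc_ge0|lra|].
    apply: ler_pM; [by rewrite invr_ge0 exprn_ge0// enorm_ge0| |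
      |by apply: tle => //; exact: enorm_ge0].
      apply: om0; rewrite divr_ge0 ?enorm_ge0//= ltr_pdivrMr// mul1r; lra.
    rewrite -exprVn -[s ^- d]exprVn -exprMn lerXn2r ?nnegrE ?invr_ge0 ?enorm_ge0//.
      by rewrite mulr_ge0// invr_ge0 ltW.
    by rewrite -[2]invrK -invfM lef_pV2 ?posrE ?mulr_gt0//; lra.
  have h2 : normc (K x0 y - K x0 y0) <= s ^- d * om t0.
    have := Kom y0 y x0; rewrite (enorm_distC y0 y) (enorm_distC y0 x0) -/s => h.
    rewrite normc_distC; apply: le_trans (le_trans _ (h _)) _;
      [by rewrite lerDr normc_ge0|lra|].
    rewrite ler_pM2l ?invr_gt0//; apply: tle => //; first exact: enorm_ge0.
    lra.
  apply: le_trans (le_normc_dist _ (K x0 y) _) _.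
  rewrite (normc_distC (K x y)); apply: le_trans (lerD h1 h2) _.
  have -> : 2 ^+ d * s ^- d * om t0 + s ^- d * om t0 =
    s ^- d * ((2 ^+ d + 1) * om t0) by ring.
  apply: (@le_trans _ _ (c0 * normc (K x0 y0) * ((2 ^+ d + 1) * eta))).
    apply: ler_pM => //; [by rewrite invr_ge0 ltW| |].
      rewrite mulr_ge0 ?addr_ge0 ?exprn_ge0//; apply: om0.
      by rewrite ltW//= /t0 invf_lt1//; lra.
    by rewrite ler_pM2l ?ltr_wpDl ?exprn_ge0// ltW.
  rewrite le_eqVlt; apply/orP; left; apply/eqP; rewrite /eta; field.
  by rewrite gt_eqF// gt_eqF// ltr_wpDl// exprn_ge0.
exists x0, (K x0 y0); split=> //.
- rewrite -/s; set q := s / (A * r).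
  suff : q <= m by rewrite /q ler_pdivrMr// => /le_trans; apply; rewrite le_eqVlt; apply/orP; left; apply/eqP; ring.
  rewrite leNgt; apply/negP => mq.
  have q1 : 1 < q by exact: le_lt_trans mq.
  have qd : q <= q ^+ d by rewrite -{1}(expr1 q) ler_weXn2l// ltW.
  suff : q ^+ d <= cK * c0.
    by move=> /(le_trans qd); rewrite leNgt => /negP; apply; apply: le_lt_trans mq; rewrite le_max lexx orbT.
  rewrite /q expr_div_n ler_pdivrMr ?exprn_gt0//.
  have := le_trans Kx0 (KcK _ _ x0y0); rewrite -/s.
  rewrite ler_pdivlMr// mulrC ler_pdivrMr ?mulr_gt0 ?exprn_gt0//.
  by rewrite mulrA.
- apply: le_trans Kx0; rewrite -invfM lef_pV2 ?posrE ?mulr_gt0 ?exprn_gt0//.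
  by rewrite exprMn mulrA.
- move=> y yB; apply: integral_normc_le => //.
  + exact: jointly_measurable1.
  + exact: measurable_eball.
  + by rewrite mulr_ge0 ?normc_ge0// ltW.
  + by move=> x xB; rewrite offE ?main// disj.
- move=> x xB; apply: integral_normc_le => //.
  + exact: jointly_measurable2.
  + exact: measurable_eball.
  + by rewrite mulr_ge0 ?normc_ge0// ltW.
  + by move=> y yB; rewrite offE ?main// disj.
Qed.

End companions.

Lemma countable_cover_pos d (T : measurableType d) (R : realType) (I : countType)
    (m : {measure set T -> \bar R}) (A : set T) (F : I -> set T) :
  measurable A -> (forall i, measurable (F i)) -> (0 < m A)%E ->
  A `<=` \bigcup_i F i -> exists i, (0 < m (F i))%E.
Proof.
move=> mA mF A0 AF; apply: contrapT => /forallNP F0.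
have nF i : m.-negligible (F i).
  apply/negligibleP => //; apply/eqP; rewrite -measure_le0 leNgt.
  by apply/negP; exact: F0.
pose G n := if unpickle n is Some i then F i else set0.
have : m.-negligible A.
  apply: (@negligibleS _ _ _ _ (\bigcup_n G n)).
    by move=> x /AF[i _ Fix]; exists (pickle i) => //; rewrite /G pickleK.
  apply: negligible_bigcup => n; rewrite /G.
  by case: unpickle => [i|]; [exact: nF|exact: negligible_set0].
by move=> /(measure_negligible mA) m0; rewrite m0 ltxx in A0.
Qed.

(** * Companions for rough homogeneous kernels *)

Section rough.
Context {R : realType} {d : nat}.
Hypothesis d0 : (0 < d)%N.
Variable Omega : 'rV[R]_d -> R[i].
Hypothesis homO : forall t x, 0 < t -> Omega (t *: x) = Omega x.
Hypothesis intO : cintegrable surface sphere Omega.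
Hypothesis nzO : ~ {ae surface, forall x : 'rV[R]_d, sphere x -> Omega x = 0}.
Implicit Types u v x y : 'rV[R]_d.
Local Notation normc := Normc.normc.
Local Notation P := (@punctured_ball R d).

(** The convolution profile of the kernel; the value [0] at the origin makes it agree with [offdiag]
    on the diagonal. *)
Definition rough_kernel u : R[i] :=
  if u == 0 then 0 else Omega u * ((enorm u ^- d)%:C)%C.
Local Notation G := rough_kernel.

Let measurable_sphere : measurable (@sphere R d).
Proof.
rewrite (_ : sphere = setT `&` (@enorm R d) @^-1` [set 1]).
  by apply: measurable_enorm => //; exact: measurable_set1.
by rewrite setTI; apply/seteqP; split.
Qed.

Let sphere_direction u : u != 0 -> sphere (direction u).
Proof.
rewrite -enorm_gt0 => u0; rewrite /sphere /direction/= enormZ.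
by rewrite gtr0_norm ?invr_gt0// mulVf// gt_eqF.
Qed.

Let Omega_direction u : u != 0 -> Omega (direction u) = Omega u.
Proof. by rewrite -enorm_gt0 => u0; rewrite /direction homO// invr_gt0. Qed.

Let direction0 : ~ sphere (direction (0 : 'rV[R]_d)).
Proof.
rewrite /sphere /direction/= scaler0 enorm0 => /eqP.
by rewrite eq_sym oner_eq0.
Qed.

Let measurable_powN : measurable_fun setT (fun u => enorm u ^- d).
Proof.
rewrite (_ : (fun _ => _) = (fun u => (enorm u `^ (-1)) ^+ d)).
  apply: measurable_funX.
  exact: (measurableT_comp (measurable_powR (-1)) measurable_enorm).
by apply/funext => u; rewrite powR_inv1 ?sqrtr_ge0// exprVn.
Qed.

(** [Omega] is known to be measurable on the sphere only; homogeneity rewrites it as its restriction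
    to the sphere composed with [direction]. The origin has direction [0], off the sphere, where the
    restriction takes the value [0] as wanted. *)
Lemma rough_kernel_measurable : cmeasurable setT G.
Proof.
have [/measurable_int/measurable_EFinP mR /measurable_int/measurable_EFinP mI] := intO.
have mdir (f : 'rV[R]_d -> R) : measurable_fun sphere f ->
    measurable_fun setT (fun u => (f \_ sphere) (direction u) * enorm u ^- d).
  move=> mf; apply: measurable_funM => //.
  apply: (measurableT_comp _ measurable_direction).
  exact/(measurable_restrictT _ measurable_sphere).
split.
- rewrite (_ : (fun _ => _) =
    (fun u => ((fun x => complex.Re (Omega x)) \_ sphere) (direction u) * enorm u ^- d)).
    exact: mdir.
  apply/funext => u; rewrite /G patchE; case: eqP => [->|/eqP u0].
    by rewrite memNset ?mul0r//; exact: direction0.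
  rewrite mem_set ?Omega_direction//; last exact: sphere_direction.
  by rewrite mulrC Re_realM mulrC.
- rewrite (_ : (fun _ => _) =
    (fun u => ((fun x => complex.Im (Omega x)) \_ sphere) (direction u) * enorm u ^- d)).
    exact: mdir.
  apply/funext => u; rewrite /G patchE; case: eqP => [->|/eqP u0].
    by rewrite memNset ?mul0r//; exact: direction0.
  rewrite mem_set ?Omega_direction//; last exact: sphere_direction.
  by case: (Omega u) => a b /=; rewrite mulr0 add0r.
Qed.

Lemma rough_kernelZ (t : R) u : 0 < t -> G (t *: u) = ((t ^- d)%:C)%C * G u.
Proof.
move=> t0; rewrite /G scaler_eq0 gt_eqF//=; case: eqP => [|_]; first by rewrite mulr0.
rewrite homO// enormZ gtr0_norm// exprMn invfM mulrCA; congr (_ * _).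
by rewrite rmorphM.
Qed.

(** [surface] involves both [direction] and a restriction to the punctured ball. Sending the points
    outside that ball to [0], which is off the sphere, merges the two into one pushforward of
    [leb]. *)
Let dirP u := \1_P u *: direction u.

Let measurable_dirP : measurable_fun setT dirP.
Proof.
apply/measurable_fun_rVP => i; under eq_fun do rewrite mxE.
apply: measurable_funM; first exact: measurable_indic measurable_punctured_ball.
exact: (measurableT_comp (measurable_coord i) measurable_direction).
Qed.

Let dirPE u : P u -> dirP u = direction u.
Proof. by move=> Pu; rewrite /dirP indicE mem_set// scale1r. Qed.

Let dirP_sphere (A : set 'rV[R]_d) : A `<=` sphere ->
  dirP @^-1` A = direction @^-1` A `&` P.
Proof.
move=> As; apply/seteqP; split => u; rewrite /preimage/=.
  have [Pu|Pu] := pselect (P u); first by rewrite dirPE.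
  move=> /As; rewrite /dirP indicE memNset// scale0r /sphere/= enorm0 => /eqP.
  by rewrite eq_sym oner_eq0.
by move=> [? ?]; rewrite dirPE.
Qed.

Let punctured_neq0 u : P u -> u != 0.
Proof. by rewrite /punctured_ball/= -enorm_gt0 => /andP[]. Qed.

(** By homogeneity [f] equals [f] after [dirP] on the punctured ball, and on subsets of the sphere
    [surface] is [d] times the pushforward of [leb] by [dirP]. As [d] is positive, an infinite
    integral on the ball would give an infinite one on the sphere. *)
Let integrable_punctured (f : 'rV[R]_d -> R) :
  surface.-integrable sphere (EFin \o f) ->
  (forall t x, 0 < t -> f (t *: x) = f x) ->
  (\int[leb d]_(u in P) `|f u|%:E < +oo)%E.
Proof.
move=> /integrableP[/measurable_EFinP mf foo] homf.
have mf' : measurable_fun sphere (fun x => `|f x|%:E).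
  by apply/measurable_EFinP; apply: measurableT_comp.
have := ge0_integral_pushforward measurable_dirP (leb d) measurable_sphere mf'.
have -> : dirP @^-1` sphere = P.
  rewrite dirP_sphere//; apply/seteqP; split=> [u []//|u Pu]; split=> //.
  by apply: sphere_direction; exact: punctured_neq0.
have -> : (\int[leb d]_(x in P) ((fun x => `|f x|%:E) \o dirP) x =
    \int[leb d]_(x in P) `|f x|%:E)%E.
  apply: eq_integral => u; rewrite inE => Pu /=.
  by rewrite dirPE// /direction homf// invr_gt0 enorm_gt0 punctured_neq0.
move=> <-; last by move=> x _; rewrite lee_fin.
have dR0 : 0 <= (d%:R : R) by [].
have : (d%:R%:E * \int[pushforward (leb d) dirP]_(x in sphere) `|f x|%:E < +oo)%E.
  rewrite -(ge0_integral_mscale _ measurable_sphere (NngNum dR0) mf')//.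
  apply: le_lt_trans foo; rewrite le_eqVlt; apply/orP; left; apply/eqP.
  apply: eq_measure_integral.
  by move=> A mA As; rewrite /= /mscale/= /pushforward dirP_sphere.
rewrite muleC ltNge => /negP h; rewrite ltNge; apply/negP => hoo; apply: h.
by move: hoo; rewrite leye_eq => /eqP ->; rewrite gt0_mulye// lte_fin ltr0n.
Qed.

Let normc_le_ReIm (z : R[i]) : normc z <= `|complex.Re z| + `|complex.Im z|.
Proof.
case: z => a b /=; rewrite -(@ler_pXn2r _ 2) ?nnegrE ?sqrtr_ge0 ?addr_ge0//.
rewrite sqr_sqrtr ?addr_ge0 ?sqr_ge0// sqrrD !real_normK ?num_real//.
by rewrite lerD2r lerDl mulrn_wge0// mulr_ge0.
Qed.

Let annulus (s : R) : set 'rV[R]_d := [set u | s < enorm u <= 1].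

Let measurable_annulus (s t : R) : measurable [set u : 'rV[R]_d | s < enorm u <= t].
Proof.
rewrite [X in measurable X](_ : _ = setT `&` (@enorm R d) @^-1` `]s, t]).
  by apply: measurable_enorm => //; exact: measurable_itv.
by rewrite setTI; apply/seteqP; split => x; rewrite /preimage/= in_itv.
Qed.

(** Cutting out a ball around the origin bounds the singular factor [|u|^-d] by [s^-d], and what
    remains is integrable by [integrable_punctured]. *)
Lemma rough_kernel_integrable (s : R) (w : R[i]) : 0 < s ->
  (leb d).-integrable setT (fun u => (\1_(annulus s) u * normc (G u - w))%:E).
Proof.
move=> s0; have [iR iI] := intO; have [mR mI] := rough_kernel_measurable.
have mA : measurable (annulus s) by exact: measurable_annulus.
have mg : measurable_fun setT (fun u => (normc (G u - w))%:E).
  by apply/measurable_EFinP/measurable_normc/cmeasurable_subr.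
apply/integrableP; split.
  by apply/measurable_EFinP/measurable_funM => //; apply/measurable_EFinP.
apply: (@le_lt_trans _ _ (\int[leb d]_(u in annulus s) (normc (G u - w))%:E)%E).
  rewrite [leRHS]integral_indicM le_eqVlt; apply/orP; left; apply/eqP.
  by apply: eq_integral => u _; rewrite gee0_abs// lee_fin mulr_ge0// normc_ge0.
have sP : annulus s `<=` P.
  by move=> u /andP[su u1]; rewrite /punctured_ball/= u1 andbT (lt_trans s0).
have homR t x : 0 < t -> complex.Re (Omega (t *: x)) = complex.Re (Omega x) by move=> ?; rewrite homO.
have homI t x : 0 < t -> complex.Im (Omega (t *: x)) = complex.Im (Omega x) by move=> ?; rewrite homO.
have mO (f : 'rV[R]_d -> R) : surface.-integrable sphere (EFin \o f) ->
  (forall t x, 0 < t -> f (t *: x) = f x) -> measurable_fun P f.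
  move=> /measurable_int/measurable_EFinP mf hf.
  apply: (@eq_measurable_fun _ _ _ _ _ ((f \_ sphere) \o direction)).
    move=> u; rewrite inE => Pu /=; have u0 := punctured_neq0 Pu.
    rewrite patchE mem_set; last exact: sphere_direction.
    by rewrite /direction hf// invr_gt0 enorm_gt0.
  apply: measurable_funTS; apply: (measurableT_comp _ measurable_direction).
  exact/(measurable_restrictT _ measurable_sphere).
have mS f : measurable_fun P f -> measurable_fun (annulus s) f.
  by apply: measurable_funS => //; exact: measurable_punctured_ball.
have finf (f : 'rV[R]_d -> R) : surface.-integrable sphere (EFin \o f) ->
  (forall t x, 0 < t -> f (t *: x) = f x) ->
  (\int[leb d]_(u in annulus s) (s ^- d * `|f u|)%:E < +oo)%E.
  move=> hf hf'; have mf := mO f hf hf'.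
  have sd0 : 0 <= s ^- d by rewrite invr_ge0 exprn_ge0// ltW.
  under eq_integral do rewrite EFinM.
  rewrite ge0_integralZl_EFin//; last first.
    by apply/measurable_EFinP; apply: measurableT_comp => //; exact: mS mf.
  rewrite lte_mul_pinfty//.
  apply: le_lt_trans (integrable_punctured hf hf').
  apply: ge0_subset_integral => //; first exact: measurable_punctured_ball.
  by apply/measurable_EFinP; apply: measurableT_comp.
have mR' := mO _ iR homR; have mI' := mO _ iI homI.
have mRs : measurable_fun (annulus s) (fun u => s ^- d * `|complex.Re (Omega u)|).
  apply: measurable_funM => //; apply: measurableT_comp => //; exact: mS mR'.
have mIs : measurable_fun (annulus s) (fun u => s ^- d * `|complex.Im (Omega u)|).
  apply: measurable_funM => //; apply: measurableT_comp => //; exact: mS mI'.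
have sd0 : 0 <= s ^- d by rewrite invr_ge0 exprn_ge0// ltW.
apply: (@le_lt_trans _ _ (\int[leb d]_(u in annulus s)
    ((s ^- d * `|complex.Re (Omega u)|)%:E + ((s ^- d * `|complex.Im (Omega u)|)%:E
     + (normc w)%:E)))%E).
  apply: ge0_le_integral.
  - by [].
  - by move=> u _; rewrite lee_fin normc_ge0.
  - exact: measurable_funTS.
  - by apply/measurable_EFinP; apply: measurable_funD => //; apply: measurable_funD.
  move=> u us; rewrite -!EFinD lee_fin addrA.
  apply: le_trans (@le_normcD R _ _) _; rewrite (@normcN R) lerD2r.
  have Pu := sP _ us; rewrite /G (negbTE (punctured_neq0 Pu)) Normc.normcM normcR.
  rewrite mulrC -mulrDr; apply: ler_pM => //; [exact: normc_ge0|].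
  have /andP[su _] := us.
  rewrite ger0_norm ?invr_ge0 ?exprn_ge0 ?enorm_ge0//.
  have u0 : 0 < enorm u by exact: lt_trans su.
  by rewrite lef_pV2 ?posrE ?exprn_gt0// lerXn2r ?nnegrE// ltW.
rewrite ge0_integralD//; last 4 first.
- by move=> u _; rewrite lee_fin mulr_ge0.
- exact/measurable_EFinP.
- by move=> u _; rewrite -EFinD lee_fin addr_ge0 ?mulr_ge0 ?normc_ge0.
- by apply/measurable_EFinP; apply: measurable_funD.
rewrite ge0_integralD//; last 3 first.
- by move=> u _; rewrite lee_fin mulr_ge0.
- exact/measurable_EFinP.
- by move=> u _; rewrite lee_fin normc_ge0.
apply: lte_add_pinfty; first exact: (finf _ iR homR).
apply: lte_add_pinfty; first exact: (finf _ iI homI).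
apply: (@le_lt_trans _ _ ((normc w)%:E * leb d (annulus s))%E).
  by rewrite -integral_cst.
rewrite lte_mul_pinfty ?lee_fin ?normc_ge0//.
apply: (@le_lt_trans _ _ (leb d (cbox 1))).
  apply: le_measure; rewrite ?inE//; first exact: measurable_cbox.
  move=> u /andP[_ u1] i; rewrite /= in_itv/= -ler_norml.
  exact: le_trans (coord_le_enorm _ _) u1.
by rewrite leb_cbox// ltry.
Qed.

(** The set where [Omega] does not vanish is a cone, so this volume times [d] is the surface measure
    of its trace on the sphere, which is not zero by [nzO]. *)
Let pos_punctured : (0 < leb d (P `&` [set u | (G u != 0)%R]))%E.
Proof.
have [/measurable_int/measurable_EFinP mR /measurable_int/measurable_EFinP mI] := intO.
rewrite lt_neqAle measure_ge0 andbT; apply/eqP => /esym m0; apply: nzO.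
pose N := sphere `&` [set x | normc (Omega x) != 0].
have mN : measurable N.
  rewrite (_ : N = sphere `&` (fun x => normc (Omega x)) @^-1` (~` [set 0])).
    apply: (measurable_normc (conj mR mI) measurable_sphere).
    exact: measurableC.
  by congr (_ `&` _); apply/seteqP; split => x /= /eqP.
exists N; split => //.
  suff : leb d (direction @^-1` N `&` P) = 0%E by rewrite /= /surface => ->; rewrite mule0.
  rewrite -[RHS]m0; congr (leb d _); apply/seteqP; split => u /=.
    move=> [[us Ou] Pu]; split=> //; rewrite /G (negbTE (punctured_neq0 Pu)).
    apply: contra_neq Ou => h; rewrite Omega_direction ?punctured_neq0//.
    apply/eqP; have := congr1 (@Normc.normc R) h; rewrite Normc.normcM normcR Normc.normc0 => /eqP.
    have u0 : (enorm u == 0) = false by rewrite gt_eqF// enorm_gt0 punctured_neq0.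
    by rewrite mulf_eq0 normr_eq0 invr_eq0 expf_eq0 d0/= u0 orbF.
  move=> [Pu]; rewrite /G (negbTE (punctured_neq0 Pu)) => Gu.
  split=> //; split; first by apply: sphere_direction; exact: punctured_neq0.
  apply: contra_neq Gu; rewrite Omega_direction ?punctured_neq0// => /(@Normc.eq0_normc R) ->.
  by rewrite mul0r.
move=> x /= /not_implyP[sx Ox]; split => //=.
by apply/eqP => /(@Normc.eq0_normc R).
Qed.

Let measurable_G_neq0 : measurable [set u | G u != 0].
Proof.
have := measurable_normc rough_kernel_measurable measurableT (measurableC (measurable_set1 0)).
rewrite setTI; congr measurable; apply/seteqP; split => u /=.
  by move=> h; apply/eqP => Gu; apply: h; rewrite Gu Normc.normc0.
by move=> /eqP h /(@Normc.eq0_normc R).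
Qed.

Let approx_complex (g : R[i]) (e : R) : g != 0 -> 0 < e ->
  exists q : rat * rat, normc (g - Complex (ratr q.1) (ratr q.2)) <
    e * normc (Complex (ratr q.1) (ratr q.2)).
Proof.
move=> g0 e0; have ng0 : 0 < normc g.
  rewrite lt_neqAle normc_ge0 andbT eq_sym.
  by apply: contra_neq g0; exact: Normc.eq0_normc.
(* Both coordinates are approximated within [h], so the error is below [2 h = e |g| / (1 + e)]. The
   approximant then has size at least [|g| - 2 h = |g| / (1 + e)], and the error is below [e] times
   that size. *)
pose h := e * normc g / (2 * (1 + e)).
have h0 : 0 < h by rewrite divr_gt0 ?mulr_gt0// addr_gt0.
have rat_near (a : R) : exists q : rat, `|a - ratr q| < h.
  have [|q] := @rat_in_itvoo R (a - h) (a + h); first by lra.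
  by rewrite in_itv/= => /andP[? ?]; exists q; rewrite ltr_norml; apply/andP; split; lra.
have [q1 hq1] := rat_near (complex.Re g); have [q2 hq2] := rat_near (complex.Im g).
pose w : R[i] := Complex (ratr q1) (ratr q2).
exists (q1, q2); change (normc (g - w) < e * normc w).
have gw : normc (g - w) < 2 * h.
  apply: le_lt_trans (normc_le_ReIm _) _; rewrite !raddfB/=; lra.
apply: (lt_le_trans gw).
have : normc g <= normc (g - w) + normc w.
  by rewrite -{1}(subrK w g) (@le_normcD R).
have -> : 2 * h = e * (normc g / (1 + e)) by rewrite /h; field; rewrite gt_eqF// addr_gt0.
have : 2 * h = normc g - normc g / (1 + e) by rewrite /h; field; rewrite gt_eqF// addr_gt0.
by move=> *; rewrite (ler_pM2l e0); lra.
Qed.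

(** Dilation by [2] transfers [pos_punctured] to radius one half. The room left up to radius [1]
    will contain small balls around the points of this set. *)
Let pos_half : (0 < leb d ([set u | (0 < enorm u <= 2^-1)%R] `&` [set u | (G u != 0)%R]))%E.
Proof.
have -> : [set u | 0 < enorm u <= 2^-1] `&` [set u | G u != 0] =
    (fun u => 2 *: u + 0) @^-1` (P `&` [set u | G u != 0]).
  apply/seteqP; split => u; rewrite /preimage/punctured_ball/= addr0.
    move=> [/andP[u0 u1] Gu]; rewrite enormZ gtr0_norm// mulr_gt0//=; split; first by lra.
    rewrite rough_kernelZ//; apply/eqP => h; move/eqP: Gu; apply.
    apply: Normc.eq0_normc; apply/eqP; have := congr1 (@Normc.normc R) h.
    rewrite Normc.normcM normcR Normc.normc0 => /eqP; rewrite mulf_eq0 normr_eq0.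
    by rewrite invr_eq0 expf_eq0 pnatr_eq0 andbF.
  rewrite enormZ gtr0_norm// => -[/andP[u0 u1] Gu]; split.
    by apply/andP; split; lra.
  apply: contra_neq Gu => h; rewrite rough_kernelZ// h mulr0//.
rewrite leb_affine//; last first.
  apply: measurableI => //; exact: measurable_punctured_ball.
by rewrite mule_gt0// lte_fin invr_gt0 exprn_gt0// normr_gt0.
Qed.

(** The sets with inner radius [1 / (n + 1)] and rational complex level [w] are countably many and
    cover a set of positive measure. Since the error is relative to [w] and strict, [w = 0] would
    give an empty set. *)
Let exists_level_set (e : R) : 0 < e -> exists (s : R) (w : R[i]), [/\ 0 < s, w != 0 &
  (0 < leb d ([set u | (s < enorm u <= 2^-1)%R] `&` [set u | (normc (G u - w) < e * normc w)%R]))%E].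
Proof.
move=> e0.
pose F (i : nat * (rat * rat)) : set 'rV[R]_d :=
  [set u | i.1.+1%:R^-1 < enorm u <= 2^-1] `&`
  [set u | normc (G u - Complex (ratr i.2.1) (ratr i.2.2)) <
     e * normc (Complex (ratr i.2.1 : R) (ratr i.2.2))].
have mF i : measurable (F i).
  apply: measurableI; first exact: measurable_annulus.
  have := measurable_normc (cmeasurable_subr (Complex (ratr i.2.1) (ratr i.2.2))
    rough_kernel_measurable) measurableT
    (measurable_itv `]-oo, e * normc (Complex (ratr i.2.1 : R) (ratr i.2.2))[).
  by rewrite setTI; congr measurable; apply/seteqP; split => u; rewrite /preimage/= in_itv.
have [] := countable_cover_pos _ mF pos_half.
- by apply: measurableI => //; exact: measurable_annulus.
- move=> u [/andP[u0 u1] Gu]; have [q hq] := approx_complex Gu e0.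
  have [n hn] : exists n : nat, n.+1%:R^-1 < enorm u.
    exists (Num.bound (enorm u)^-1).
    rewrite -[ltRHS]invrK ltf_pV2 ?posrE ?invr_gt0 ?ltr0n//.
    apply: lt_trans (archi_boundP _) _; first by rewrite invr_ge0 enorm_ge0.
    by rewrite ltr_nat.
  by exists (n, q) => //; split => //=; rewrite hn.
move=> [n q] Fpos; pose w : R[i] := Complex (ratr q.1) (ratr q.2).
exists n.+1%:R^-1, w; split; [by rewrite invr_gt0|apply/eqP => w0|exact: Fpos].
suff F0 : F (n, q) = set0 by rewrite F0 measure0 ltxx in Fpos.
apply/seteqP; split => // u [_ hu].
have : normc (G u - w) < e * normc w by exact: hu.
by rewrite w0 Normc.normc0 mulr0 ltNge normc_ge0.
Qed.

(** On average [G] is close to [w] in a small ball around [z]. The dilation by [t] carries this ball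
    to one that contains all differences [x - y] between the two balls of radius [r], and by
    homogeneity [G] is there close to [t^-d w]. *)
Lemma rough_kernel_companions (kappa eps : R) : 0 < kappa -> 0 < eps ->
  has_companions (fun x y => G (x - y)) kappa eps.
Proof.
move=> kappa0 eps0.
(* The factor [3] is lost in [exists_small_mean], and [2^d] is lost because a slice fills a ball of
   radius [r] inside the dilated ball of radius [2 r]. *)
pose e0 := eps * 2 ^- d / 3.
have e00 : 0 < e0 by rewrite divr_gt0// mulr_gt0// invr_gt0 exprn_gt0.
have [s [w [s0 w0 Epos]]] := exists_level_set e00.
set E := (X in leb d X) in Epos.
have nw0 : 0 < normc w.
  by rewrite lt_neqAle normc_ge0 andbT eq_sym; apply: contra_neq w0; exact: Normc.eq0_normc.
pose phi u := \1_(annulus (s / 2)) u * normc (G u - w).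
have s20 : 0 < s / 2 by rewrite divr_gt0.
have iphi : (leb d).-integrable setT (EFin \o phi) by exact: rough_kernel_integrable.
have phi0 u : 0 <= phi u by rewrite mulr_ge0// normc_ge0.
have mE : measurable E.
  apply: measurableI; first exact: measurable_annulus.
  have := measurable_normc (cmeasurable_subr w rough_kernel_measurable) measurableT
    (measurable_itv `]-oo, e0 * normc w[).
  by rewrite setTI; congr measurable; apply/seteqP; split => u; rewrite /preimage/= in_itv.
have Ek : E `<=` cbox 1.
  move=> u [/andP[_ u1] _] i; rewrite /= in_itv/= -ler_norml.
  by apply: le_trans (coord_le_enorm _ _) (le_trans u1 _); rewrite invf_le1// ler1n.
have c0 : 0 < e0 * normc w by rewrite mulr_gt0.
have Ec u : E u -> phi u <= e0 * normc w.
  move=> [_ /ltW]; apply: le_trans; rewrite /phi indicE.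
  by case: (_ \in _); rewrite ?mul1r// mul0r normc_ge0.
(* The first bound gives the separation of the balls, the second keeps the ball around [z] at
   distance [s / 2] from the origin, the third keeps it in the unit ball. *)
pose delta := Num.min (s / (1 + kappa)) (Num.min (s / 2) 2^-1).
have delta0 : 0 < delta.
  by rewrite !lt_min s20 divr_gt0 ?addr_gt0//= invr_gt0.
have [z [rho [Ez rho0]]] := exists_small_mean d0 phi0 iphi mE Ek Epos c0 Ec delta0.
rewrite !lt_min => /and3P[rhos rhos2 rho2] mean.
have [/andP[sz z2] _] := Ez.
have ballA : eball z rho `<=` annulus (s / 2).
  move=> u; rewrite /eball/annulus/= => uz.
  have h1 := ler_enormB z (z - u); rewrite subKr in h1.
  have h2 := ler_enormD (u - z) z; rewrite subrK in h2.
  by rewrite (enorm_distC z u) in h1; apply/andP; split; lra.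
have {mean}mean : (\int[leb d]_u (\1_(eball z rho) u * normc (G u - w))%:E <=
    (eps * 2 ^- d * normc w * (ball_vol R d * rho ^+ d))%:E)%E.
  have -> : (eps * 2 ^- d * normc w * (ball_vol R d * rho ^+ d))%:E =
    ((3 * (e0 * normc w))%:E * leb d (eball (0 : 'rV[R]_d) rho))%E.
    by rewrite leb_eball// -EFinM; congr EFin; rewrite /e0; field.
  apply: le_trans mean; rewrite [leRHS]integral_indicM le_eqVlt; apply/orP; left; apply/eqP.
  apply: eq_integral => u _; rewrite /phi !indicE.
  have [uB|uB] := pselect (eball z rho u); last by rewrite (memNset uB) !mul0r.
  by rewrite (mem_set uB) (mem_set (ballA _ uB)) !mul1r.
(* The difference [x - y] deviates from its central value by less than [2 r], so [rho] has to be
   dilated to [2 r]. *)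
pose t r : R := 2 * r / rho.
have t0 r : 0 < r -> 0 < t r by move=> r0; rewrite divr_gt0// mulr_gt0.
have key (r a : R) (c : 'rV[R]_d) (B : set 'rV[R]_d) : 0 < r -> `|a| = (t r)^-1 ->
    measurable B -> (forall v, B v -> eball z rho (a *: v + c)) ->
    (\int[leb d]_(v in B) (normc (G (t r *: (a *: v + c)) - ((t r ^- d)%:C)%C * w))%:E <=
      (eps * normc (((t r ^- d)%:C)%C * w))%:E * (ball_vol R d * r ^+ d)%:E)%E.
  move=> r0 ar mB Bz; have tr0 := t0 _ r0.
  have a0 : a != 0 by rewrite -normr_eq0 ar invr_eq0 gt_eqF.
  have td0 : 0 < t r ^- d by rewrite invr_gt0 exprn_gt0.
  pose f u := (t r ^- d * (\1_(eball z rho) u * normc (G u - w)))%:E.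
  have mf : measurable_fun setT f.
    apply/measurable_EFinP/measurable_funM => //; apply: measurable_funM.
      by apply: measurable_indic; exact: measurable_eball.
    exact/measurable_normc/cmeasurable_subr/rough_kernel_measurable.
  have f0 u : (0 <= f u)%E by rewrite lee_fin mulr_ge0 ?mulr_ge0 ?normc_ge0// ltW.
  have mfa : measurable_fun setT (fun v => f (a *: v + c)).
    by apply: measurableT_comp mf _; exact: measurable_affine.
  apply: (@le_trans _ _ (\int[leb d]_v f (a *: v + c)%R)%E).
    rewrite integral_mkcond; apply: ge0_le_integral.
    - by [].
    - by move=> v _; rewrite patchE; case: ifP => // _; rewrite lee_fin normc_ge0.
    - apply/(measurable_restrictT _ mB); apply: measurable_funTS.
      apply/measurable_EFinP/measurable_normc/cmeasurable_subr.
      have [mR mI] := rough_kernel_measurable.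
      have mm : measurable_fun setT (fun v => t r *: (a *: v + c)).
        under eq_fun do rewrite scalerDr scalerA.
        exact: measurable_affine.
      by split; [exact: (measurableT_comp mR mm)|exact: (measurableT_comp mI mm)].
    - exact: mfa.
    move=> v _; rewrite patchE; case: ifPn => [|_]; last exact: f0.
    rewrite inE => /Bz Bv; rewrite rough_kernelZ// -mulrBr Normc.normcM normcR.
    by rewrite gtr0_norm// lee_fin indicE mem_set// mul1r.
  rewrite ge0_integral_affine// ar.
  have -> : (t r)^-1 ^- d = t r ^+ d by rewrite exprVn invrK.
  rewrite /f; under eq_integral do rewrite EFinM.
  rewrite ge0_integralZl_EFin//; last 3 first.
  - by move=> u _; rewrite lee_fin mulr_ge0// normc_ge0.
  - apply/measurable_EFinP; apply: measurable_funM.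
      by apply: measurable_indic; exact: measurable_eball.
    exact/measurable_normc/cmeasurable_subr/rough_kernel_measurable.
  - exact: ltW.
  rewrite muleA -EFinM mulfV ?mul1e; last by rewrite expf_neq0// gt_eqF.
  apply: le_trans mean _; rewrite -EFinM lee_fin Normc.normcM normcR gtr0_norm//.
  rewrite le_eqVlt; apply/orP; left; apply/eqP.
  rewrite /t expr_div_n exprMn; field.
  by rewrite ?gt_eqF// ?exprn_gt0.
have M0 : 0 <= 2 / rho * enorm z by rewrite mulr_ge0 ?enorm_ge0// divr_ge0// ltW.
have cc0 : 0 < (2 / rho) ^- d * normc w.
  by rewrite mulr_gt0// invr_gt0 exprn_gt0// divr_gt0.
exists (2 / rho * enorm z), ((2 / rho) ^- d * normc w); split => //.
move=> y0 r r0; have tr0 := t0 _ r0.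
exists (y0 + t r *: z), (((t r ^- d)%:C)%C * w).
have dist : enorm ((y0 + t r *: z) - y0) = t r * enorm z.
  by rewrite addrC addKr enormZ gtr0_norm.
have sub_ball x y : eball (y0 + t r *: z) r x -> eball y0 r y ->
    enorm ((t r)^-1 *: (x - y) - z) < rho.
  rewrite /eball/= => xB yB.
  have -> : (t r)^-1 *: (x - y) - z = (t r)^-1 *: (x - (y0 + t r *: z) - (y - y0)).
    apply/rowP => i; rewrite !mxE; field; exact: lt0r_neq0.
  rewrite enormZ gtr0_norm ?invr_gt0// mulrC ltr_pdivrMr//.
  have -> : rho * t r = r + r by rewrite /t; field; exact: lt0r_neq0.
  by apply: le_lt_trans (ler_enormD _ _) _; rewrite enormN ltrD.
split.
- apply: setdist_ge => //; rewrite enorm_distC dist.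
  have : (1 + kappa) * rho < s by rewrite mulrC -ltr_pdivlMr// addr_gt0.
  move=> h; have -> : kappa * r + 2 * r = (2 + kappa) / 2 * rho * t r.
    by rewrite /t; field; exact: lt0r_neq0.
  rewrite mulrC ler_pM2l//; apply: le_trans (ltW sz).
  apply: le_trans (ltW h); rewrite ler_pM2r//; lra.
- by rewrite dist /t le_eqVlt; apply/orP; left; apply/eqP; ring.
- rewrite Normc.normcM normcR gtr0_norm ?invr_gt0 ?exprn_gt0// /t mulrAC.
  by rewrite mulrAC mulrAC -invfM -exprMn mulrAC -mulrA mulrC.
- move=> y yB; rewrite leb_eball//.
  have := key r (t r)^-1 (- ((t r)^-1 *: y)) (eball (y0 + t r *: z) r) r0.
  rewrite gtr0_norm ?invr_gt0// => /(_ erefl (measurable_eball _ _)).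
  have E1 x : t r *: ((t r)^-1 *: x - (t r)^-1 *: y) = x - y.
    by rewrite -scalerBr scalerA mulfV ?scale1r// gt_eqF.
  under eq_integral do rewrite E1.
  by apply=> x xB; rewrite -scalerBr; exact: sub_ball.
- move=> x xB; rewrite leb_eball//.
  have := key r (- (t r)^-1) ((t r)^-1 *: x) (eball y0 r) r0.
  rewrite normrN gtr0_norm ?invr_gt0// => /(_ erefl (measurable_eball _ _)).
  have E1 y : t r *: (- (t r)^-1 *: y + (t r)^-1 *: x) = x - y.
    by rewrite addrC scaleNr -scalerBr scalerA mulfV ?scale1r// gt_eqF.
  under eq_integral do rewrite E1.
  by apply=> y yB; rewrite addrC scaleNr -scalerBr; exact: sub_ball.
Qed.

End rough.

Lemma nondegenerate_companions (R : realType) (d : nat)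
    (K : 'rV[R]_d -> 'rV[R]_d -> R[i]) (kappa eps : R) :
  (0 < d)%N -> 0 < kappa -> 0 < eps -> nondegenerate_kernel K ->
  jointly_measurable (offdiag K) /\ has_companions (offdiag K) kappa eps.
Proof.
move=> d0 k0 e0 [hCZ|[ Omega [hom int nz KO]]]; first exact: CZ_companions.
have -> : offdiag K = fun x y => rough_kernel Omega (x - y).
  apply/funext => x; apply/funext => y; rewrite /offdiag /rough_kernel subr_eq0.
  by case: eqP => // /eqP /KO.
split; last exact: rough_kernel_companions.
have [mR mI] := rough_kernel_measurable hom int.
have ms : measurable_fun setT (fun z : 'rV[R]_d * 'rV[R]_d => z.1 - z.2).
  apply/measurable_fun_rVP => i; under eq_fun do rewrite !mxE.
  apply: measurable_funB.
    by apply: (measurableT_comp (measurable_coord i)); exact: measurable_fst.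
  by apply: (measurableT_comp (measurable_coord i)); exact: measurable_snd.
by split; [exact: (measurableT_comp mR ms)|exact: (measurableT_comp mI ms)].
Qed.

(** * Medians *)

Section median.
Context d (T : measurableType d) (R : realType) (m : {measure set T -> \bar R}).
Variables (b : T -> R) (B : set T).
Hypotheses (mb : measurable_fun setT b) (mB : measurable B).
Variable V : R.
Hypotheses (V0 : 0 < V) (mBV : m B = V%:E).

Let le_set (t : R) := B `&` [set x | b x <= t].

Let mle t : measurable (le_set t).
Proof.
rewrite /le_set (_ : [set x | _] = setT `&` b @^-1` `]-oo, t]).
  by apply: measurableI => //; exact: mb.
by rewrite setTI; apply/seteqP; split => x; rewrite /preimage/= in_itv.
Qed.

Let le_set_subset s t : s <= t -> le_set s `<=` le_set t.
Proof. by move=> st x [Bx bs]; split=> //=; exact: le_trans st. Qed.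

Let le_m s t : s <= t -> (m (le_set s) <= m (le_set t))%E.
Proof. by move=> st; apply: le_measure; rewrite ?inE//; exact: le_set_subset. Qed.

Let m_fin (A : set T) : measurable A -> A `<=` B -> (m A < +oo)%E.
Proof.
move=> mA AB; apply: (@le_lt_trans _ _ (m B)); last by rewrite mBV ltry.
by apply: le_measure; rewrite ?inE.
Qed.

(** The median is the infimum of the levels whose sublevel set fills at least half of [B].
    Continuity from above shows that the sublevel set at the infimum does so too; continuity from
    below shows that the strict one fills at most half, so its complement fills at least half. *)
Lemma exists_median : exists a : R,
  ((V / 2)%:E <= m (B `&` [set x | (a <= b x)%R]))%E /\
  ((V / 2)%:E <= m (B `&` [set x | (b x <= a)%R]))%E.
Proof.
have V2 : V / 2 < V by move: V0; lra.
pose S := [set t | ((V / 2)%:E <= m (le_set t))%E].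
have Sup s t : S s -> s <= t -> S t by move=> h /le_m; exact: le_trans.
have S0 : S !=set0.
  have : m (le_set n%:R) @[n --> \oo] --> m (\bigcup_n le_set n%:R).
    apply: nondecreasing_cvg_mu => //; first exact: bigcup_measurable.
    by apply/nondecreasing_seqP => n; apply/subsetPset/le_set_subset; rewrite ler_nat.
  rewrite (_ : \bigcup_n _ = B); last first.
    apply/seteqP; split => x; first by move=> [n _ []].
    move=> Bx; exists (Num.bound `|b x|) => //; split=> //=.
    by apply: le_trans (ler_norm _) _; apply/ltW/archi_boundP.
  have VB : ((V / 2)%:E < m B)%E by rewrite mBV lte_fin.
  by move=> /(_ _ (open_ereal_gt' VB)) [n _ /(_ n (leqnn _)) /ltW]; exists n%:R.
have [L SL] : exists L, lbound S L.
  have : m (le_set (- n%:R)) @[n --> \oo] --> m (\bigcap_n le_set (- n%:R)).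
    apply: nonincreasing_cvg_mu => //.
    - by apply: m_fin => // x [].
    - exact: bigcap_measurable.
    - by apply/nonincreasing_seqP => n; apply/subsetPset/le_set_subset; rewrite lerN2 ler_nat.
  rewrite (_ : \bigcap_n _ = set0); last first.
    apply/seteqP; split => // x h.
    have [_ /=] := h (Num.bound `|b x|) I; rewrite leNgt => /negP; apply.
    have := archi_boundP (normr_ge0 (b x)); rewrite -ltrN2; move=> /lt_le_trans; apply.
    by rewrite lerNl -normrN ler_norm.
  have VB : ((0 : R)%:E < (V / 2)%:E)%E by rewrite lte_fin divr_gt0.
  rewrite measure0 => /(_ _ (open_ereal_lt' VB)) [n _ /(_ n (leqnn _)) hn].
  exists (- n%:R) => t St; rewrite leNgt; apply/negP => tn.
  by have := Sup _ _ St (ltW tn); rewrite /S/= leNgt hn.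
pose a := inf S; exists a.
have Sa t : a < t -> S t.
  move=> at_; have [s Ss /ltW st] := inf_lt S0 at_.
  exact: Sup Ss st.
have NSa t : t < a -> ~ S t.
  by move=> ta St; have := ge_inf (ex_intro _ L SL) St; rewrite leNgt ta.
split; last first.
  have : m (le_set (a + n.+1%:R^-1)) @[n --> \oo] --> m (\bigcap_n le_set (a + n.+1%:R^-1)).
    apply: nonincreasing_cvg_mu => //.
    - by apply: m_fin => // x [].
    - exact: bigcap_measurable.
    - apply/nonincreasing_seqP => n; apply/subsetPset/le_set_subset.
      by rewrite lerD2l lef_pV2 ?posrE// ler_nat.
  rewrite (_ : \bigcap_n _ = le_set a); last first.
    apply/seteqP; split => x.
      move=> h; split; first by have [] := h 0%N I.
      rewrite /= leNgt; apply/negP => ab.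
      have ba0 : 0 < b x - a by rewrite subr_gt0.
      have [_ /=] := h (Num.bound (b x - a)^-1) I.
      rewrite leNgt => /negP; apply; rewrite -ltrBrDl -[ltRHS]invrK ltf_pV2 ?posrE ?invr_gt0//.
      apply: lt_trans (archi_boundP _) _; first by rewrite invr_ge0 ltW.
      by rewrite ltr_nat.
    by move=> [Bx bx] n _; split=> //=; apply: (le_trans bx); rewrite lerDl.
  move=> mc; rewrite leNgt; apply/negP => h.
  have [n _ /(_ n (leqnn _))] := mc _ (open_ereal_lt' h).
  by rewrite /= ltNge Sa// ltrDl.
have : m (le_set (a - n.+1%:R^-1)) @[n --> \oo] --> m (\bigcup_n le_set (a - n.+1%:R^-1)).
  apply: nondecreasing_cvg_mu => //; first exact: bigcup_measurable.
  apply/nondecreasing_seqP => n; apply/subsetPset/le_set_subset.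
  by rewrite lerD2l lerN2 lef_pV2 ?posrE// ler_nat.
(* [U] is the part of [B] where [b < a]; every set of the union has a level below the infimum, hence
   measure below [V / 2]. *)
set U := \bigcup_n _ => mc.
have mU : measurable U by exact: bigcup_measurable.
have UB : U `<=` B by move=> x [n _ []].
have -> : B `&` [set x | a <= b x] = B `\` U.
  apply/seteqP; split => x.
    move=> [Bx /= ax]; split=> // -[n _ [_ /=]]; rewrite leNgt => /negP; apply.
    by apply: lt_le_trans ax; rewrite ltrBlDr ltrDl.
  move=> [Bx Ux]; split=> //=; rewrite leNgt; apply/negP => ab; apply: Ux.
  have ba0 : 0 < a - b x by rewrite subr_gt0.
  exists (Num.bound (a - b x)^-1) => //; split => //=.
  rewrite lerBrDl -lerBrDr -[leRHS]invrK lef_pV2 ?posrE ?invr_gt0//.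
  apply: ltW; apply: lt_trans (archi_boundP _) _; first by rewrite invr_ge0 ltW.
  by rewrite ltr_nat.
have mU2 : (m U <= (V / 2)%:E)%E.
  rewrite leNgt; apply/negP => h.
  have [n _ /(_ n (leqnn _)) /ltW hn] := mc _ (open_ereal_gt' h).
  by apply: NSa hn; rewrite ltrBlDr ltrDl.
have mUfin := m_fin mU UB.
have -> : m (B `\` U) = (m B - m U)%E.
  rewrite measureD//; first by rewrite setIidr.
  by apply: (@le_lt_trans _ _ (m B)) => //; rewrite mBV ltry.
rewrite mBV.
have fU : m U \is a fin_num by rewrite ge0_fin_numE.
move: mU2 V0; rewrite -(fineK fU) -EFinB !lee_fin; lra.
Qed.

End median.

(** * The estimate on two halves *)

Section powers.
Context {R : realType}.
Implicit Types a c u delta : R.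

Lemma exprD_ge (k : nat) a c : (0 < k)%N -> 0 <= a -> 0 <= c ->
  a ^+ k + c ^+ k <= (a + c) ^+ k.
Proof.
case: k => // k _ a0 c0; elim: k => [|k IH]; first by rewrite !expr1.
rewrite [leRHS]exprS; apply: (@le_trans _ _ ((a + c) * (a ^+ k.+1 + c ^+ k.+1))).
  rewrite !(exprS _ k.+1) mulrDl !mulrDr.
  have : 0 <= a * c ^+ k.+1 by rewrite mulr_ge0// exprn_ge0.
  have : 0 <= c * a ^+ k.+1 by rewrite mulr_ge0// exprn_ge0.
  lra.
by rewrite ler_wpM2l// addr_ge0.
Qed.

Lemma exprD_le (k : nat) a c : 0 <= a -> 0 <= c ->
  (a + c) ^+ k <= 2 ^+ k * (a ^+ k + c ^+ k).
Proof.
move=> a0 c0; wlog ac : a c a0 c0 / a <= c.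
  move=> h; have [/h|/ltW/h] := leP a c; first exact.
  by rewrite addrC [c ^+ k + _]addrC; apply.
apply: (@le_trans _ _ ((2 * c) ^+ k)).
  by rewrite lerXn2r ?nnegrE ?addr_ge0 ?mulr_ge0//; lra.
by rewrite exprMn ler_wpM2l ?exprn_ge0// lerDr exprn_ge0.
Qed.

Lemma norm_exprD_le (k : nat) a c delta : 0 <= a -> 0 <= c ->
  `|a + c + delta| ^+ k <= 4 ^+ k * (a ^+ k + c ^+ k + `|delta| ^+ k).
Proof.
move=> a0 c0; have ac0 : 0 <= a + c by exact: addr_ge0.
apply: (@le_trans _ _ ((a + c + `|delta|) ^+ k)).
  rewrite lerXn2r ?nnegrE ?addr_ge0// (le_trans (ler_normD _ _))//.
  by rewrite (ger0_norm ac0).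
apply: le_trans (exprD_le k ac0 (normr_ge0 _)) _.
have -> : 4 ^+ k = 2 ^+ k * 2 ^+ k :> R by rewrite -exprMn; congr (_ ^+ _); ring.
rewrite -mulrA ler_wpM2l ?exprn_ge0// [leRHS]mulrDr lerD ?exprD_le//.
by rewrite ler_peMl ?exprn_ge0// exprn_ege1// ler1n.
Qed.

Lemma exprD_delta_ge (k : nat) u delta : 0 <= u ->
  2 ^- k * u ^+ k - 2 * `|delta| ^+ k <= (u + delta) ^+ k.
Proof.
move=> u0; rewrite -exprVn -exprMn mulrC.
have [h|h] := leP (2 * `|delta|) u.
  have hd := ler_norm (- delta); rewrite normrN in hd.
  apply: (@le_trans _ _ ((u / 2) ^+ k)).
    by rewrite lerBlDr lerDl mulr_ge0// exprn_ge0.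
  by rewrite lerXn2r ?nnegrE//; lra.
have h1 : (u / 2) ^+ k <= `|delta| ^+ k by rewrite lerXn2r ?nnegrE//; lra.
suff : - `|delta| ^+ k <= (u + delta) ^+ k by lra.
have [ud|ud] := leP 0 (u + delta).
  by apply: (@le_trans _ _ 0); rewrite ?exprn_ge0// oppr_le0 exprn_ge0.
apply: (@le_trans _ _ (- `|u + delta| ^+ k)).
  rewrite lerN2 lerXn2r ?nnegrE// ltr0_norm// ltr0_norm; lra.
by rewrite -normrX lerNl -normrN ler_norm.
Qed.

End powers.

Section product_integrals.
Context d1 d2 (X : measurableType d1) (Y : measurableType d2) (R : realType).
Variables (m1 : {sigma_finite_measure set X -> \bar R}).
Variables (m2 : {sigma_finite_measure set Y -> \bar R}).
Local Open Scope ereal_scope.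

Lemma integral_prod_mul (p : X -> R) (q : Y -> R) :
  measurable_fun setT p -> measurable_fun setT q ->
  (forall x, 0 <= p x)%R -> (forall y, 0 <= q y)%R ->
  \int[m1 \x m2]_z (p z.1 * q z.2)%:E =
  \int[m1]_x (p x)%:E * \int[m2]_y (q y)%:E.
Proof.
move=> mp mq p0 q0.
rewrite (fubini_tonelli1 (fun z => (p z.1 * q z.2)%:E)); last 2 first.
- apply/measurable_EFinP; apply: measurable_funM.
    by apply: measurableT_comp => //; exact: measurable_fst.
  by apply: measurableT_comp => //; exact: measurable_snd.
- by move=> z; rewrite lee_fin mulr_ge0.
rewrite -ge0_integralZr//; last 3 first.
- exact/measurable_EFinP.
- by move=> x _; rewrite lee_fin.
- by apply: integral_ge0 => y _; rewrite lee_fin.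
apply: eq_integral => x _; rewrite -ge0_integralZl//; last 3 first.
- exact/measurable_EFinP.
- by move=> y _; rewrite lee_fin.
- by rewrite lee_fin.
Qed.

Lemma integral_prod_le2 (t : X * Y -> R) (q : Y -> R) (M : R) :
  measurable_fun setT t -> measurable_fun setT q ->
  (forall z, 0 <= t z)%R -> (forall y, 0 <= q y)%R -> (0 <= M)%R ->
  (forall y, \int[m1]_x (t (x, y))%:E <= M%:E) ->
  \int[m1 \x m2]_z (t z * q z.2)%:E <= M%:E * \int[m2]_y (q y)%:E.
Proof.
move=> mt mq t0 q0 M0 tM.
have mtq : measurable_fun setT (fun z => (t z * q z.2)%:E).
  apply/measurable_EFinP; apply: measurable_funM => //.
  by apply: measurableT_comp => //; exact: measurable_snd.
have tq0 z : 0 <= (t z * q z.2)%:E by rewrite lee_fin mulr_ge0.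
have mqE : measurable_fun setT (EFin \o q) by exact/measurable_EFinP.
rewrite (fubini_tonelli2 _ mtq tq0) -ge0_integralZl//; last by move=> y _; rewrite lee_fin.
apply: ge0_le_integral.
- by [].
- by move=> y _; apply: integral_ge0.
- exact: measurable_fun_fubini_tonelli_G.
- exact: measurable_funeM.
rewrite /fubini_G => y _ /=; under eq_integral do rewrite EFinM.
rewrite ge0_integralZr ?lee_fin//; last 2 first.
- by apply/measurable_EFinP; exact: measurable_fun_pair1.
- by move=> x _; rewrite lee_fin.
by apply: lee_wpmul2r => //; rewrite lee_fin.
Qed.

Lemma integral_prod_le1 (t : X * Y -> R) (p : X -> R) (M : R) :
  measurable_fun setT t -> measurable_fun setT p ->
  (forall z, 0 <= t z)%R -> (forall x, 0 <= p x)%R -> (0 <= M)%R ->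
  (forall x, \int[m2]_y (t (x, y))%:E <= M%:E) ->
  \int[m1 \x m2]_z (t z * p z.1)%:E <= M%:E * \int[m1]_x (p x)%:E.
Proof.
move=> mt mp t0 p0 M0 tM.
have mtp : measurable_fun setT (fun z => (t z * p z.1)%:E).
  apply/measurable_EFinP; apply: measurable_funM => //.
  by apply: measurableT_comp => //; exact: measurable_fst.
have tp0 z : 0 <= (t z * p z.1)%:E by rewrite lee_fin mulr_ge0.
have mpE : measurable_fun setT (EFin \o p) by exact/measurable_EFinP.
rewrite (fubini_tonelli1 _ mtp tp0) -ge0_integralZl//; last by move=> x _; rewrite lee_fin.
apply: ge0_le_integral.
- by [].
- by move=> x _; apply: integral_ge0.
- exact: measurable_fun_fubini_tonelli_F.
- exact: measurable_funeM.
rewrite /fubini_F => x _ /=; under eq_integral do rewrite EFinM.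
rewrite ge0_integralZr ?lee_fin//; last 2 first.
- by apply/measurable_EFinP; exact: measurable_fun_pair2.
- by move=> y _; rewrite lee_fin.
by apply: lee_wpmul2r => //; rewrite lee_fin.
Qed.

Lemma Rintegral_prod (h : X * Y -> R) :
  (m1 \x m2).-integrable setT (EFin \o h) ->
  (\int[m1]_x \int[m2]_y h (x, y) = \int[m1 \x m2]_z h z)%R.
Proof.
move=> ih; rewrite /Rintegral -(integral12_prod_meas1 ih); congr fine.
have iF := integrable_fubini_F ih.
apply: ae_eq_integral => //.
- apply/measurable_EFinP; apply: measurableT_comp => //.
  exact: measurable_int iF.
- exact: measurable_int iF.
apply: filterS (integrable_ae measurableT iF) => x /(_ I) fx _.
by rewrite fineK.
Qed.

End product_integrals.

Lemma integrable_of_le d (T : measurableType d) (R : realType)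
    (m : {measure set T -> \bar R}) (f : T -> R) (M : R) :
  measurable_fun setT f -> (forall x, 0 <= f x) ->
  (\int[m]_x (f x)%:E <= M%:E)%E ->
  m.-integrable setT (EFin \o f) /\ \int[m]_x f x <= M.
Proof.
move=> mf f0 fM; have If : m.-integrable setT (EFin \o f).
  apply/integrableP; split; first exact/measurable_EFinP.
  under eq_integral do rewrite /= ger0_norm//.
  exact: le_lt_trans (ltry M).
split=> //; rewrite -lee_fin /Rintegral fineK//.
exact: integrable_fin_num.
Qed.

Section core_estimate.
Context {R : realType} {d : nat}.
Local Notation normc := Normc.normc.
Local Notation Re := complex.Re.
Variables (K : 'rV[R]_d -> 'rV[R]_d -> R[i]) (b : 'rV[R]_d -> R) (k : nat).
Hypotheses (mK : jointly_measurable K) (mb : measurable_fun setT b) (k0 : (0 < k)%N).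
Variables (E F : set 'rV[R]_d) (V e f : R).
Hypotheses (mE : measurable E) (mF : measurable F) (V0 : 0 < V).
Hypotheses (eE : leb d E = e%:E) (fF : leb d F = f%:E).
Hypotheses (eV : V / 2 <= e <= V) (fV : V / 2 <= f <= V).
Variables (K0 : R[i]) (eps : R).
Hypotheses (K00 : 0 < normc K0) (eps0 : 0 <= eps).
Hypothesis hy : forall y, E y ->
  (\int[leb d]_(x in F) (normc (K x y - K0))%:E <= (eps * normc K0 * V)%:E)%E.
Hypothesis hx : forall x, F x ->
  (\int[leb d]_(y in E) (normc (K x y - K0))%:E <= (eps * normc K0 * V)%:E)%E.
Variables (s alpha beta : R).
Hypotheses (s1 : s ^+ 2 = 1).
Hypothesis hE : forall y, E y -> alpha <= s * b y.
Hypothesis hF : forall x, F x -> s * b x <= beta.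
Variables (A C : R).
Hypothesis intA : (\int[leb d]_(y in E) ((s * b y - alpha) ^+ k)%:E = A%:E)%E.
Hypothesis intC : (\int[leb d]_(x in F) ((beta - s * b x) ^+ k)%:E = C%:E)%E.
Variables (taup taun : R).
Hypotheses (taup0 : 0 <= taup) (taun0 : 0 <= taun).
Let delta := alpha - beta.
Hypothesis htau : forall u, 0 <= u -> 2 ^- k * u ^+ k + taup - taun <= (u + delta) ^+ k.

Let theta : R[i] := K0^-1 * ((normc K0)%:C)%C.

Let K0neq0 : K0 != 0.
Proof. by apply/eqP => h; move: K00; rewrite h Normc.normc0 ltxx. Qed.

Let K0theta : K0 * theta = ((normc K0)%:C)%C.
Proof. by rewrite /theta mulrA mulfV// mul1r. Qed.

Let normc_theta : normc theta = 1.
Proof. by rewrite /theta Normc.normcM Normc.normcV normcR gtr0_norm// mulVf// gt_eqF. Qed.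

Let zeta : R[i] := (((- s) ^+ k)%:C)%C * theta.

Let normc_zeta : normc zeta = 1.
Proof.
rewrite /zeta Normc.normcM normc_theta mulr1 normcR normrX normrN.
suff -> : `|s| = 1 by rewrite expr1n.
by apply/eqP; rewrite -(@eqrXn2 _ 2)// expr1n real_normK ?num_real// s1.
Qed.

Let ff y : R[i] := zeta * ((\1_E y : R)%:C)%C.
Let gg x : R[i] := ((\1_F x : R)%:C)%C.

Let H (z : 'rV[R]_d * 'rV[R]_d) : R :=
  Re ((((b z.1 - b z.2) ^+ k)%:C)%C * K z.1 z.2 * ff z.2 * gg z.1).
Let I z : R := \1_F z.1 * \1_E z.2 :> R.
Let t z : R := \1_F z.1 * \1_E z.2 * normc (K z.1 z.2 - K0).
Let aE y : R := \1_E y * (s * b y - alpha) ^+ k.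
Let cF x : R := \1_F x * (beta - s * b x) ^+ k.

Let abs_Re (z : R[i]) : `|Re z| <= normc z.
Proof.
by rewrite ler_norml Re_le_normc andbT lerNl -raddfN (le_trans (Re_le_normc _))// (@normcN R).
Qed.

Let HE z : H z = I z * ((s * b z.2 - s * b z.1) ^+ k * Re (K z.1 z.2 * theta)).
Proof.
rewrite /H /ff /gg /I /zeta; set B := (b z.1 - b z.2).
have -> : ((B ^+ k)%:C)%C * K z.1 z.2 * ((((- s) ^+ k)%:C)%C * theta * ((\1_E z.2 : R)%:C)%C) *
   ((\1_F z.1 : R)%:C)%C = ((B ^+ k * (- s) ^+ k * (\1_F z.1 * \1_E z.2 : R))%:C)%C * (K z.1 z.2 * theta).
  by rewrite !rmorphM/=; ring.
rewrite Re_realM -exprMn (_ : B * - s = s * b z.2 - s * b z.1); first by ring.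
by rewrite /B; ring.
Qed.

Let bound z : [/\ `|H z| <= 4 ^+ k * ((normc K0 * (\1_F z.1 * aE z.2) + t z * aE z.2)
      + (normc K0 * (cF z.1 * \1_E z.2) + t z * cF z.1)
      + `|delta| ^+ k * (normc K0 * I z + t z)) &
   normc K0 * (2 ^- k * (\1_F z.1 * aE z.2 + cF z.1 * \1_E z.2) + taup * I z) <=
   H z + (4 ^+ k * (t z * aE z.2 + t z * cF z.1 + `|delta| ^+ k * t z)
     + normc K0 * taun * I z)].
Proof.
rewrite HE /t /I /aE /cF !indicE.
have [Fx|Fx] := pselect (F z.1); last first.
  by rewrite (memNset Fx); split; rewrite ?mul0r ?mulr0 ?addr0 ?mul0r ?mulr0 ?addr0 ?normr0.
have [Ey|Ey] := pselect (E z.2); last first.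
  by rewrite (memNset Ey); split; rewrite ?mul0r ?mulr0 ?mul0r ?addr0 ?mulr0 ?addr0 ?normr0.
rewrite (mem_set Fx) (mem_set Ey) !mul1r !mulr1.
set a := s * b z.2 - alpha; set c := beta - s * b z.1.
have a0 : 0 <= a by rewrite subr_ge0 hE.
have c0 : 0 <= c by rewrite subr_ge0 hF.
set D := s * b z.2 - s * b z.1.
have DE : D = a + c + delta by rewrite /D /a /c /delta; ring.
have D1 : `|D| ^+ k <= 4 ^+ k * (a ^+ k + c ^+ k + `|delta| ^+ k).
  by rewrite DE norm_exprD_le.
have D2 : 2 ^- k * (a ^+ k + c ^+ k) + taup - taun <= D ^+ k.
  rewrite DE; apply: le_trans (htau (addr_ge0 a0 c0)).
  by rewrite lerD2r lerD2r ler_wpM2l ?invr_ge0 ?exprn_ge0// exprD_ge.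
set n := normc (K z.1 z.2 - K0); have n0 : 0 <= n by exact: normc_ge0.
have rn : `|Re (K z.1 z.2 * theta) - normc K0| <= n.
  have -> : Re (K z.1 z.2 * theta) - normc K0 = Re ((K z.1 z.2 - K0) * theta).
    by rewrite mulrBl K0theta raddfB.
  by apply: le_trans (abs_Re _) _; rewrite Normc.normcM normc_theta mulr1.
set r := Re _ in rn *.
have k4 : 0 <= 4 ^+ k :> R by rewrite exprn_ge0.
split.
  rewrite normrM normrX.
  have r1 : `|r| <= normc K0 + n.
    have -> : r = normc K0 + (r - normc K0) by ring.
    by apply: le_trans (ler_normD _ _) _; rewrite (gtr0_norm K00) lerD2l.
  apply: le_trans (ler_pM _ _ D1 r1) _; rewrite ?exprn_ge0//.
  by rewrite le_eqVlt; apply/orP; left; apply/eqP; ring.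
have h1 : - (`|D| ^+ k * n) <= D ^+ k * (r - normc K0).
  rewrite lerNl (le_trans (ler_norm _))// normrN normrM normrX.
  by rewrite ler_wpM2l ?exprn_ge0.
have h2 : `|D| ^+ k * n <= 4 ^+ k * (a ^+ k + c ^+ k + `|delta| ^+ k) * n.
  by rewrite ler_wpM2r.
have h3 : normc K0 * (2 ^- k * (a ^+ k + c ^+ k) + taup - taun) <= normc K0 * D ^+ k.
  by rewrite ler_pM2l.
have -> : 4 ^+ k * (n * a ^+ k + n * c ^+ k + `|delta| ^+ k * n) =
   4 ^+ k * (a ^+ k + c ^+ k + `|delta| ^+ k) * n by ring.
have -> : D ^+ k * r = D ^+ k * (r - normc K0) + normc K0 * D ^+ k by ring.
move: h3; rewrite mulrBr; lra.
Qed.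

Let maE : measurable_fun setT aE.
Proof.
apply: measurable_funM; first exact: measurable_indic.
by apply: measurable_funX; apply: measurable_funB => //; exact: measurable_funM.
Qed.

Let mcF : measurable_fun setT cF.
Proof.
apply: measurable_funM; first exact: measurable_indic.
by apply: measurable_funX; apply: measurable_funB => //; exact: measurable_funM.
Qed.

Let m1F : measurable_fun setT (\1_F : 'rV[R]_d -> R).
Proof. exact: measurable_indic. Qed.

Let m1E : measurable_fun setT (\1_E : 'rV[R]_d -> R).
Proof. exact: measurable_indic. Qed.

Let mfst (p : 'rV[R]_d -> R) : measurable_fun setT p ->
  measurable_fun setT (fun z : 'rV[R]_d * 'rV[R]_d => p z.1).
Proof. by move=> mp; apply: measurableT_comp => //; exact: measurable_fst. Qed.

Let msnd (p : 'rV[R]_d -> R) : measurable_fun setT p ->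
  measurable_fun setT (fun z : 'rV[R]_d * 'rV[R]_d => p z.2).
Proof. by move=> mp; apply: measurableT_comp => //; exact: measurable_snd. Qed.

Let mI : measurable_fun setT I.
Proof. by apply: measurable_funM; [exact: mfst|exact: msnd]. Qed.

Let mt : measurable_fun setT t.
Proof.
by apply: measurable_funM => //; exact/measurable_normc/cmeasurable_subr.
Qed.

Let mH : measurable_fun setT H.
Proof.
rewrite (funext HE); apply: measurable_funM => //; apply: measurable_funM.
  apply: measurable_funX; apply: measurable_funB; apply: measurable_funM => //.
    exact: msnd.
  exact: mfst.
have [mR mIm] := mK.
rewrite (_ : (fun _ => _) = (fun z => Re (K z.1 z.2) * Re theta - complex.Im (K z.1 z.2) * complex.Im theta)).
  by apply: measurable_funB; apply: measurable_funM.
by apply/funext => z; case: (K z.1 z.2) => ? ?; case: theta.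
Qed.

Let aE0 y : 0 <= aE y.
Proof.
rewrite /aE indicE; case: (boolP (y \in E)) => [|_]; last by rewrite mul0r.
by rewrite inE => Ey; rewrite mul1r exprn_ge0// subr_ge0 hE.
Qed.

Let cF0 x : 0 <= cF x.
Proof.
rewrite /cF indicE; case: (boolP (x \in F)) => [|_]; last by rewrite mul0r.
by rewrite inE => Fx; rewrite mul1r exprn_ge0// subr_ge0 hF.
Qed.

Let t0 z : 0 <= t z.
Proof. by rewrite /t mulr_ge0 ?normc_ge0// mulr_ge0. Qed.

Let iaE : (\int[leb d]_y (aE y)%:E = A%:E)%E.
Proof. by rewrite -intA [RHS]integral_indicM. Qed.

Let icF : (\int[leb d]_x (cF x)%:E = C%:E)%E.
Proof. by rewrite -intC [RHS]integral_indicM. Qed.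

Let i1 (B : set 'rV[R]_d) (v : R) : measurable B -> leb d B = v%:E ->
  (\int[leb d]_x (\1_B x : R)%:E = v%:E)%E.
Proof. by move=> mB <-; rewrite integral_indic// setIT. Qed.

Let M := eps * normc K0 * V.

Let M0 : 0 <= M.
Proof. exact: mulr_ge0 (mulr_ge0 eps0 (ltW K00)) (ltW V0). Qed.

Let t_le1 x : (\int[leb d]_y (t (x, y))%:E <= M%:E)%E.
Proof.
rewrite /t/=; have [Fx|Fx] := pselect (F x); last first.
  by rewrite integral0_eq ?lee_fin// => y _; rewrite indicE memNset// !mul0r.
apply: le_trans (hx Fx); rewrite [leRHS]integral_indicM le_eqVlt; apply/orP; left.
by apply/eqP/eq_integral => y _; rewrite [\1_F x]indicE mem_set// mul1r.
Qed.

Let t_le2 y : (\int[leb d]_x (t (x, y))%:E <= M%:E)%E.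
Proof.
rewrite /t/=; have [Ey|Ey] := pselect (E y); last first.
  by rewrite integral0_eq ?lee_fin// => x _; rewrite [\1_E y]indicE memNset// mulr0 mul0r.
apply: le_trans (hy Ey); rewrite [leRHS]integral_indicM le_eqVlt; apply/orP; left.
by apply/eqP/eq_integral => x _; rewrite [\1_E y]indicE mem_set// mulr1.
Qed.

Local Notation mm := (leb d \x leb d)%E.
Local Notation "'Int' h" := (mm.-integrable setT (EFin \o h)) (at level 10).
Local Notation J h := (\int[mm]_z h z).

Let IntD (h1 h2 : 'rV[R]_d * 'rV[R]_d -> R) : Int h1 -> Int h2 ->
  Int (fun z => h1 z + h2 z) /\ J (fun z => h1 z + h2 z) = J h1 + J h2.
Proof.
move=> i1' i2'; split; last exact: RintegralD.
exact: (integrableD measurableT i1' i2').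
Qed.

Let IntZ (c : R) (h : 'rV[R]_d * 'rV[R]_d -> R) : Int h ->
  Int (fun z => c * h z) /\ J (fun z => c * h z) = c * J h.
Proof.
move=> ih; split; last exact: RintegralZl.
exact: (integrableZl measurableT c ih).
Qed.

Let prodE (p q : 'rV[R]_d -> R) (u v : R) : measurable_fun setT p -> measurable_fun setT q ->
  (forall x, 0 <= p x) -> (forall x, 0 <= q x) ->
  (\int[leb d]_x (p x)%:E = u%:E)%E -> (\int[leb d]_x (q x)%:E = v%:E)%E ->
  Int (fun z => p z.1 * q z.2) /\ J (fun z => p z.1 * q z.2) = u * v.
Proof.
move=> mp mq p0 q0 pu qv.
have E1 := integral_prod_mul (leb d) (leb d) mp mq p0 q0.
rewrite pu qv -EFinM in E1; split; last by rewrite /Rintegral E1.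
apply: (proj1 (integrable_of_le (M := u * v) _ _ _)).
- by apply: measurable_funM; [exact: mfst|exact: msnd].
- by move=> z; rewrite mulr_ge0.
- by rewrite E1.
Qed.

Lemma core_estimate : exists z : R[i], normc z = 1 /\
  normc K0 * (2 ^- k * (V / 2) * (A + C) + taup * (V / 2) ^+ 2) <=
  normc (commutator_form k b K (fun y => z * ((\1_E y : R)%:C)%C) (fun x => ((\1_F x : R)%:C)%C))
  + 4 ^+ k * eps * normc K0 * V * (A + C + `|delta| ^+ k * V) + normc K0 * taun * V ^+ 2.
Proof.
exists zeta; split=> //.
have ge01 (B : set 'rV[R]_d) x : 0 <= (\1_B x : R) by rewrite indicE.
have [iFa JFa] := prodE m1F maE (ge01 F) aE0 (i1 mF fF) iaE.
have [icE JcE] := prodE mcF m1E cF0 (ge01 E) icF (i1 mE eE).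
have [iI JI] := prodE m1F m1E (ge01 F) (ge01 E) (i1 mF fF) (i1 mE eE).
have [ita Jta] : Int (fun z => t z * aE z.2) /\ J (fun z => t z * aE z.2) <= M * A.
  apply: integrable_of_le.
  - by apply: measurable_funM => //; exact: msnd.
  - by move=> z; rewrite mulr_ge0.
  - by rewrite EFinM -iaE; exact: integral_prod_le2.
have [itc Jtc] : Int (fun z => t z * cF z.1) /\ J (fun z => t z * cF z.1) <= M * C.
  apply: integrable_of_le.
  - by apply: measurable_funM => //; exact: mfst.
  - by move=> z; rewrite mulr_ge0.
  - by rewrite EFinM -icF; exact: integral_prod_le1.
have [it Jt] : Int t /\ J t <= M * e.
  apply: integrable_of_le => //.
  rewrite EFinM -(i1 mE eE).
  have -> : (\int[mm]_z (t z)%:E = \int[mm]_z (t z * \1_E z.2)%:E)%E.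
    apply: eq_integral => z _; rewrite /t; congr EFin.
    by rewrite !indicE; case: (z.2 \in E); rewrite ?mulr1 ?mulr0 ?mul0r.
  exact: integral_prod_le2.
have iH : Int H.
  apply: (le_integrable measurableT (g := EFin \o (fun z =>
     4 ^+ k * ((normc K0 * (\1_F z.1 * aE z.2) + t z * aE z.2)
      + (normc K0 * (cF z.1 * \1_E z.2) + t z * cF z.1)
      + `|delta| ^+ k * (normc K0 * I z + t z))))).
  - exact/measurable_EFinP.
  - move=> z _; rewrite /= lee_fin; have [h _] := bound z.
    exact: le_trans h (ler_norm _).
  have [x1 _] := IntZ (normc K0) iFa.
  have [x2 _] := IntD x1 ita.
  have [x3 _] := IntZ (normc K0) icE.
  have [x4 _] := IntD x3 itc.
  have [x5 _] := IntD x2 x4.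
  have [x6 _] := IntZ (normc K0) iI.
  have [x7 _] := IntD x6 it.
  have [x8 _] := IntZ (`|delta| ^+ k) x7.
  have [x9 _] := IntD x5 x8.
  by have [] := IntZ (4 ^+ k) x9.
have JH : J H <= normc (commutator_form k b K ff gg).
  apply: le_trans (Re_le_normc _).
  by rewrite -(Rintegral_prod iH).
have [l1 L1] := IntD iFa icE.
have [l2 L2] := IntZ (2 ^- k) l1.
have [l3 L3] := IntZ taup iI.
have [l4 L4] := IntD l2 l3.
have [l5 L5] := IntZ (normc K0) l4.
have [r1 R1] := IntD ita itc.
have [r2 R2] := IntZ (`|delta| ^+ k) it.
have [r3 R3] := IntD r1 r2.
have [r4 R4] := IntZ (4 ^+ k) r3.
have [r5 R5] := IntZ (normc K0 * taun) iI.
have [r6 R6] := IntD r4 r5.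
have [r7 R7] := IntD iH r6.
have main := le_Rintegral measurableT l5 r7 (fun z _ => proj2 (bound z)).
rewrite L5 L4 L2 L1 L3 JFa JcE JI R7 R6 R4 R3 R1 R2 R5 JI in main.
have A0 : 0 <= A by rewrite -lee_fin -iaE; apply: integral_ge0 => y _; rewrite lee_fin.
have C0 : 0 <= C by rewrite -lee_fin -icF; apply: integral_ge0 => y _; rewrite lee_fin.
have /andP[e1 e2] := eV; have /andP[f1 f2] := fV.
have V2 : 0 < V / 2 by rewrite divr_gt0.
have e0 : 0 <= e by apply: le_trans e1; exact: ltW.
have f0 : 0 <= f by apply: le_trans f1; exact: ltW.
apply: (@le_trans _ _ (normc K0 * (2 ^- k * (f * A + C * e) + taup * (f * e)))).
  rewrite ler_pM2l//; apply: lerD.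
    rewrite -mulrA ler_wpM2l ?invr_ge0 ?exprn_ge0// mulrDr; apply: lerD.
      by rewrite ler_wpM2r.
    by rewrite [C * e]mulrC ler_wpM2r.
  by rewrite ler_wpM2l// expr2; apply: ler_pM => //; exact: ltW.
apply: (le_trans main).
rewrite -[leRHS]addrA; apply: lerD => //; apply: lerD; last first.
  rewrite ler_wpM2l ?mulr_ge0 ?(ltW K00)// expr2; exact: ler_pM.
have -> : 4 ^+ k * eps * normc K0 * V * (A + C + `|delta| ^+ k * V) =
   4 ^+ k * (M * A + M * C + `|delta| ^+ k * (M * V)) by rewrite /M; ring.
rewrite ler_wpM2l ?exprn_ge0//; apply: lerD; first exact: lerD.
rewrite ler_wpM2l ?exprn_ge0//; apply: (le_trans Jt).
by rewrite ler_wpM2l.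
Qed.

End core_estimate.

Section median_estimate.
Context {R : realType} {d : nat}.
Local Notation normc := Normc.normc.
Variables (K : 'rV[R]_d -> 'rV[R]_d -> R[i]) (b : 'rV[R]_d -> R) (k : nat).
Hypotheses (mK : jointly_measurable K) (mb : measurable_fun setT b) (k0 : (0 < k)%N).
Variables (B B' : set 'rV[R]_d) (V : R).
Hypotheses (mB : measurable B) (mB' : measurable B') (V0 : 0 < V).
Hypotheses (BV : leb d B = V%:E) (BV' : leb d B' = V%:E).
Variables (K0 : R[i]) (eps : R).
Hypotheses (K00 : 0 < normc K0) (eps0 : 0 <= eps) (heps : 4 ^+ k * eps <= 2 ^- k / 8).
Hypothesis hy : forall y, B y ->
  (\int[leb d]_(x in B') (normc (K x y - K0))%:E <= (eps * normc K0 * V)%:E)%E.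
Hypothesis hx : forall x, B' x ->
  (\int[leb d]_(y in B) (normc (K x y - K0))%:E <= (eps * normc K0 * V)%:E)%E.
Variables (alpha beta : R).
Hypotheses (alpha_ge : ((V / 2)%:E <= leb d (B `&` [set x | (alpha <= b x)%R]))%E)
  (alpha_le : ((V / 2)%:E <= leb d (B `&` [set x | (b x <= alpha)%R]))%E)
  (beta_ge : ((V / 2)%:E <= leb d (B' `&` [set x | (beta <= b x)%R]))%E)
  (beta_le : ((V / 2)%:E <= leb d (B' `&` [set x | (b x <= beta)%R]))%E).
Hypotheses (Lk : (\int[leb d]_(x in B) (`|b x| ^+ k)%:E < +oo)%E)
  (Lk' : (\int[leb d]_(x in B') (`|b x| ^+ k)%:E < +oo)%E).
Variable N : R.
Hypothesis hN : forall (z : R[i]) (E F : set 'rV[R]_d), normc z = 1 ->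
  measurable E -> E `<=` B -> measurable F -> F `<=` B' ->
  normc (commutator_form k b K (fun y => z * ((\1_E y : R)%:C)%C)
    (fun x => ((\1_F x : R)%:C)%C)) <= N.

Let msub (D : set 'rV[R]_d) (c s : R) : measurable D ->
  measurable (D `&` [set x | s * c <= s * b x]).
Proof.
move=> mD; apply: measurableI => //.
have ms : measurable_fun setT (fun x => s * b x) by exact: measurable_funM.
rewrite (_ : [set x | _] = setT `&` (fun x => s * b x) @^-1` `[s * c, +oo[).
  exact: ms.
by rewrite setTI; apply/seteqP; split => x; rewrite /preimage/= in_itv/= andbT.
Qed.

Let half (D : set 'rV[R]_d) (c s : R) : s ^+ 2 = 1 ->
  ((V / 2)%:E <= leb d (D `&` [set x | (c <= b x)%R]))%E ->
  ((V / 2)%:E <= leb d (D `&` [set x | (b x <= c)%R]))%E ->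
  ((V / 2)%:E <= leb d (D `&` [set x | (s * c <= s * b x)%R]))%E.
Proof.
move=> /eqP; rewrite sqrf_eq1 => /orP[] /eqP -> h1 h2.
  by under eq_set do rewrite !mul1r.
by under eq_set do rewrite !mulN1r lerN2.
Qed.

Let mpow (c : R) : measurable_fun setT (fun x => (`|b x - c| ^+ k)%:E).
Proof.
apply/measurable_EFinP/measurable_funX/measurableT_comp => //.
exact: measurable_funB.
Qed.

Let fin_pow (D : set 'rV[R]_d) (c : R) : measurable D -> leb d D = V%:E ->
  (\int[leb d]_(x in D) (`|b x| ^+ k)%:E < +oo)%E ->
  (\int[leb d]_(x in D) (`|b x - c| ^+ k)%:E < +oo)%E.
Proof.
move=> mD DV Dk; have mb0 : measurable_fun D (fun x => (`|b x| ^+ k)%:E).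
  apply: measurable_funTS; have := mpow 0.
  by under [X in measurable_fun _ X -> _]eq_fun do rewrite subr0.
apply: (@le_lt_trans _ _ (\int[leb d]_(x in D)
   ((2 ^+ k)%:E * ((`|b x| ^+ k)%:E + (`|c| ^+ k)%:E)))%E).
  apply: ge0_le_integral.
  - by [].
  - by move=> x _; rewrite lee_fin exprn_ge0.
  - exact: measurable_funTS.
  - by apply: measurable_funeM; exact: emeasurable_funD.
  move=> x _; rewrite -EFinD -EFinM lee_fin.
  apply: le_trans (exprD_le k (normr_ge0 _) (normr_ge0 _)).
  by rewrite lerXn2r ?nnegrE ?addr_ge0// (le_trans (ler_normD _ _))// normrN.
rewrite ge0_integralZl_EFin ?exprn_ge0//; last 2 first.
- by move=> x _; rewrite -EFinD lee_fin addr_ge0 ?exprn_ge0.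
- exact: emeasurable_funD.
rewrite ge0_integralD//.
rewrite lte_mul_pinfty ?lee_fin ?exprn_ge0//.
apply: lte_add_pinfty => //.
apply: (@le_lt_trans _ _ ((`|c| ^+ k)%:E * leb d D)%E); first by rewrite -integral_cst.
by rewrite DV -EFinM ltry.
Qed.

Let sub_real (D G : set 'rV[R]_d) (c : R) : measurable D -> leb d D = V%:E ->
  (\int[leb d]_(x in D) (`|b x| ^+ k)%:E < +oo)%E -> measurable G -> G `<=` D ->
  exists2 A, 0 <= A & (\int[leb d]_(x in G) (`|b x - c| ^+ k)%:E = A%:E)%E.
Proof.
move=> mD DV Dk mG GD; have fD := fin_pow c mD DV Dk.
have I0 : (0 <= \int[leb d]_(x in G) (`|b x - c| ^+ k)%:E)%E.
  by apply: integral_ge0 => x _; rewrite lee_fin exprn_ge0.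
have fG : (\int[leb d]_(x in G) (`|b x - c| ^+ k)%:E)%E \is a fin_num.
  rewrite ge0_fin_numE//; apply: le_lt_trans fD.
  by apply: ge0_subset_integral => //; exact: measurable_funTS.
exists (fine (\int[leb d]_(x in G) (`|b x - c| ^+ k)%:E)%E); last by rewrite fineK.
exact: fine_ge0.
Qed.

Let side (s : R) := B `&` [set x | s * alpha <= s * b x].

Let mside s : measurable (side s).
Proof. exact: msub. Qed.

Let step (s taup taun : R) : s ^+ 2 = 1 -> 0 <= taup -> 0 <= taun ->
  (forall u, 0 <= u -> 2 ^- k * u ^+ k + taup - taun <= (u + s * (alpha - beta)) ^+ k) ->
  exists A C, [/\ 0 <= A, 0 <= C,
    (\int[leb d]_(x in side s) (`|b x - alpha| ^+ k)%:E = A%:E)%E &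
    normc K0 * (2 ^- k * (V / 2) * (A + C) + taup * (V / 2) ^+ 2) <=
    N + 4 ^+ k * eps * normc K0 * V * (A + C + `|alpha - beta| ^+ k * V)
      + normc K0 * taun * V ^+ 2].
Proof.
move=> s1 taup0 taun0 htau.
pose F := B' `&` [set x | (- s) * beta <= (- s) * b x].
have mF : measurable F by exact: msub.
have sN1 : (- s) ^+ 2 = 1 by rewrite sqrrN.
have ns : `|s| = 1 by apply/eqP; rewrite -(@eqrXn2 _ 2)// expr1n real_normK ?num_real// s1.
have sideB : side s `<=` B by move=> x [].
have FB' : F `<=` B' by move=> x [].
have [A A0 AE] := sub_real alpha mB BV Lk (mside s) sideB.
have [C C0 CE] := sub_real beta mB' BV' Lk' mF FB'.
have sizes (D G : set 'rV[R]_d) : measurable D -> leb d D = V%:E -> measurable G ->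
    G `<=` D -> ((V / 2)%:E <= leb d G)%E ->
    leb d G = (fine (leb d G))%:E /\ V / 2 <= fine (leb d G) <= V.
  move=> mD DV mG GD hG; have GV : (leb d G <= V%:E)%E.
    by rewrite -DV; apply: le_measure; rewrite ?inE.
  have fG : leb d G \is a fin_num by rewrite ge0_fin_numE// (le_lt_trans GV)// ltry.
  by split; [rewrite fineK|rewrite -!lee_fin fineK// hG GV].
have [eE eV] := sizes _ _ mB BV (mside s) sideB (half s1 alpha_ge alpha_le).
have [fF fV] := sizes _ _ mB' BV' mF FB' (half sN1 beta_ge beta_le).
have hy' y : side s y ->
    (\int[leb d]_(x in F) (normc (K x y - K0))%:E <= (eps * normc K0 * V)%:E)%E.
  move=> [By _]; apply: le_trans (hy By); apply: ge0_subset_integral => //.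
    apply/measurable_EFinP/measurable_funTS/measurable_normc/cmeasurable_subr.
    exact: jointly_measurable1.
  by move=> x _; rewrite lee_fin normc_ge0.
have hx' x : F x ->
    (\int[leb d]_(y in side s) (normc (K x y - K0))%:E <= (eps * normc K0 * V)%:E)%E.
  move=> [Bx _]; apply: le_trans (hx Bx); apply: ge0_subset_integral => //.
    apply/measurable_EFinP/measurable_funTS/measurable_normc/cmeasurable_subr.
    exact: jointly_measurable2.
  by move=> y _; rewrite lee_fin normc_ge0.
have hE y : side s y -> s * alpha <= s * b y by move=> [].
have hF x : F x -> s * b x <= s * beta.
  by move=> [_ /=]; rewrite !mulNr lerN2.
have intA : (\int[leb d]_(y in side s) ((s * b y - s * alpha) ^+ k)%:E = A%:E)%E.
  rewrite -AE; apply: eq_integral => y; rewrite inE => /hE sy.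
  by rewrite -mulrBr -(ger0_norm (_ : 0 <= s * (b y - alpha))) ?normrM ?ns ?mul1r// mulrBr subr_ge0.
have intC : (\int[leb d]_(x in F) ((s * beta - s * b x) ^+ k)%:E = C%:E)%E.
  rewrite -CE; apply: eq_integral => y; rewrite inE => /hF sy.
  rewrite -mulrBr -(ger0_norm (_ : 0 <= s * (beta - b y))) ?normrM ?ns ?mul1r 1?distrC//.
  by rewrite mulrBr subr_ge0.
have htau' u : 0 <= u -> 2 ^- k * u ^+ k + taup - taun <= (u + (s * alpha - s * beta)) ^+ k.
  by rewrite -mulrBr; exact: htau.
have [z [z1]] := core_estimate mK mb k0 (mside s) mF V0 eE fF eV fV K00 eps0
  hy' hx' s1 hE hF intA intC taup0 taun0 htau'.
rewrite -mulrBr normrM ns mul1r => h.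
exists A, C; split=> //; apply: le_trans h _.
by rewrite lerD2r lerD2r; exact: hN.
Qed.

Let eps_bound (X : R) : 0 <= X -> 4 ^+ k * eps * normc K0 * V * X <=
  normc K0 * V * (2 ^- k / 8 * X).
Proof.
move=> X0; have -> : 4 ^+ k * eps * normc K0 * V * X =
  (4 ^+ k * eps) * (normc K0 * V * X) by ring.
have -> : normc K0 * V * (2 ^- k / 8 * X) = 2 ^- k / 8 * (normc K0 * V * X) by ring.
by rewrite ler_wpM2r// !mulr_ge0// ltW.
Qed.

Lemma median_estimate :
  (\int[leb d]_(y in B) (`|b y - alpha| ^+ k)%:E <=
   (52 * 2 ^+ k * N / (normc K0 * V))%:E)%E.
Proof.
have [s [s1 sd]] : exists s : R, s ^+ 2 = 1 /\ 0 <= s * (alpha - beta).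
  have [h|h] := leP beta alpha; [exists 1|exists (-1)]; rewrite ?sqrrN expr1n; split=> //.
    by rewrite mul1r subr_ge0.
  by rewrite mulN1r opprB subr_ge0 ltW.
have ns : `|s| = 1 by apply/eqP; rewrite -(@eqrXn2 _ 2)// expr1n real_normK ?num_real// s1.
set dk := `|alpha - beta| ^+ k.
have dk0 : 0 <= dk by rewrite exprn_ge0.
have dkE : (s * (alpha - beta)) ^+ k = dk.
  by rewrite -(ger0_norm sd) normrM ns mul1r.
have k2 : 0 < 2 ^- k :> R by rewrite invr_gt0 exprn_gt0.
have k21 : 2 ^- k <= 1 :> R by rewrite invf_le1 ?exprn_gt0// exprn_ege1// ler1n.
have [|A1 [C1 [A10 C10 A1E h1]]] := step s1 dk0 (lexx 0).
  move=> u u0; rewrite subr0 -dkE.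
  apply: le_trans (exprD_ge k0 u0 sd); rewrite lerD2r.
  by rewrite ler_piMl// exprn_ge0.
have sN1 : (- s) ^+ 2 = 1 by rewrite sqrrN.
have [|A2 [C2 [A20 C20 A2E h2]]] := step sN1 (lexx 0) (mulr_ge0 (ler0n R 2) dk0).
  move=> u u0; rewrite addr0 mulNr.
  apply: le_trans (exprD_delta_ge k _ u0).
  by rewrite normrN normrM ns mul1r.
have KV0 : 0 < normc K0 * V by rewrite mulr_gt0.
set t : R := 2 ^- k in k2 k21 h1 h2 *.
have e1 := eps_bound (addr_ge0 (addr_ge0 A10 C10) (mulr_ge0 dk0 (ltW V0))).
have e2 := eps_bound (addr_ge0 (addr_ge0 A20 C20) (mulr_ge0 dk0 (ltW V0))).
rewrite -/t in e1 e2.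
set KV := normc K0 * V in KV0 e1 e2 *.
have g1 : KV * (t / 2 * (A1 + C1) + dk * V / 4) <= N + KV * (t / 8 * (A1 + C1 + dk * V)).
  apply: le_trans (le_trans h1 _).
    by rewrite le_eqVlt; apply/orP; left; apply/eqP; rewrite /KV; field.
  by rewrite mulr0 mul0r addr0 lerD2l.
have g2 : KV * (t / 2 * (A2 + C2)) <= N + KV * (t / 8 * (A2 + C2 + dk * V)) + KV * (2 * (dk * V)).
  apply: le_trans (le_trans h2 _).
    by rewrite le_eqVlt; apply/orP; left; apply/eqP; rewrite /KV; field.
  rewrite (_ : normc K0 * (2 * dk) * V ^+ 2 = KV * (2 * (dk * V))); last by rewrite /KV; ring.
  by rewrite lerD2r lerD2l.
have dV0 : 0 <= dk * V by rewrite mulr_ge0// ltW.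
have tdV : t * (dk * V) <= dk * V by rewrite ler_piMl.
have tC1 : 0 <= t * C1 by rewrite mulr_ge0// ltW.
have tC2 : 0 <= t * C2 by rewrite mulr_ge0// ltW.
have tA1 : 0 <= t * A1 by rewrite mulr_ge0// ltW.
have q1 : KV * (t * (3 / 8) * A1 + dk * V / 8) <= N.
  have : KV * (t * (3 / 8) * A1 + dk * V / 8 + t / 8 * (A1 + C1 + dk * V)) <=
     KV * (t / 2 * (A1 + C1) + dk * V / 4) by rewrite ler_pM2l//; lra.
  by rewrite mulrDr => /le_trans/(_ g1); rewrite [N + _]addrC [leLHS]addrC lerD2l.
have q2 : KV * (t * (3 / 8) * A2) <= N + KV * (17 / 8 * (dk * V)).
  have : KV * (t * (3 / 8) * A2 + t / 8 * (A2 + C2 + dk * V)) <=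
     KV * (t / 2 * (A2 + C2) + dk * V / 8) by rewrite ler_pM2l//; lra.
  rewrite !mulrDr.
  move: g2; rewrite !mulrDr; lra.
have q3 : KV * (dk * V) <= 8 * N.
  have : KV * (dk * V / 8) <= KV * (t * (3 / 8) * A1 + dk * V / 8).
    by rewrite ler_pM2l// lerDr; lra.
  by move=> /le_trans/(_ q1); lra.
have q4 : KV * (t * (3 / 8) * A1) <= N.
  by apply: le_trans q1; rewrite ler_pM2l// lerDl; lra.
have AA : KV * (t * (A1 + A2)) <= 52 * N.
  have N0 : 0 <= N.
    by apply: le_trans q4; rewrite mulr_ge0 ?(ltW KV0)// mulrAC mulr_ge0.
  have : KV * (t * (3 / 8) * A2) <= 18 * N by lra.
  by move: q4; rewrite !mulrDr; lra.
apply: (@le_trans _ _ (A1 + A2)%:E); last first.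
  rewrite lee_fin ler_pdivlMr//.
  have -> : (A1 + A2) * KV = 2 ^+ k * (KV * (t * (A1 + A2))).
    rewrite /t; field; by rewrite expf_neq0.
  have -> : 52 * 2 ^+ k * N = 2 ^+ k * (52 * N) by ring.
  by rewrite ler_wpM2l// exprn_ge0.
rewrite EFinD -A1E -A2E.
have -> : B = side s `|` (side (- s) `\` side s).
  apply/seteqP; split => x; last by move=> [[]|[[]]].
  move=> Bx; have [sx|sx] := leP (s * alpha) (s * b x); first by left.
  right; split; last by move=> [_ /=]; rewrite leNgt sx.
  by split=> //=; rewrite !mulNr lerN2 ltW.
rewrite ge0_integral_setU//.
- apply: leeD => //; apply: ge0_subset_integral => //.
  + exact: measurableD.
  + exact: measurable_funTS.
- exact: measurableD.
- exact: measurable_funTS.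
- by apply/disj_setPS => x [? []].
Qed.

End median_estimate.

(** * Weights *)

(* [x^-1 = (x^2)^-1 x] also at [0], where the library's power of a nonnegative
   base applies. *)
Lemma measurable_invr d (T : measurableType d) (R : realType) (D : set T) (f : T -> R) :
  measurable_fun D f -> measurable_fun D (fun x => (f x)^-1).
Proof.
move=> mf; rewrite (_ : (fun _ => _) = (fun x => (f x ^+ 2) `^ (-1) * f x)).
  apply: measurable_funM => //.
  by apply: (measurableT_comp (measurable_powR _)); exact: measurable_funX.
apply/funext => x; rewrite powR_inv1 ?sqr_ge0//.
have [->|fx0] := eqVneq (f x) 0; first by rewrite invr0 mulr0.
by field.
Qed.

Section weight_theory.
Context {R : realType} {d : nat}.
Implicit Types (w b : 'rV[R]_d -> R) (c : 'rV[R]_d) (r : R).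

Lemma Lloc_eball (k : nat) b c r : Lloc k b ->
  (\int[leb d]_(x in eball c r) (`|b x| ^+ k)%:E < +oo)%E.
Proof.
move=> [mb Lb]; apply: le_lt_trans (Lb _ (@compact_ebox R d c r)).
apply: ge0_subset_integral.
- exact: measurable_eball.
- have -> : ebox c r = [set x | forall i, `[c ord0 i - r, c ord0 i + r]%classic (x ord0 i)].
    by apply/seteqP; split => x h i; have := h i; rewrite /= in_itv.
  rewrite measurable_boxes; apply: sub_sigma_algebra.
  by exists (fun i => `[c ord0 i - r, c ord0 i + r]%classic) => // i; exact: measurable_itv.
- apply/measurable_EFinP/measurable_funTS/measurable_funX.
  exact: measurableT_comp.
- by move=> x _; rewrite lee_fin exprn_ge0.
- exact: eball_sub_ebox.
Qed.

Lemma ae_weight w (B : set 'rV[R]_d) : measurable_fun setT w -> measurable B ->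
  {ae leb d, forall x, 0 < w x} ->
  weight w B = (\int[leb d]_(x in B) `|w x|%:E)%E.
Proof.
move=> mw mB w0; apply: ae_eq_integral => //.
- by apply/measurable_EFinP; exact: measurable_funTS.
- by apply/measurable_EFinP/measurable_funTS; exact: measurableT_comp.
- by apply: filterS w0 => x w0 _; rewrite gtr0_norm.
Qed.

Lemma weight_gt0 w (B : set 'rV[R]_d) : measurable_fun setT w -> measurable B ->
  {ae leb d, forall x, 0 < w x} -> (0 < leb d B)%E -> (0 < weight w B)%E.
Proof.
move=> mw mB w0 B0; rewrite ae_weight// lt_neqAle integral_ge0 ?andbT//; last first.
apply/eqP => /esym h.
have mwE : measurable_fun B (EFin \o w) by apply/measurable_EFinP; exact: measurable_funTS.
have /(ae_eq_integral_abs _ mB mwE) wB0 : (\int[leb d]_(x in B) `|(EFin \o w) x| = 0)%E.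
  by rewrite -[RHS]h; apply: eq_integral => x _.
have nB : (leb d).-negligible B.
  have : \forall x \ae leb d, ~ B x.
    by apply: filterS2 w0 wB0 => x wx h' Bx; have [] := h' Bx; move: wx => /[swap] ->; rewrite ltxx.
  by apply: negligibleS => x Bx; apply.
by move: B0; rewrite (measure_negligible mB nB) ltxx.
Qed.

Lemma weight_subset w (A B : set 'rV[R]_d) : measurable_fun setT w ->
  {ae leb d, forall x, 0 < w x} -> measurable A -> measurable B -> A `<=` B ->
  (weight w A <= weight w B)%E.
Proof.
move=> mw w0 mA mB AB; rewrite !ae_weight//; apply: ge0_subset_integral => //.
by apply/measurable_EFinP/measurable_funTS; exact: measurableT_comp.
Qed.

Lemma measurable_dual_weight (p : R) w : measurable_fun setT w ->
  measurable_fun setT (dual_weight p w).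
Proof.
move=> mw; exact: (measurableT_comp (measurable_powR _) mw).
Qed.

Lemma dual_weight_gt0 (p : R) w : {ae leb d, forall x, 0 < w x} ->
  {ae leb d, forall x, 0 < dual_weight p w x}.
Proof. by apply: filterS => x w0; exact: powR_gt0. Qed.

Lemma Ap_ball (p : R) w : (0 < d)%N -> 1 < p -> Ap p w -> exists2 Q, 0 < Q &
  forall c r, 0 < r -> exists W W', [/\ 0 < W, 0 < W',
    weight w (eball c r) = W%:E, weight (dual_weight p w) (eball c r) = W'%:E &
    ln (W / (ball_vol R d * r ^+ d)) +
      (p - 1) * ln (W' / (ball_vol R d * r ^+ d)) <= ln Q].
Proof.
move=> d0 p1 [[mw Lw] w0 Aoo]; have p10 : 0 < p - 1 by rewrite subr_gt0.
have [Q AQ] : exists Q : R, (Ap_const p w <= Q%:E)%E.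
  by case: (Ap_const p w) Aoo => [q _||] //; [exists q|exists 0; rewrite leNye].
have Q1 : 0 < Num.max 1 Q by rewrite lt_max ltr01.
exists (Num.max 1 Q) => //.
move=> c r r0; set V := ball_vol R d * r ^+ d.
have V0 : 0 < V by rewrite mulr_gt0 ?exprn_gt0// ball_vol_gt0.
have BV : leb d (eball c r) = V%:E by exact: leb_eball.
have mB : measurable (eball c r) by exact: measurable_eball.
have B0 : (0 < leb d (eball c r))%E by rewrite BV lte_fin.
have Wp := weight_gt0 mw mB w0 B0.
have W'p := weight_gt0 (measurable_dual_weight p mw) mB (dual_weight_gt0 p w0) B0.
have Woo : (weight w (eball c r) < +oo)%E.
  rewrite ae_weight//; have := @Lloc_eball 1 w c r (conj mw Lw).
  by under eq_integral do rewrite expr1.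
have : (weight w (eball c r) / leb d (eball c r) *
    (weight (dual_weight p w) (eball c r) / leb d (eball c r)) `^ (p - 1) <= Q%:E)%E.
  apply: le_trans AQ; apply: ereal_sup_ubound; exists c => //; exists r => //.
rewrite BV inver gt_eqF//.
case: (weight w (eball c r)) Wp Woo => [W||]//; rewrite lte_fin => W0 _.
have WV0 : 0 < W * V^-1 by rewrite divr_gt0.
case: (weight (dual_weight p w) (eball c r)) W'p => [W'||]//; last first.
  by move=> _; rewrite gt0_mulye ?lte_fin ?invr_gt0// poweRyr ?gt_eqF// -EFinM gt0_muley ?lte_fin// leye_eq.
rewrite lte_fin => W'0.
have -> : (W'%:E * (V^-1)%:E = (W' * V^-1)%:E)%E by [].
rewrite poweR_EFin -!EFinM lee_fin => hQ.
exists W, W'; split=> //.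
have W'V0 : 0 < W' * V^-1 by rewrite divr_gt0.
rewrite -ln_powR -lnM ?posrE ?powR_gt0// ler_ln ?posrE ?mulr_gt0 ?powR_gt0//.
  by rewrite le_max hQ orbT.
by rewrite invr_gt0.
Qed.

Lemma ln_le_sub1 (y : R) : 0 < y -> ln y <= y - 1.
Proof. by move=> y0; have := @le_ln1Dx R (y - 1); rewrite subrKC; apply; lra. Qed.

Lemma weighted_log_ge0 (p : R) (k : nat) (lambda mu : 'rV[R]_d -> R) (B : set 'rV[R]_d)
    (V N m l : R) :
  let nu_k := fun x => ((mu x / lambda x) `^ p^-1) `^ (k%:R)^-1 in
  (0 < k)%N -> 1 < p -> measurable_fun setT lambda -> measurable_fun setT mu ->
  {ae leb d, forall x, 0 < lambda x} -> {ae leb d, forall x, 0 < mu x} ->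
  measurable B -> leb d B = V%:E -> 0 < V -> 0 < N -> 0 < m -> 0 < l ->
  weight nu_k B = N%:E -> weight (dual_weight p mu) B = m%:E -> weight lambda B = l%:E ->
  0 <= k%:R * ln (N / V) + (p - 1) / p * ln (m / V) + p^-1 * ln (l / V).
Proof.
move=> nu_k k0 p1 mla mmu la0 mu0 mB BV V0 N0 m0 l0 NE mE lE.
have p0 : 0 < p by lra.
have p10 : 0 < p - 1 by lra.
have kr0 : 0 < k%:R :> R by rewrite ltr0n.
pose t1 : R := k%:R / (k%:R + 1).
pose t2 : R := (p - 1) / (p * (k%:R + 1)).
pose t3 : R := (p * (k%:R + 1))^-1.
have kr1 : 0 < k%:R + 1 :> R by lra.
have t10 : 0 < t1 by rewrite divr_gt0.
have t20 : 0 < t2 by rewrite divr_gt0// mulr_gt0.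
have t30 : 0 < t3 by rewrite invr_gt0 mulr_gt0.
have kp0 : k%:R + 1 != 0 :> R by rewrite gt_eqF.
have pn0 : p != 0 by rewrite gt_eqF.
have t123 : t1 + t2 + t3 = 1.
  by rewrite /t1 /t2 /t3; field; rewrite kp0.
pose L := t1 * ln (N / V) + t2 * ln (m / V) + t3 * ln (l / V).
suff L0 : 0 <= L.
  have -> : k%:R * ln (N / V) + (p - 1) / p * ln (m / V) + p^-1 * ln (l / V) =
     (k%:R + 1) * L.
    by rewrite /L /t1 /t2 /t3; field; rewrite kp0.
  by rewrite mulr_ge0// ltW.
rewrite leNgt; apply/negP => Lneg.
have mnu : measurable_fun setT nu_k.
  apply: (measurableT_comp (measurable_powR _)).
  apply: (measurableT_comp (measurable_powR _)).
  exact: measurable_funM mmu (measurable_invr mla).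
have mdm := measurable_dual_weight p mmu.
have nuE : (\int[leb d]_(x in B) (nu_k x)%:E = N%:E)%E by [].
have NV0 : 0 < N / V by rewrite divr_gt0.
have mV0 : 0 < m / V by rewrite divr_gt0.
have lV0 : 0 < l / V by rewrite divr_gt0.
pose c1 := t1 / (N / V); pose c2 := t2 / (m / V); pose c3 := t3 / (l / V).
have c10 : 0 < c1 by rewrite divr_gt0.
have c20 : 0 < c2 by rewrite divr_gt0.
have c30 : 0 < c3 by rewrite divr_gt0.
have nu0 x : 0 <= nu_k x by exact: powR_ge0.
have dm0 x : 0 <= dual_weight p mu x by exact: powR_ge0.
have EV : (\int[leb d]_(x in B) ((c1 * nu_k x)%:E + ((c2 * dual_weight p mu x)%:E +
    (c3 * `|lambda x|)%:E)) = V%:E)%E.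
  have mc (c : R) (h : 'rV[R]_d -> R) : measurable_fun setT h ->
      measurable_fun B (fun x => (c * h x)%:E).
    by move=> mh; apply/measurable_EFinP/measurable_funTS; exact: measurable_funM.
  have mal : measurable_fun setT (fun x => `|lambda x|) by exact: measurableT_comp.
  have Zc (c v : R) (h : 'rV[R]_d -> R) : 0 <= c -> measurable_fun setT h ->
     (forall x, 0 <= h x) -> (\int[leb d]_(x in B) (h x)%:E = v%:E)%E ->
     (\int[leb d]_(x in B) (c * h x)%:E = (c * v)%:E)%E.
    move=> cge mh h0 hv; under eq_integral do rewrite EFinM.
    have mhE : measurable_fun B (EFin \o h).
      by apply/measurable_EFinP; exact: measurable_funTS.
    by rewrite (ge0_integralZl_EFin _ mB _ mhE cge) ?hv// => x _; rewrite lee_fin.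
  rewrite ge0_integralD//; last 4 first.
  - by move=> x _; rewrite lee_fin mulr_ge0// ltW.
  - exact: mc.
  - by move=> x _; rewrite -EFinD lee_fin addr_ge0 // mulr_ge0 // ltW.
  - by apply: emeasurable_funD; exact: mc.
  rewrite ge0_integralD//; last 4 first.
  - by move=> x _; rewrite lee_fin mulr_ge0// ltW.
  - exact: mc.
  - by move=> x _; rewrite lee_fin mulr_ge0// ltW.
  - exact: mc.
  rewrite (Zc c1 N _ (ltW c10) mnu nu0)// (Zc c2 m _ (ltW c20) mdm dm0)//.
  rewrite (Zc c3 l _ (ltW c30) mal) => [|x|]; last 2 first.
  - exact: normr_ge0.
  - by rewrite -lE ae_weight.
  rewrite -!EFinD -[V in RHS]mul1r -t123 /c1 /c2 /c3; congr EFin; field.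
  by rewrite !gt_eqF.
have : ((1 - L)%:E * V%:E <= V%:E)%E.
  rewrite -[leRHS]EV -BV -integral_cst//; apply: ae_ge0_le_integral => //.
  - by move=> x _; rewrite lee_fin; lra.
  - by move=> x _; rewrite -!EFinD lee_fin !addr_ge0 // mulr_ge0 // ltW.
  - apply/measurable_EFinP/measurable_funTS; apply: measurable_funD.
      exact: measurable_funM.
    apply: measurable_funD; first exact: measurable_funM.
    by apply: measurable_funM => //; exact: measurableT_comp.
  apply: filterS2 la0 mu0 => x lx mx _; rewrite -!EFinD lee_fin.
  have lnx (t u a : R) : 0 < t -> 0 < u -> 0 < a -> t * (1 + (ln u - ln a)) <= t / a * u.
    move=> t0 u0 a0; rewrite -mulrA ler_pM2l// -ln_div ?posrE// [a^-1 * u]mulrC.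
    by have := ln_le_sub1 (divr_gt0 u0 a0); lra.
  have nux : 0 < nu_k x by rewrite !powR_gt0// divr_gt0.
  have dmx : 0 < dual_weight p mu x by rewrite powR_gt0.
  have h1 := lnx _ _ _ t10 nux NV0.
  have h2 := lnx _ _ _ t20 dmx mV0.
  have h3 := lnx _ _ _ t30 lx lV0.
  rewrite (gtr0_norm lx).
  have S0 : t1 * ln (nu_k x) + t2 * ln (dual_weight p mu x) + t3 * ln (lambda x) = 0.
    rewrite /nu_k /dual_weight !ln_powR ln_div ?posrE// /t1 /t2 /t3; field.
    by rewrite kp0 pn0 (gt_eqF p10) (gt_eqF kr0).
  apply: (@le_trans _ _ (t1 * (1 + (ln (nu_k x) - ln (N / V))) +
     (t2 * (1 + (ln (dual_weight p mu x) - ln (m / V))) +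
      t3 * (1 + (ln (lambda x) - ln (l / V)))))); last first.
    by apply: lerD => //; exact: lerD.
  rewrite -subr_ge0 (_ : _ - _ = (t1 + t2 + t3 - 1) + (t1 * ln (nu_k x) +
     t2 * ln (dual_weight p mu x) + t3 * ln (lambda x))); last by rewrite /L; ring.
  by rewrite S0 t123 subrr addr0.
by rewrite -EFinM lee_fin -[leRHS]mul1r ler_pM2r//; lra.
Qed.

(* [lambda'(B(x0, r))] is compared with [lambda(B(y0, r))] through the [A_p]
   condition on a ball centred at [y0] that contains both. *)
Lemma weight_companion (p : R) (k : nat) (lambda mu : 'rV[R]_d -> R) (M : R) :
  let nu_k := fun x => ((mu x / lambda x) `^ p^-1) `^ (k%:R)^-1 in
  (0 < d)%N -> (0 < k)%N -> 1 < p -> Ap p lambda -> Ap p mu -> 0 <= M ->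
  exists2 C, 0 < C & forall x0 y0 r N, 0 < r -> enorm (x0 - y0) <= M * r ->
    weight nu_k (eball y0 r) = N%:E -> 0 < N -> exists m l,
    [/\ 0 < m, 0 < l, weight mu (eball y0 r) = m%:E,
        weight (dual_weight p lambda) (eball x0 r) = l%:E &
        m `^ p^-1 * l `^ ((p - 1) / p) <=
        C * (N / (ball_vol R d * r ^+ d)) ^+ k * (ball_vol R d * r ^+ d)].
Proof.
move=> nu_k d0 k0 p1 Al Am M0.
have [Ql Ql0 hl] := Ap_ball d0 p1 Al; have [Qm Qm0 hm] := Ap_ball d0 p1 Am.
have [[mla _] la0 _] := Al; have [[mmu _] mu0 _] := Am.
have p0 : 0 < p by lra.
have M10 : 0 < M + 1 by lra.
pose h := ln ((M + 1) ^+ d).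
exists (expR ((ln Qm + ln Ql) / p + h)); first exact: expR_gt0.
move=> x0 y0 r N r0 xyM NE N0.
set V := ball_vol R d * r ^+ d.
have V0 : 0 < V by rewrite mulr_gt0 ?exprn_gt0// ball_vol_gt0.
have BV : leb d (eball y0 r) = V%:E by exact: leb_eball.
have [m [mm [m0 mm0 mE mmE hX]]] := hm y0 r r0.
have [ly [_ [ly0 _ lyE _ _]]] := hl y0 r r0.
have [_ [l [_ l0 _ lE _]]] := hl x0 r r0.
have Mr0 : 0 < (M + 1) * r by rewrite mulr_gt0.
have [W [W' [W0 W'0 WE W'E hW]]] := hl y0 _ Mr0.
exists m, l; split=> //.
have mb c s : measurable (eball c s) by exact: measurable_eball.
have lyW : ly <= W.
  rewrite -lee_fin -lyE -WE; apply: weight_subset => //; apply: eball_subset.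
  by rewrite subrr enorm0 add0r mulrDl mul1r lerDr mulr_ge0// ltW.
have lW' : l <= W'.
  rewrite -lee_fin -lE -W'E; apply: weight_subset => //.
  - exact: measurable_dual_weight.
  - exact: dual_weight_gt0.
  - by apply: eball_subset; rewrite mulrDl mul1r lerD2r.
have VE : ball_vol R d * ((M + 1) * r) ^+ d = (M + 1) ^+ d * V.
  by rewrite exprMn /V mulrCA.
have Md0 : 0 < (M + 1) ^+ d by rewrite exprn_gt0.
have big (u v : R) : 0 < u -> u <= v -> ln u - ln V - h <= ln (v / ((M + 1) ^+ d * V)).
  move=> u0 uv; have v0 : 0 < v by exact: lt_le_trans uv.
  have MV0 : 0 < (M + 1) ^+ d * V by rewrite mulr_gt0.
  have -> : ln (v / ((M + 1) ^+ d * V)) = ln v - (h + ln V).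
    rewrite ln_div ?posrE//; congr (_ - _); by rewrite lnM ?posrE.
  have : ln u <= ln v by rewrite ler_ln ?posrE.
  lra.
rewrite VE in hW.
have b1 := big _ _ ly0 lyW; have b2 := big _ _ l0 lW'.
have J := weighted_log_ge0 k0 p1 mla mmu la0 mu0 (mb y0 r) BV V0 N0 mm0 ly0 NE mmE lyE.
rewrite !ln_div ?posrE// in hX J.
have rhs0 : 0 < expR ((ln Qm + ln Ql) / p + h) * (N / V) ^+ k.
  by rewrite mulr_gt0 ?expR_gt0// exprn_gt0// divr_gt0.
have lhs0 : 0 < m `^ p^-1 * l `^ ((p - 1) / p) by rewrite mulr_gt0 ?powR_gt0.
rewrite -ler_ln ?posrE//; last exact: mulr_gt0 rhs0 V0.
rewrite lnM ?posrE ?powR_gt0// !ln_powR lnM ?posrE//.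
rewrite lnM ?posrE ?expR_gt0 ?exprn_gt0 ?divr_gt0// expRK lnXn ?divr_gt0//.
rewrite ln_div ?posrE// -mulr_natl.
rewrite -(ler_pM2l p0).
have -> : p * (p^-1 * ln m + (p - 1) / p * ln l) = ln m + (p - 1) * ln l.
  by field; rewrite gt_eqF.
have -> : p * ((ln Qm + ln Ql) / p + h + k%:R * (ln N - ln V) + ln V) =
  ln Qm + ln Ql + p * h + p * (k%:R * (ln N - ln V)) + p * ln V.
  by field; rewrite gt_eqF.
have {}J : 0 <= p * (k%:R * (ln N - ln V)) + (p - 1) * (ln mm - ln V) + (ln ly - ln V).
  have -> : p * (k%:R * (ln N - ln V)) + (p - 1) * (ln mm - ln V) + (ln ly - ln V) =
    p * (k%:R * (ln N - ln V) + (p - 1) / p * (ln mm - ln V) + p^-1 * (ln ly - ln V)).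
    by field; rewrite gt_eqF.
  by rewrite mulr_ge0// ltW.
have b2' : (p - 1) * (ln l - ln V - h) <= (p - 1) * ln (W' / ((M + 1) ^+ d * V)).
  by rewrite ler_pM2l// subr_gt0.
move: b1 b2' hW hX J; rewrite !mulrBr !mulrBl !mul1r; lra.
Qed.

End weight_theory.

Section oscillation.
Context d (T : measurableType d) (R : realType) (m : {measure set T -> \bar R}).
Variables (B : set T) (V : R).
Hypotheses (mB : measurable B) (V0 : 0 < V) (BV : m B = V%:E).

Lemma integral_le_power (g : T -> R) (k : nat) (t : R) : (0 < k)%N ->
  measurable_fun setT g -> (forall x, 0 <= g x) -> 0 <= t ->
  (\int[m]_(x in B) (g x ^+ k)%:E <= (t ^+ k * V)%:E)%E ->
  (\int[m]_(x in B) (g x)%:E <= (2 * t * V)%:E)%E.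
Proof.
move=> k0 mg g0 t0 gk; apply/lee_addgt0Pr => e e0.
pose s := t + e / (2 * V).
have V20 : 0 < 2 * V by rewrite mulr_gt0.
have s0 : 0 < s by rewrite ltr_wpDl// divr_gt0.
have sk0 : 0 < s * s ^- k by rewrite mulr_gt0// invr_gt0 exprn_gt0.
have mgk : measurable_fun B (fun x => (g x ^+ k)%:E).
  by apply/measurable_EFinP/measurable_funTS; exact: measurable_funX.
have -> : ((2 * t * V)%:E + e%:E = (s * V)%:E + (s * s ^- k * (s ^+ k * V))%:E)%E.
  rewrite (_ : s * s ^- k * (s ^+ k * V) = s * V); last first.
    by rewrite mulrA mulfVK// expf_neq0// gt_eqF.
  by rewrite -!EFinD /s; congr EFin; field; rewrite gt_eqF.
apply: (@le_trans _ _ (\int[m]_(x in B) (s%:E + (s * s ^- k)%:E * (g x ^+ k)%:E))%E).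
  apply: ge0_le_integral.
  - by [].
  - by move=> x _; rewrite lee_fin.
  - by apply/measurable_EFinP; exact: measurable_funTS.
  - by apply: emeasurable_funD => //; exact: measurable_funeM.
  move=> x _; rewrite -EFinM -EFinD lee_fin.
  have [gs|gs] := leP (g x) s.
    by rewrite (le_trans gs)// lerDl mulr_ge0 ?exprn_ge0// ltW.
  apply: (@le_trans _ _ (s * (s ^- k * g x ^+ k))); last first.
    by rewrite mulrA lerDr ltW.
  rewrite -exprVn -exprMn -{1}[g x](mulVKf (lt0r_neq0 s0)) ler_pM2l//.
  have gs1 : 1 <= s^-1 * g x by rewrite mulrC ler_pdivlMr// mul1r ltW.
  by rewrite -{1}[_ * g x]expr1 ler_weXn2l.
have s0E x : B x -> (0 <= s%:E)%E by rewrite lee_fin ltW.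
have gE x : B x -> (0 <= (s * s ^- k)%:E * (g x ^+ k)%:E)%E.
  by rewrite -EFinM lee_fin mulr_ge0 ?exprn_ge0// ltW.
have msgk := measurable_funeM (s * s ^- k)%:E mgk.
rewrite (ge0_integralD _ mB s0E (measurable_cst _) gE msgk).
apply: leeD.
  by rewrite EFinM -BV -integral_cst.
rewrite ge0_integralZl_EFin ?(ltW sk0)//; last first.
  by move=> x _; rewrite lee_fin exprn_ge0.
rewrite [leRHS]EFinM lee_wpmul2l ?lee_fin ?(ltW sk0)//.
apply: (le_trans gk); rewrite lee_fin ler_wpM2r ?(ltW V0)//.
by rewrite lerXn2r ?nnegrE ?(ltW s0)// lerDl ltW// divr_gt0.
Qed.

Lemma integral_osc_le (b : T -> R) (a D : R) : measurable_fun setT b ->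
  (\int[m]_(x in B) `|b x - a|%:E <= D%:E)%E ->
  (\int[m]_(x in B) `|b x - (\int[m]_(x in B) b x)%R / V|%:E <= (2 * D)%:E)%E.
Proof.
move=> mb bD.
have mba (c : R) : measurable_fun setT (fun x => `|b x - c|).
  by apply: measurableT_comp => //; exact: measurable_funB.
have mbaE (c : R) : measurable_fun B (fun x => `|b x - c|%:E).
  by apply/measurable_EFinP; exact: measurable_funTS.
have iba : m.-integrable B (EFin \o (fun x => b x - a)).
  apply/integrableP; split.
    by apply/measurable_EFinP/measurable_funTS; exact: measurable_funB.
  exact: le_lt_trans bD (ltry _).
have ia : m.-integrable B (EFin \o (fun=> a)).
  apply/integrableP; split; first exact: measurable_cst.
  apply: (@le_lt_trans _ _ (`|a|%:E * m B)%E); first by rewrite -integral_cst.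
  by rewrite BV -EFinM ltry.
have ib : m.-integrable B (EFin \o b).
  have := integrableD mB iba ia; apply: eq_integrable => // x _ /=.
  by rewrite -EFinD subrK.
have E1 : \int[m]_(x in B) (b x - a) = \int[m]_(x in B) b x - a * V.
  by rewrite RintegralB// Rintegral_cst// BV.
have avg : `|\int[m]_(x in B) b x / V - a| * V <= D.
  rewrite -{2}(gtr0_norm V0) -normrM mulrBl divfK ?gt_eqF// -E1.
  apply: le_trans (le_normr_Rintegral mB iba) _.
  rewrite -lee_fin /Rintegral fineK//.
  have := integrable_norm iba => /(integrable_fin_num mB).
  by [].
set A := _ / V in avg *.
apply: (@le_trans _ _ (\int[m]_(x in B) (`|b x - a|%:E + `|A - a|%:E))%E).
  apply: ge0_le_integral => //.
  - by apply: emeasurable_funD.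
  - move=> x _; rewrite -EFinD lee_fin.
    by rewrite [`|A - a|]distrC (le_trans _ (ler_normD _ _))// subrKA.
rewrite ge0_integralD//.
rewrite mulr_natl mulr2n EFinD leeD//.
apply: (@le_trans _ _ (`|A - a|%:E * m B)%E); first by rewrite -integral_cst.
by rewrite BV -EFinM lee_fin.
Qed.

End oscillation.

Section bounded_functions.
Context {R : realType} {d : nat}.
Local Notation normc := Normc.normc.

Lemma Linfty_norm_le1 (f : 'rV[R]_d -> R[i]) : (forall x, normc (f x) <= 1) ->
  (Linfty_norm (leb d) f <= 1)%E.
Proof.
move=> f1; rewrite /Linfty_norm unlock /Lnorm; case: ifPn => _ //.
apply/ess_supP; apply: aeW => x /=.
by rewrite lee_fin ger0_norm ?normc_ge0.
Qed.

Lemma Linfty_on_indic (E D : set 'rV[R]_d) (z : R[i]) : measurable E -> E `<=` D ->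
  normc z = 1 -> Linfty_on (leb d) D (fun y => z * ((\1_E y : R)%:C)%C) /\
  (Linfty_norm (leb d) (fun y => (z * ((\1_E y : R)%:C)%C)%R) <= 1)%E.
Proof.
move=> mE ED z1.
have le1 : (Linfty_norm (leb d) (fun y => (z * ((\1_E y : R)%:C)%C)%R) <= 1)%E.
  apply: Linfty_norm_le1 => x; rewrite Normc.normcM z1 mul1r normcR indicE.
  by case: (_ \in _); rewrite ?normr1 ?normr0.
split=> //; split.
- have m1 : measurable_fun setT (\1_E : 'rV[R]_d -> R) by exact: measurable_indic.
  split.
    rewrite (_ : (fun _ => _) = (fun x => complex.Re z * \1_E x)).
      exact: measurable_funM.
    by apply/funext => x; rewrite mulrC Re_realM mulrC.
  rewrite (_ : (fun _ => _) = (fun x => complex.Im z * \1_E x)).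
    exact: measurable_funM.
  by apply/funext => x; case: z {z1 le1} => u v /=; rewrite mulr0 add0r.
- exact: le_lt_trans le1 (ltry _).
- apply: aeW => x; rewrite mulrCA; congr (_ * _).
  rewrite -rmorphM; congr (_%:C)%C; rewrite !indicE.
  have [Ex|Ex] := pselect (E x); last by rewrite (memNset Ex) mulr0.
  by rewrite (mem_set Ex) (mem_set (ED _ Ex)) mulr1.
Qed.

Lemma commutator_form_offdiag (k : nat) (b : 'rV[R]_d -> R)
    (K : 'rV[R]_d -> 'rV[R]_d -> R[i]) (E F : set 'rV[R]_d) (z : R[i]) :
  (forall x, E x -> ~ F x) ->
  commutator_form k b (offdiag K) (fun y => z * ((\1_E y : R)%:C)%C)
    (fun x => ((\1_F x : R)%:C)%C) =
  commutator_form k b K (fun y => z * ((\1_E y : R)%:C)%C)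
    (fun x => ((\1_F x : R)%:C)%C).
Proof.
move=> EF; rewrite /commutator_form; congr (cintegral _ _).
apply/funext => x; congr (cintegral _ _); apply/funext => y.
rewrite /offdiag; case: eqP => // ->.
have [Ey|Ey] := pselect (E y); last by rewrite [\1_E y]indicE (memNset Ey) !mulr0 !mul0r.
by rewrite [\1_F y]indicE (memNset (EF _ Ey)) !mulr0.
Qed.

End bounded_functions.

Theorem theorem4p3p2 (R : realType) (d : nat) (hd : (0 < d)%N)
  (K : 'rV[R]_d -> 'rV[R]_d -> R[i]) (hK : nondegenerate_kernel K)
  (k : nat) (hk : (0 < k)%N) (p : R) (hp : 1 < p)
  (lambda mu : 'rV[R]_d -> R) (hlambda : Ap p lambda) (hmu : Ap p mu)
  (kappa : R) (hkappa : 0 < kappa) :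
  let p' := p / (p - 1) in
  let nu := fun x => (mu x / lambda x) `^ p^-1 in
  let nu_k := fun x => nu x `^ (k%:R)^-1 in
  exists C : R, forall (b : 'rV[R]_d -> R) (Theta : R),
    Lloc k b -> 0 <= Theta ->
    (forall (c c' : 'rV[R]_d) (r : R) (f g : 'rV[R]_d -> R[i]),
      let B := eball c r in
      let B' := eball c' r in
      0 < r -> kappa * r <= setdist B B' ->
      Linfty_on (leb d) B f -> Linfty_on (leb d) B' g ->
      ((Normc.normc (commutator_form k b K f g))%:E <=
       Theta%:E *
       (Linfty_norm (leb d) f * weight mu B `^ p^-1) *
       (Linfty_norm (leb d) g * weight (dual_weight p lambda) B' `^ p'^-1))%E) ->
    BMO nu_k b /\ (BMO_norm nu_k b <= (C * Theta `^ (k%:R)^-1)%:E)%E.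
Proof.
move=> p' nu nu_k.
have kr0 : (k%:R : R) != 0 by rewrite pnatr_eq0 -lt0n.
pose eps : R := 2 ^- k / 8 * 4 ^- k.
have eps0 : 0 < eps by rewrite mulr_gt0 ?divr_gt0 ?invr_gt0 ?exprn_gt0.
have heps : 4 ^+ k * eps <= 2 ^- k / 8.
  by rewrite /eps mulrC mulfVK// expf_neq0.
have [mK1 [M [c [M0 c0 comp]]]] := nondegenerate_companions hd hkappa eps0 hK.
have [C1 C10 wc] := weight_companion hd hk hp hlambda hmu M0.
have v0 : 0 < ball_vol R d by exact: ball_vol_gt0.
pose Ck := 52 * 2 ^+ k / (c * ball_vol R d) * C1.
have Ck0 : 0 < Ck.
  by rewrite mulr_gt0// divr_gt0 ?mulr_gt0// exprn_gt0.
have [[mla _] la0 _] := hlambda; have [[mmu _] mu0 _] := hmu.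
have mnu : measurable_fun setT nu_k.
  apply: (measurableT_comp (measurable_powR _)).
  apply: (measurableT_comp (measurable_powR _)).
  exact: measurable_funM mmu (measurable_invr mla).
have nu0 : {ae leb d, forall x, 0 < nu_k x}.
  by apply: filterS2 la0 mu0 => x lx mx; rewrite !powR_gt0// divr_gt0.
exists (4 * Ck `^ (k%:R)^-1) => b Theta Lb Theta0 hform.
suff main : (BMO_norm nu_k b <= (4 * Ck `^ (k%:R)^-1 * Theta `^ (k%:R)^-1)%:E)%E.
  by split=> //; exact: le_lt_trans main (ltry _).
apply: ub_ereal_sup => _ [y0 _ [r /= r0 <-]].
set B := eball y0 r; set V := ball_vol R d * r ^+ d.
have V0 : 0 < V by rewrite mulr_gt0 ?exprn_gt0.
have mB : measurable B by exact: measurable_eball.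
have BV : leb d B = V%:E by exact: leb_eball.
have rhs0 : 0 <= 4 * Ck `^ (k%:R)^-1 * Theta `^ (k%:R)^-1.
  by rewrite !mulr_ge0 ?powR_ge0.
have : (0 < weight nu_k B)%E by apply: weight_gt0 => //; rewrite BV lte_fin.
case NE : (weight nu_k B) => [N||]//; last by rewrite invey mule0 lee_fin.
rewrite lte_fin => N0.
have [x0 [K0 [sep dist cK hy hx]]] := comp y0 r r0.
have [m [l [m0 l0 mE lE ml]]] := wc x0 y0 r N r0 dist NE N0.
set B' := eball x0 r in sep hy hx lE.
have mB' : measurable B' by exact: measurable_eball.
have BV' : leb d B' = V%:E by exact: leb_eball.
have [mb _] := Lb.
have [alpha [a1 a2]] := exists_median mb mB V0 BV.
have [beta [b1 b2]] := exists_median mb mB' V0 BV'.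
have rd0 : 0 < r ^+ d by rewrite exprn_gt0.
have K00 : 0 < Normc.normc K0 by apply: lt_le_trans cK; rewrite mulr_gt0// invr_gt0.
have p'V : p'^-1 = (p - 1) / p by rewrite /p' invf_div.
pose N1 := Theta * (m `^ p^-1 * l `^ p'^-1).
have disj x : B x -> ~ B' x.
  by move=> Bx Bx'; apply: (setdist_gt0_disj _ Bx Bx'); rewrite (lt_le_trans _ sep)// mulr_gt0.
have hN (z : R[i]) (E F : set 'rV[R]_d) : Normc.normc z = 1 ->
    measurable E -> E `<=` B -> measurable F -> F `<=` B' ->
    Normc.normc (commutator_form k b (offdiag K) (fun y => z * ((\1_E y : R)%:C)%C)
      (fun x => ((\1_F x : R)%:C)%C)) <= N1.
  move=> z1 mE' EB mF FB.
  rewrite commutator_form_offdiag => [|x /EB/disj nBx /FB//].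
  have [fon f1] := Linfty_on_indic mE' EB z1.
  have [] := Linfty_on_indic (z := 1) mF FB (Normc.normc1 R).
  under eq_fun do rewrite mul1r; move=> gon g1.
  rewrite -lee_fin; apply: le_trans (hform y0 x0 r _ _ r0 sep fon gon) _.
  rewrite -/B -/B' mE lE !poweR_EFin /N1 mulrA !EFinM.
  have L0 (h : 'rV[R]_d -> R[i]) : (0 <= Linfty_norm (leb d) h)%E by exact: Lnorm_ge0.
  apply: lee_pmul; last 2 first.
  - by apply: lee_wpmul2l; rewrite ?lee_fin// -[leRHS]mul1e lee_wpmul2r// lee_fin powR_ge0.
  - by rewrite -[leRHS]mul1e lee_wpmul2r// lee_fin powR_ge0.
  - by rewrite !mule_ge0// lee_fin ?powR_ge0.
  - by rewrite mule_ge0// lee_fin powR_ge0.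
have hy' y : B y -> (\int[leb d]_(x in B') (Normc.normc (offdiag K x y - K0))%:E <=
    (eps * Normc.normc K0 * V)%:E)%E.
  by move=> /hy; rewrite BV' -EFinM.
have hx' x : B' x -> (\int[leb d]_(y in B) (Normc.normc (offdiag K x y - K0))%:E <=
    (eps * Normc.normc K0 * V)%:E)%E.
  by move=> /hx; rewrite BV -EFinM.
have est := median_estimate mK1 mb hk mB mB' V0 BV BV' K00 (ltW eps0) heps hy' hx'
  a1 a2 b1 b2 (Lloc_eball y0 r Lb) (Lloc_eball x0 r Lb) hN.
pose T := Ck `^ (k%:R)^-1 * Theta `^ (k%:R)^-1 * (N / V).
have T0 : 0 <= T by rewrite !mulr_ge0 ?powR_ge0 ?invr_ge0 ?ltW.
have rootK (a : R) : 0 <= a -> (a `^ (k%:R)^-1) ^+ k = a.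
  by move=> a0; rewrite -powR_mulrn ?powR_ge0// -powRrM mulVf// powRr1.
have Tk : T ^+ k = Ck * Theta * (N / V) ^+ k.
  by rewrite /T !exprMn !rootK// ltW.
have {}est : (\int[leb d]_(y in B) (`|b y - alpha| ^+ k)%:E <= (T ^+ k * V)%:E)%E.
  apply: (le_trans est); rewrite lee_fin Tk.
  have KV : c * ball_vol R d <= Normc.normc K0 * V.
    rewrite /V mulrCA [c * _]mulrC ler_pM2l//.
    by rewrite -ler_pdivrMr.
  have cv0 : 0 < c * ball_vol R d by rewrite mulr_gt0.
  have KV0 : 0 < Normc.normc K0 * V by exact: lt_le_trans KV.
  rewrite ler_pdivrMr//.
  apply: (@le_trans _ _ (Ck * Theta * (N / V) ^+ k * V * (c * ball_vol R d))); last first.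
    have NVk0 : 0 <= (N / V) ^+ k by rewrite exprn_ge0 ?divr_ge0 ?(ltW N0) ?(ltW V0).
    by apply: ler_wpM2l KV; exact: mulr_ge0 (mulr_ge0 (mulr_ge0 (ltW Ck0) Theta0) NVk0) (ltW V0).
  have -> : Ck * Theta * (N / V) ^+ k * V * (c * ball_vol R d) =
    52 * 2 ^+ k * (Theta * (C1 * (N / V) ^+ k * V)).
    by rewrite /Ck; field; rewrite !gt_eqF.
  rewrite ler_wpM2l ?mulr_ge0 ?exprn_ge0// ler_wpM2l// p'V.
  exact: ml.
have mba : measurable_fun setT (fun y => `|b y - alpha|).
  by apply: measurableT_comp => //; exact: measurable_funB.
have osc := integral_le_power mB V0 BV hk mba (fun y => normr_ge0 _) T0 est.
have := integral_osc_le mB V0 BV mb osc.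
rewrite /average -/B BV /= => {}osc.
rewrite inver gt_eqF//; apply: (@le_trans _ _ ((2 * (2 * T * V))%:E * (N^-1)%:E)%E).
  by rewrite lee_wpmul2r// lee_fin invr_ge0 ltW.
rewrite -EFinM lee_fin le_eqVlt; apply/orP; left; apply/eqP; rewrite /T; field.
by rewrite !gt_eqF.
Qed.
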